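(* Let $\varkappa\in\{1,-1\}$, let $G\subset \mathrm{End}(V)$ be a symplectic reflection group and let $H_{1,\eta}(G)$ be the associated symplectic reflection algebra. The dimension of the space of $\varkappa$-traces on the superalgebra $H_{1,\eta}(G)$ is equal to the number of conjugacy classes of $G$ consisting of elements without eigenvalue $\varkappa$. Moreover, each central function on the set of elements of $G$ without eigenvalue $\varkappa$ (i.e. each complex-valued function on this set that is constant on conjugacy classes of $G$) can be uniquely extended to a $\varkappa$-trace on $H_{1,\eta}(G)$.
   Context: Let $V=\mathbb{C}^{2N}$ carry a non-degenerate antisymmetric bilinear form $\omega$, and let $Sp(2N)\subset \mathrm{End}(V)$ be the group of linear maps preserving $\omega$. An element $R\in Sp(2N)$ is a symplectic reflection if $\mathrm{rk}(R-1)=2$. A symplectic reflection group is a finite subgroup $G\subset Sp(2N)$ generated by a set of symplectic reflections; $\mathcal{R}$ denotes the set of all symplectic reflections in $G$. For $R\in\mathcal{R}$ put $V_R=\mathrm{Im}(R-1)$, $Z_R=\mathrm{Ker}(R-1)$; then $V=V_R\oplus Z_R$ is an $\omega$-orthogonal decomposition, and $\omega_R(x,y):=\omega(x_{V_R},y_{V_R})$, where $x_{V_R}$ denotes the component of $x$ in $V_R$. Let $\eta:\mathcal{R}\to\mathbb{C}$, $R\mapsto\eta_R$, be constant on $G$-conjugacy classes. The symplectic reflection algebra $H_{1,\eta}(G)$ is the unital associative complex algebra generated by $V$ and the group algebra $\mathbb{C}[G]$ subject to the relations $gx=g(x)g$ for $g\in G$, $x\in V$, and $[x,y]=xy-yx=\omega(x,y)+\sum_{R\in\mathcal{R}}\eta_R\,\omega_R(x,y)R$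 for $x,y\in V$. It is a superalgebra with parity $\pi(x)=1$ for $x\in V$ and $\pi(g)=0$ for $g\in G$; $\mathbb{C}[G]$ is regarded as a subalgebra of $H_{1,\eta}(G)$. For $\varkappa=\pm1$, a $\varkappa$-trace on an associative superalgebra $\mathcal{A}$ is a linear function $sp$ with $sp(fg)=\varkappa^{\pi(f)\pi(g)}sp(gf)$ for all homogeneous $f,g\in\mathcal{A}$ (so $\varkappa=1$ gives traces and $\varkappa=-1$ gives supertraces). *)

(* Defs.v *)
From HB Require Import structures.
From mathcomp Require Import all_boot all_order all_fingroup all_algebra.
From mathcomp Require Import all_solvable all_field all_character.
From mathcomp Require Import sesquilinear generic_quotient.
From mathcomp Require Import boolp functions reals.
From mathcomp Require Import complex.

Set Implicit Arguments.
Unset Strict Implicit.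
Unset Printing Implicit Defensive.

Import GRing.Theory.
Local Open Scope ring_scope.
Local Open Scope quotient_scope.

(* The unital associative K-algebra on generators X subject to relations [rel]:
   algebra expressions modulo the least congruence that contains the axioms of
   unital associative algebras and [rel]. *)
Section PresentedAlgebra.
Variables (K : comPzRingType) (X : Type).

Inductive aterm : Type :=
| AVar of X
| AZero
| AOpp of aterm
| AAdd of aterm & aterm
| AOne
| AMul of aterm & aterm
| AScale of K & aterm.

HB.instance Definition _ := gen_eqMixin aterm.
HB.instance Definition _ := gen_choiceMixin aterm.

Variable rel : aterm -> aterm -> Prop.

Inductive acongr : aterm -> aterm -> Prop :=
| acongr_rel s t : rel s t -> acongr s t
| acongr_refl s : acongr s s
| acongr_sym s t : acongr s t -> acongr t s
| acongr_trans s t u : acongr s t -> acongr t u -> acongr s u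
| acongr_opp s s' : acongr s s' -> acongr (AOpp s) (AOpp s')
| acongr_add s s' t t' :
    acongr s s' -> acongr t t' -> acongr (AAdd s t) (AAdd s' t')
| acongr_mul s s' t t' :
    acongr s s' -> acongr t t' -> acongr (AMul s t) (AMul s' t')
| acongr_scale a s s' : acongr s s' -> acongr (AScale a s) (AScale a s')
| acongr_addA s t u : acongr (AAdd s (AAdd t u)) (AAdd (AAdd s t) u)
| acongr_addC s t : acongr (AAdd s t) (AAdd t s)
| acongr_add0 s : acongr (AAdd AZero s) s
| acongr_addN s : acongr (AAdd (AOpp s) s) AZero
| acongr_mulA s t u : acongr (AMul s (AMul t u)) (AMul (AMul s t) u)
| acongr_mul1l s : acongr (AMul AOne s) s
| acongr_mul1r s : acongr (AMul s AOne) s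
| acongr_mulDl s t u : acongr (AMul (AAdd s t) u) (AAdd (AMul s u) (AMul t u))
| acongr_mulDr s t u : acongr (AMul s (AAdd t u)) (AAdd (AMul s t) (AMul s u))
| acongr_scaleA a b s : acongr (AScale a (AScale b s)) (AScale (a * b) s)
| acongr_scale1 s : acongr (AScale 1 s) s
| acongr_scaleDr a s t :
    acongr (AScale a (AAdd s t)) (AAdd (AScale a s) (AScale a t))
| acongr_scaleDl a b s :
    acongr (AScale (a + b) s) (AAdd (AScale a s) (AScale b s))
| acongr_scaleAl a s t : acongr (AScale a (AMul s t)) (AMul (AScale a s) t)
| acongr_scaleAr a s t : acongr (AScale a (AMul s t)) (AMul s (AScale a t)).

Definition acongrb (s t : aterm) : bool := `[< acongr s t >].

Fact acongrb_equiv : equiv_class_of acongrb.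
Proof.
split=> [s|s t|t s u]; first by apply/asboolP; exact: acongr_refl.
  by apply/asboolP/asboolP; exact: acongr_sym.
by move=> /asboolP st /asboolP tu; apply/asboolP; exact: acongr_trans tu.
Qed.

Canonical acongr_equiv := EquivRelPack acongrb_equiv.

Definition palg : Type := {eq_quot acongr_equiv}.
HB.instance Definition _ := Choice.on palg.
HB.instance Definition _ := EqQuotient.on palg.

Definition pclass (s : aterm) : palg := \pi_palg s.

Lemma pclassP s t : pclass s = pclass t <-> acongr s t.
Proof.
rewrite /pclass; split=> [/eqmodP|st]; first by move=> /asboolP.
by apply/eqmodP/asboolP.
Qed.

Lemma pclass_repr (f : palg) : pclass (repr f) = f.
Proof. exact: reprK. Qed.

Lemma repr_pclass s : acongr (repr (pclass s)) s.
Proof. by apply/pclassP; rewrite pclass_repr. Qed.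

Definition palg_opp (f : palg) := pclass (AOpp (repr f)).
Definition palg_add (f g : palg) := pclass (AAdd (repr f) (repr g)).
Definition palg_mul (f g : palg) := pclass (AMul (repr f) (repr g)).
Definition palg_scale (a : K) (f : palg) := pclass (AScale a (repr f)).

Lemma palg_oppE s : palg_opp (pclass s) = pclass (AOpp s).
Proof. by apply/pclassP/acongr_opp/repr_pclass. Qed.
Lemma palg_addE s t : palg_add (pclass s) (pclass t) = pclass (AAdd s t).
Proof. by apply/pclassP/acongr_add; exact: repr_pclass. Qed.
Lemma palg_mulE s t : palg_mul (pclass s) (pclass t) = pclass (AMul s t).
Proof. by apply/pclassP/acongr_mul; exact: repr_pclass. Qed.
Lemma palg_scaleE a s : palg_scale a (pclass s) = pclass (AScale a s).
Proof. by apply/pclassP/acongr_scale/repr_pclass. Qed.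

Definition palgE := (palg_oppE, palg_addE, palg_mulE, palg_scaleE).

Lemma palg_ind (P : palg -> Prop) : (forall s, P (pclass s)) -> forall f, P f.
Proof. by move=> Ps f; rewrite -(pclass_repr f). Qed.

Fact palg_addA : associative palg_add.
Proof.
elim/palg_ind=> s; elim/palg_ind=> t; elim/palg_ind=> u; rewrite !palgE.
exact/pclassP/acongr_addA.
Qed.
Fact palg_addC : commutative palg_add.
Proof.
by elim/palg_ind=> s; elim/palg_ind=> t; rewrite !palgE; apply/pclassP/acongr_addC.
Qed.
Fact palg_add0 : left_id (pclass AZero) palg_add.
Proof. by elim/palg_ind=> s; rewrite !palgE; apply/pclassP/acongr_add0. Qed.
Fact palg_addN : left_inverse (pclass AZero) palg_opp palg_add.
Proof. by elim/palg_ind=> s; rewrite !palgE; apply/pclassP/acongr_addN. Qed.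

HB.instance Definition _ :=
  GRing.isZmodule.Build palg palg_addA palg_addC palg_add0 palg_addN.

Fact palg_mulA : associative palg_mul.
Proof.
elim/palg_ind=> s; elim/palg_ind=> t; elim/palg_ind=> u; rewrite !palgE.
exact/pclassP/acongr_mulA.
Qed.
Fact palg_mul1l : left_id (pclass AOne) palg_mul.
Proof. by elim/palg_ind=> s; rewrite !palgE; apply/pclassP/acongr_mul1l. Qed.
Fact palg_mul1r : right_id (pclass AOne) palg_mul.
Proof. by elim/palg_ind=> s; rewrite !palgE; apply/pclassP/acongr_mul1r. Qed.
Fact palg_mulDl : left_distributive palg_mul palg_add.
Proof.
elim/palg_ind=> s; elim/palg_ind=> t; elim/palg_ind=> u; rewrite !palgE.
exact/pclassP/acongr_mulDl.
Qed.
Fact palg_mulDr : right_distributive palg_mul palg_add.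
Proof.
elim/palg_ind=> s; elim/palg_ind=> t; elim/palg_ind=> u; rewrite !palgE.
exact/pclassP/acongr_mulDr.
Qed.

(* Only a possibly-zero ring: [1 != 0] is not clear for arbitrary relations, and
   the library's [algType] requires it. *)
HB.instance Definition _ :=
  GRing.Zmodule_isPzRing.Build palg
    palg_mulA palg_mul1l palg_mul1r palg_mulDl palg_mulDr.

Fact palg_scaleA a b f : palg_scale a (palg_scale b f) = palg_scale (a * b) f.
Proof. by elim/palg_ind: f => s; rewrite !palgE; apply/pclassP/acongr_scaleA. Qed.
Fact palg_scale1 : left_id 1 palg_scale.
Proof. by elim/palg_ind=> s; rewrite !palgE; apply/pclassP/acongr_scale1. Qed.
Fact palg_scaleDr : right_distributive palg_scale palg_add.
Proof.
move=> a; elim/palg_ind=> s; elim/palg_ind=> t; rewrite !palgE.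
exact/pclassP/acongr_scaleDr.
Qed.
Fact palg_scaleDl f : {morph palg_scale^~ f : a b / a + b >-> palg_add a b}.
Proof.
by move=> a b; elim/palg_ind: f => s; rewrite !palgE; apply/pclassP/acongr_scaleDl.
Qed.

HB.instance Definition _ :=
  GRing.Zmodule_isLmodule.Build K palg
    palg_scaleA palg_scale1 palg_scaleDr palg_scaleDl.

Lemma palg_scalerAl (a : K) (f g : palg) : a *: (f * g) = (a *: f) * g.
Proof.
elim/palg_ind: f => s; elim/palg_ind: g => t.
rewrite /GRing.scale /GRing.mul /= !palgE; exact/pclassP/acongr_scaleAl.
Qed.

Lemma palg_scalerAr (a : K) (f g : palg) : a *: (f * g) = f * (a *: g).
Proof.
elim/palg_ind: f => s; elim/palg_ind: g => t.
rewrite /GRing.scale /GRing.mul /= !palgE; exact/pclassP/acongr_scaleAr.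
Qed.

Definition pgen (x : X) : palg := pclass (AVar x).

End PresentedAlgebra.

Arguments AZero {K X}.
Arguments AOne {K X}.

(* A finite subgroup of GL_n(K) is encoded as a finite group [gT] with a faithful
   matrix representation [rG]; [g] acts on column vectors by [x |-> rG g *m x]. *)
Section SymplecticReflectionAlgebra.
Variables (K : fieldType) (n : nat) (gT : finGroupType).
Local Notation V := 'cV[K]_n.
Variables (omega : {skew_symmetric V}) (rG : mx_representation K [set: gT] n).

Definition gact (g : gT) : 'End(V) := linfun (mulmx (rG g)).

Lemma gactE g x : gact g x = rG g *m x.
Proof. by rewrite lfunE. Qed.

Definition sreflections : {set gT} :=
  [set g | \dim (limg (gact g - \1%VF)) == 2%N].

Definition symplectic_reflection_group : Prop :=
  [/\ mx_faithful rG,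
      forall g, isometry omega omega (gact g)
    & exists2 S : {set gT}, S \subset sreflections & <<S>>%g = [set: gT]].

Definition omega_refl (r : gT) (x y : V) : K :=
  let VR := limg (gact r - \1%VF) in
  let ZR := lker (gact r - \1%VF) in
  omega (daddv_pi VR ZR x) (daddv_pi VR ZR y).

Variable eta : gT -> K.

Local Notation TV x := (AVar K (inl x : V + gT)).
Local Notation TG g := (AVar K (inr g : V + gT)).

Inductive sra_rel : aterm K (V + gT) -> aterm K (V + gT) -> Prop :=
| sra_linear a x y : sra_rel (TV (a *: x + y)) (AAdd (AScale a (TV x)) (TV y))
| sra_one : sra_rel (TG 1%g) AOne
| sra_mul g h : sra_rel (TG (g * h)%g) (AMul (TG g) (TG h))
| sra_act g x : sra_rel (AMul (TG g) (TV x)) (AMul (TV (gact g x)) (TG g))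
| sra_comm x y : sra_rel
    (AAdd (AMul (TV x) (TV y)) (AOpp (AMul (TV y) (TV x))))
    (AAdd (AScale (omega x y) AOne)
      (\big[@AAdd K (V + gT)/AZero]_(r in sreflections)
         AScale (eta r * omega_refl r x y) (TG r))).

Definition sra := palg sra_rel.
HB.instance Definition _ := GRing.PzRing.on sra.
HB.instance Definition _ := GRing.Lmodule.on sra.

Definition sra_vec (x : V) : sra := pgen sra_rel (inl x).
Definition sra_grp (g : gT) : sra := pgen sra_rel (inr g).

Lemma sra_vec_linear a x y : sra_vec (a *: x + y) = a *: sra_vec x + sra_vec y.
Proof.
rewrite /GRing.scale /GRing.add /sra_vec /pgen /= !palgE.
exact/pclassP/acongr_rel/sra_linear.
Qed.

Lemma sra_grp1 : sra_grp 1%g = 1.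
Proof. exact/pclassP/acongr_rel/sra_one. Qed.

Lemma sra_grpM g h : sra_grp (g * h)%g = sra_grp g * sra_grp h.
Proof.
rewrite [RHS]/GRing.mul /sra_grp /pgen /= !palgE.
exact/pclassP/acongr_rel/sra_mul.
Qed.

Lemma sra_grp_vec g x : sra_grp g * sra_vec x = sra_vec (gact g x) * sra_grp g.
Proof.
rewrite /GRing.mul /sra_grp /sra_vec /pgen /= !palgE.
exact/pclassP/acongr_rel/sra_act.
Qed.

Lemma sra_commutator x y :
  sra_vec x * sra_vec y - sra_vec y * sra_vec x =
  omega x y *: (1 : sra) +
    \sum_(r in sreflections) (eta r * omega_refl r x y) *: sra_grp r.
Proof.
have -> : \sum_(r in sreflections) (eta r * omega_refl r x y) *: sra_grp r =
    pclass sra_rel (\big[@AAdd K (V + gT)/AZero]_(r in sreflections)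
      AScale (eta r * omega_refl r x y) (TG r)) :> sra.
  elim/big_rec2: _ => [//|r s f _ ->].
  by rewrite /GRing.scale /GRing.add /sra_grp /pgen /= !palgE.
have -> : omega x y *: (1 : sra) = pclass sra_rel (AScale (omega x y) AOne).
  by rewrite /GRing.scale /GRing.one /= !palgE.
rewrite /GRing.mul /GRing.opp /GRing.add /sra_vec /pgen /= !palgE.
exact/pclassP/acongr_rel/sra_comm.
Qed.

(* Homogeneous elements of parity [p], with [true] for odd. *)
Inductive homogeneous : bool -> sra -> Prop :=
| homogeneous_vec x : homogeneous true (sra_vec x)
| homogeneous_grp g : homogeneous false (sra_grp g)
| homogeneous_0 p : homogeneous p 0
| homogeneous_lin p a f g :
    homogeneous p f -> homogeneous p g -> homogeneous p (a *: f + g)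
| homogeneous_mul p q f g :
    homogeneous p f -> homogeneous q g -> homogeneous (p (+) q) (f * g).

Variable kappa : K.

Definition is_ktrace (sp : sra -> K^o) : Prop :=
  scalar sp /\
  forall p q f g, homogeneous p f -> homogeneous q g ->
    sp (f * g) = kappa ^+ (p && q) * sp (g * f).

Definition ktrace_pred : {pred sra -> K^o} := [pred sp | `[< is_ktrace sp >]].

Fact ktrace_submod : submod_closed ktrace_pred.
Proof.
split=> [|a u v /asboolP[lu tu] /asboolP[lv tv]]; apply/asboolP; split.
- by move=> b f g; rewrite /GRing.zero /= mulr0 addr0.
- by move=> p q f g _ _; rewrite /GRing.zero /= mulr0.
- move=> b f g.
  rewrite [LHS](_ : _ = a * u (b *: f + g) + v (b *: f + g)) //.
  rewrite [RHS](_ : _ = b * (a * u f + v f) + (a * u g + v g)) //.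
  by rewrite lu lv !mulrDr mulrCA addrACA.
- move=> p q f g hf hg.
  rewrite [LHS](_ : _ = a * u (f * g) + v (f * g)) //.
  rewrite [RHS](_ : _ = kappa ^+ (p && q) * (a * u (g * f) + v (g * f))) //.
  by rewrite (tu _ _ _ _ hf hg) (tv _ _ _ _ hf hg) mulrDr mulrCA.
Qed.

HB.instance Definition _ :=
  GRing.isSubmodClosed.Build K (sra -> K^o) ktrace_pred ktrace_submod.

Record ktrace : Type := KTrace { ktrace_fun :> sra -> K^o;
                                 _ : ktrace_fun \in ktrace_pred }.
HB.instance Definition _ := [isSub for ktrace_fun].
HB.instance Definition _ := [Choice of ktrace by <:].
HB.instance Definition _ := [SubChoice_isSubLmodule of ktrace by <:].

Definition no_eigenvalue : {set gT} :=
  [set g | ~~ passmx.leigenvalue (gact g) kappa].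

End SymplecticReflectionAlgebra.

(* [Vector.axiom d W]: W is linearly isomorphic to K^d. *)
Definition has_dim (K : fieldType) (W : lmodType K) (d : nat) : Prop :=
  inhabited (Vector.axiom d W).

(* Main.v *)
(** Let [H] be filtered by the degree in [V]. The PBW theorem, that gr H is the smash
    product of S(V) and G, comes from an explicit action of [H] on S(V) (x) C[G]: left
    multiplication by [x] is the commutative product plus lower order terms, determined
    recursively by a Poincare homotopy, whose closedness is the Jacobi identity for the
    commutator of [V].

    A [kappa]-trace is conjugation invariant and vanishes on the twisted commutators
    [x h - kappa h x] with [x] in [V]. On the component of [g] the symbol of such a
    commutator is the product with [(1 - kappa g) x], so a Koszul complex reduces symbols
    to polynomials on the fixed space V_g of [kappa g]. There the commutators act by the
    Poisson bracket, because multiplying [g] by a reflection [R] with omega_R nonzero on V_g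
    lowers dim V_g; and the divergence of the Poisson structure is onto when V_g <> 0.
    By induction on the degree and dim V_g, the even part of [H] is spanned by twisted
    commutators and by the [g] without eigenvalue [kappa], which gives uniqueness.

    Existence amounts to showing that a sum of twisted commutators that is a combination of
    such [g] has vanishing average under conjugation. The same induction proves this: by the
    exactness of the Koszul complex and of Brylinski's Poisson complex, the leading symbol
    of the sum's arguments is a boundary, and boundaries contribute nothing to the average. *)
From HB Require Import structures.
Require Import Defs.
From mathcomp Require Import all_boot all_order all_fingroup all_algebra.
From mathcomp Require Import all_solvable all_field all_character.
From mathcomp Require Import sesquilinear boolp functions reals complex.
From mathcomp Require Import ring.
From mathcomp Require Import mpoly.
Import GRing.Theory Num.Theory.
Local Open Scope ring_scope.

Set Implicit Arguments.
Unset Strict Implicit.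
Unset Printing Implicit Defensive.

(** [H] comes without coordinates, so a symbol is first a relation between elements and polynomials,
    and becomes a function only through the action of [H] on S(V) (x) C[G]. Filtration levels are
    degrees plus two, so that levels 0 and 1 are zero, and are kept apart by parity, since the
    commutator of two vectors lowers the degree by two. The homotopy for left multiplication is
    normalised by sum_j lo e_j (D_j m) = 0, the choice of symmetrized monomials as basis. Taking y =
    e_j and m = D_j m' in the equation for [lo] and summing gives lo x ((euler + 1) m') = sum_j phi
    x e_j (D_j m'); hence the inverse of euler + 1. The obstacle to existence is that the
    noncommutative Koszul differentials do not compose to zero: twisted commutators commute only up
    to a commutator with an element of C[G]. Averaging under conjugation kills that, so each change
    of the arguments by a boundary is followed by an average over G. On the odd part a trace lets a
    vector and an even element commute without the factor kappa, so the spanning theorem is used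
    there with kappa = 1. *)

Section PolynomialRing.
Variables (C : numFieldType) (n : nat).
Local Notation S := {mpoly C[n]}.
Local Notation V := 'cV[C]_n.
Implicit Types (f g : S) (x y : V) (A B : 'M[C]_n).

(** * Linear substitutions, derivations and the Euler operator on S(V) *)

Lemma mpoly_lin_ind (P : S -> Prop) :
    (forall a f g, P f -> P g -> P (a *: f + g)) -> P 1 ->
    (forall i f, P f -> P ('X_i * f)) ->
  forall f, P f.
Proof.
move=> Plin P1 PX; have P0 : P 0.
  by have := Plin (-1) _ _ P1 P1; rewrite scaleN1r addNr.
elim/mpolyind => // a m f _ _ Pf; apply: Plin Pf.
rewrite mpolyXE_id; elim/big_rec: _ => // i g _ Pg.
elim: (m i) => [|k IH]; first by rewrite expr0 mul1r.
by rewrite exprS -mulrA; apply: PX.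
Qed.

(* Several definitions are locked, as unification would otherwise unfold them. *)
Fact lin_key : unit. Proof. by []. Qed.
Definition lin x : S := locked_with lin_key (\sum_i x i 0 *: 'X_i).

Lemma linE x : lin x = \sum_i x i 0 *: 'X_i.
Proof. by rewrite /lin unlock. Qed.

Lemma lin_is_linear : linear lin.
Proof.
move=> a x y; rewrite !linE scaler_sumr -big_split /=; apply: eq_bigr => i _.
by rewrite !mxE scalerDl scalerA.
Qed.
HB.instance Definition _ := GRing.isLinear.Build C V S _ lin lin_is_linear.

Lemma lin_delta i : lin (delta_mx i 0) = 'X_i.
Proof.
rewrite linE (bigD1 i) //= big1 => [|j ji]; rewrite mxE ?eqxx.
  by rewrite scale1r addr0.
by rewrite (negPf ji) scale0r.
Qed.

Lemma vec_sum_delta x : x = \sum_i x i 0 *: delta_mx i 0.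
Proof.
apply/matrixP => i j; rewrite summxE (bigD1 i) //= big1 => [|k ki]; rewrite !mxE ord1 ?eqxx.
  by rewrite mulr1 addr0.
by rewrite eq_sym (negPf ki) mulr0.
Qed.

Lemma mulmx_deltaE A i j : (A *m delta_mx i 0 : V) j 0 = A j i.
Proof. by rewrite -colE mxE. Qed.

Lemma mulmx_delta A i : A *m delta_mx i 0 = \sum_j A j i *: (delta_mx j 0 : V).
Proof.
rewrite [LHS]vec_sum_delta; apply: eq_bigr => j _; by rewrite mulmx_deltaE.
Qed.

Fact subst_key : unit. Proof. by []. Qed.
Definition subst A f : S :=
  locked_with subst_key (f \mPo [tuple lin (col i A) | i < n]).

Lemma substE A f : subst A f = f \mPo [tuple lin (col i A) | i < n].
Proof. by rewrite /subst unlock. Qed.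

Lemma subst_is_linear A : linear (subst A).
Proof. by move=> a f g; rewrite !substE comp_mpolyD comp_mpolyZ. Qed.
HB.instance Definition _ A := GRing.isLinear.Build C S S _ (subst A) (subst_is_linear A).

Lemma subst1 A : subst A 1 = 1. Proof. by rewrite substE comp_mpoly1. Qed.
Lemma substM A f g : subst A (f * g) = subst A f * subst A g.
Proof. by rewrite !substE rmorphM. Qed.

Lemma substX A i : subst A 'X_i = lin (A *m delta_mx i 0).
Proof. by rewrite substE comp_mpolyXU -tnth_nth tnth_mktuple -colE. Qed.

Lemma subst_lin A x : subst A (lin x) = lin (A *m x).
Proof.
rewrite {1}linE linear_sum [in RHS](vec_sum_delta x) mulmx_sumr linear_sum /=.
by apply: eq_bigr => i _; rewrite -scalemxAr !linearZ /= substX.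
Qed.

Lemma subst_comp A B f : subst A (subst B f) = subst (A *m B) f.
Proof.
elim/mpoly_lin_ind: f => [a f g Pf Pg||i f Pf].
- by rewrite !linearP /= Pf Pg.
- by rewrite !subst1.
by rewrite !substM substX subst_lin Pf substX mulmxA.
Qed.

Lemma subst_id f : subst 1%:M f = f.
Proof.
elim/mpoly_lin_ind: f => [a f g Pf Pg||i f Pf].
- by rewrite !linearP /= Pf Pg.
- by rewrite subst1.
by rewrite substM substX mul1mx lin_delta Pf.
Qed.

Lemma mderivXU i j : ('X_j : S)^`M(i) = (i == j)%:R.
Proof.
rewrite mderivX mnm1E eq_sym; case: eqP => [->|_]; last by rewrite scale0r.
by rewrite scale1r -[X in 'X_[X - _]]add0m addmK mpolyX0.
Qed.

Lemma mderiv_lin i x : (lin x)^`M(i) = (x i 0)%:MP.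
Proof.
rewrite linE linear_sum (bigD1 i) //= big1 => [|j ji]; rewrite mderivZ mderivXU.
  by rewrite eqxx addr0 -mul_mpolyC mulr1.
by rewrite eq_sym (negPf ji) scaler0.
Qed.

Lemma mderiv_subst A i f : (subst A f)^`M(i) = \sum_k A i k *: subst A (f^`M(k)).
Proof.
elim/mpoly_lin_ind: f => [a f g Pf Pg||j f Pf].
- rewrite !linearP /= Pf Pg scaler_sumr -big_split /=; apply: eq_bigr => k _.
  by rewrite !linearP /= scalerA mulrC -scalerA.
- rewrite subst1 mderivC big1 // => k _.
  by rewrite mderivC linear0 scaler0.
rewrite substM substX mderivM mderiv_lin Pf mulr_sumr.
transitivity (\sum_k A i k *: (subst A (('X_j)^`M(k)) * subst A f) +
              \sum_k A i k *: (subst A 'X_j * subst A (f^`M(k)))).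
  congr (_ + _).
    rewrite [RHS](bigD1 j) //= [X in _ + X]big1 => [|k kj]; rewrite mderivXU.
      by rewrite eqxx subst1 mul1r addr0 mulmx_deltaE mul_mpolyC.
    by rewrite (negPf kj) linear0 mul0r scaler0.
  by apply: eq_bigr => k _; rewrite substX scalerAr.
rewrite -big_split /=; apply: eq_bigr => k _.
by rewrite mderivM linearD /= !substM scalerDr.
Qed.

Fact ederiv_key : unit. Proof. by []. Qed.
(* The derivation of S(V) that extends the endomorphism [A] of V. *)
Definition ederiv A f : S :=
  locked_with ederiv_key (\sum_k lin (A *m delta_mx k 0) * f^`M(k)).

Lemma ederivE A f : ederiv A f = \sum_k lin (A *m delta_mx k 0) * f^`M(k).
Proof. by rewrite /ederiv unlock. Qed.

Lemma ederiv_is_linear A : linear (ederiv A).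
Proof.
move=> a f g; rewrite !ederivE scaler_sumr -big_split /=; apply: eq_bigr => k _.
by rewrite linearP /= mulrDr scalerAr.
Qed.
HB.instance Definition _ A := GRing.isLinear.Build C S S _ (ederiv A) (ederiv_is_linear A).

Lemma ederivM A f g : ederiv A (f * g) = ederiv A f * g + f * ederiv A g.
Proof.
rewrite !ederivE mulr_suml mulr_sumr -big_split /=; apply: eq_bigr => k _.
rewrite mderivM; ring.
Qed.

Lemma ederiv_lin A x : ederiv A (lin x) = lin (A *m x).
Proof.
rewrite ederivE {2}(vec_sum_delta x) mulmx_sumr linear_sum /=; apply: eq_bigr => k _.
by rewrite mderiv_lin -scalemxAr linearZ /= mulrC mul_mpolyC.
Qed.

Definition euler f : S := ederiv 1%:M f.

Lemma eulerE f : euler f = \sum_k 'X_k * f^`M(k).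
Proof. by rewrite /euler ederivE; apply: eq_bigr => k _; rewrite mul1mx lin_delta. Qed.

Lemma euler_is_linear : linear euler.
Proof. by move=> a f g; rewrite /euler linearP. Qed.
HB.instance Definition _ := GRing.isLinear.Build C S S _ euler euler_is_linear.

Lemma eulerM f g : euler (f * g) = euler f * g + f * euler g.
Proof. by rewrite /euler ederivM. Qed.

Lemma euler_lin x : euler (lin x) = lin x.
Proof. by rewrite /euler ederiv_lin mul1mx. Qed.

Lemma euler1 : euler 1 = 0.
Proof. by rewrite eulerE big1 // => k _; rewrite mderivC mulr0. Qed.

Lemma eulerX m : euler 'X_[m] = (mdeg m)%:R *: 'X_[m].
Proof.
rewrite eulerE mdegE natr_sum scaler_suml; apply: eq_bigr => k _.
rewrite mderivX; case: (m k =P 0%N) => [->|mk]; first by rewrite !scale0r mulr0.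
rewrite -scalerAr -mpolyXD addmC submK //.
by rewrite lep1mP; apply/eqP.
Qed.

Lemma mpoly_lin_eq (F G : S -> S) : linear F -> linear G ->
  (forall m, F 'X_[m] = G 'X_[m]) -> F =1 G.
Proof.
move=> Fl Gl FG; elim/mpolyind => [|a m f _ _ Pf].
  by have := (Fl (-1) 0 0, Gl (-1) 0 0); rewrite !scaler0 !scaleN1r !addr0 !addNr => -[-> ->].
by rewrite Fl Gl FG Pf.
Qed.

Lemma mcoeff_euler f m : (euler f)@_m = (mdeg m)%:R * f@_m.
Proof.
elim/mpolyind: f => [|a k f _ _ Pf]; first by rewrite linear0 mcoeff0 mulr0.
rewrite linearP /= !mcoeffD !mcoeffZ Pf mulrDr eulerX mcoeffZ mcoeffX.
by case: eqP => [->|_]; rewrite ?mulr1 ?mulr0 // mulrC.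
Qed.

Fact eulinv_key : unit. Proof. by []. Qed.
(* The inverse of [euler + a], for [a > 0]. *)
Definition eulinv (a : nat) f : S := locked_with eulinv_key
  (\sum_(m <- msupp f) (f@_m / (mdeg m + a)%:R) *: 'X_[m]).

Lemma mcoeff_eulinv a f m : (eulinv a f)@_m = f@_m / (mdeg m + a)%:R.
Proof.
rewrite /eulinv unlock linear_sum /=.
under eq_bigr => k _ do rewrite mcoeffZ mcoeffX.
have [mf|mf] := boolP (m \in msupp f); last first.
  rewrite big_seq big1 => [|k kf]; first by rewrite memN_msupp_eq0 ?mul0r.
  by case: eqP => [km|_]; rewrite ?mulr0 //; rewrite km (negPf mf) in kf.
rewrite (bigD1_seq m) //= eqxx mulr1 big1 ?addr0 // => k km.
by rewrite (negPf km) mulr0.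
Qed.

Lemma eulinv_is_linear a : linear (eulinv a).
Proof.
move=> b f g; apply/mpolyP => m.
by rewrite mcoeffD mcoeffZ !mcoeff_eulinv mcoeffD mcoeffZ mulrDl mulrA.
Qed.
HB.instance Definition _ a := GRing.isLinear.Build C S S _ (eulinv a) (eulinv_is_linear a).

Lemma eulinvK a f : (0 < a)%N -> euler (eulinv a f) + a%:R *: eulinv a f = f.
Proof.
move=> a0; apply/mpolyP => m.
rewrite mcoeffD mcoeffZ mcoeff_euler mcoeff_eulinv -mulrDl -natrD.
by rewrite mulrC divfK // pnatr_eq0 addn_eq0 negb_and -!lt0n a0 orbT.
Qed.

Lemma eulerK a f : (0 < a)%N -> eulinv a (euler f + a%:R *: f) = f.
Proof.
move=> a0; apply/mpolyP => m.
rewrite mcoeff_eulinv mcoeffD mcoeffZ mcoeff_euler -mulrDl -natrD.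
by rewrite mulrC mulKf // pnatr_eq0 addn_eq0 negb_and -!lt0n a0 orbT.
Qed.

(** Multiplication by ['X_i] raises the degree by one, so the shift a after it becomes the shift a +
    1 before it. *)
Lemma eulinvX a i f : eulinv a ('X_i * f) = 'X_i * eulinv a.+1 f.
Proof.
move: f; apply: mpoly_lin_eq => [b f g|b f g|m].
- by rewrite mulrDr -scalerAr linearP.
- by rewrite linearP mulrDr /= scalerAr.
have eulinvXm b k : eulinv b 'X_[k] = (mdeg k + b)%:R^-1 *: 'X_[k].
  apply/mpolyP => l; rewrite mcoeff_eulinv mcoeffZ mcoeffX.
  by case: eqP => [->|]; rewrite ?mul0r ?mulr0 // mulrC.
by rewrite -mpolyXD !eulinvXm -scalerAr -mpolyXD mdegD mdeg1 add1n addSnnS.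
Qed.

Lemma lin_mulmx_delta A k : lin (A *m delta_mx k 0) = \sum_j A j k *: 'X_j.
Proof.
rewrite mulmx_delta linear_sum /=; apply: eq_bigr => j _.
by rewrite linearZ /= lin_delta.
Qed.

Lemma euler_subst A f : euler (subst A f) = subst A (euler f).
Proof.
rewrite !eulerE linear_sum /=.
under eq_bigr => k _ do rewrite mderiv_subst mulr_sumr.
rewrite exchange_big /=; apply: eq_bigr => k _.
rewrite substM substX lin_mulmx_delta mulr_suml; apply: eq_bigr => j _.
by rewrite -scalerAr -scalerAl.
Qed.

Lemma eulinv_subst a A f : (0 < a)%N -> eulinv a (subst A f) = subst A (eulinv a f).
Proof.
move=> a0; rewrite -[RHS](eulerK _ a0) euler_subst -linearZ -linearD /=.
by rewrite eulinvK.
Qed.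

(** An eigenvalue equation is linear, holds for 0 in every degree, and passes to products,
    substitutions and derivatives by the Leibniz and chain rules. *)
Definition hom (d : nat) f : Prop := euler f = d%:R *: f.

Lemma hom_lin d a f g : hom d f -> hom d g -> hom d (a *: f + g).
Proof. by rewrite /hom linearP /= => -> ->; rewrite scalerDr !scalerA mulrC. Qed.

Lemma hom0 d : hom d 0. Proof. by rewrite /hom linear0 scaler0. Qed.

Lemma homD d f g : hom d f -> hom d g -> hom d (f + g).
Proof. by move=> hf hg; rewrite -[f]scale1r; apply: hom_lin. Qed.

Lemma homZ d a f : hom d f -> hom d (a *: f).
Proof. by move=> hf; rewrite -[_ *: f]addr0; apply: hom_lin => //; apply: hom0. Qed.

Lemma homB d f g : hom d f -> hom d g -> hom d (f - g).
Proof. by move=> hf hg; apply: homD => //; rewrite -scaleN1r; apply: homZ. Qed.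

Lemma hom_sum d (I : Type) (r : seq I) (P : pred I) (F : I -> S) :
  (forall i, P i -> hom d (F i)) -> hom d (\sum_(i <- r | P i) F i).
Proof. by move=> hF; elim/big_ind: _ => //; [apply: hom0 | apply: homD]. Qed.

Lemma hom_mul d e f g : hom d f -> hom e g -> hom (d + e) (f * g).
Proof.
rewrite /hom eulerM => -> ->.
by rewrite -scalerAl -scalerAr -scalerDl natrD.
Qed.

Lemma hom1 : hom 0 1. Proof. by rewrite /hom euler1 scale0r. Qed.
Lemma hom_lin1 x : hom 1 (lin x). Proof. by rewrite /hom euler_lin scale1r. Qed.
Lemma hom_linM d x f : hom d f -> hom d.+1 (lin x * f).
Proof. by move=> hf; rewrite -add1n; apply: hom_mul => //; apply: hom_lin1. Qed.

Lemma hom_subst d A f : hom d f -> hom d (subst A f).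
Proof. by rewrite /hom euler_subst => ->; rewrite linearZ. Qed.

Lemma euler_mderiv i f : euler (f^`M(i)) = (euler f)^`M(i) - f^`M(i).
Proof.
rewrite !eulerE linear_sum /=; apply/eqP; rewrite eq_sym subr_eq; apply/eqP.
transitivity (\sum_k (('X_k : S)^`M(i) * f^`M(k) + 'X_k * f^`M(k)^`M(i))).
  by apply: eq_bigr => k _; rewrite mderivM.
rewrite big_split /= addrC; congr (_ + _).
  by apply: eq_bigr => k _; rewrite mderiv_comm.
rewrite (bigD1 i) //= big1 => [|k ki]; rewrite mderivXU.
  by rewrite eqxx mul1r addr0.
by rewrite eq_sym (negPf ki) mul0r.
Qed.

Lemma hom_mderiv d i f : hom d.+1 f -> hom d (f^`M(i)).
Proof.
rewrite /hom euler_mderiv => ->.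
by rewrite mderivZ -{2}[_^`M(i)]scale1r -scalerBl -addn1 natrD addrK.
Qed.

Lemma hom0_const f : hom 0 f -> f = (f@_0)%:MP.
Proof.
move=> hf; apply/mpolyP => m; rewrite mcoeffC.
have := congr1 (mcoeff m) hf; rewrite scale0r mcoeff_euler mcoeff0.
case: (m =P 0%MM) => [->|/eqP m0 /eqP]; first by rewrite mulr1.
by rewrite mulr0 mulf_eq0 pnatr_eq0 mdeg_eq0 (negPf m0) => /eqP.
Qed.

Lemma mderiv_hom0 i f : hom 0 f -> f^`M(i) = 0.
Proof. by move/hom0_const->; rewrite mderivC. Qed.

Lemma hom_euler d f : hom d f -> \sum_k 'X_k * f^`M(k) = d%:R *: f.
Proof. by rewrite -eulerE. Qed.

End PolynomialRing.

Lemma natr_card_neq0 (C : numDomainType) (gT : finGroupType) : #|gT|%:R != 0 :> C.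
Proof. by rewrite pnatr_eq0 -lt0n -cardsT cardG_gt0. Qed.

Lemma scalerAl_mx (C : comPzRingType) n (c : C) (A B : 'M[C]_n) :
  c *: (A * B) = (c *: A) * B.
Proof. exact: scalemxAl. Qed.
Lemma scalerAr_mx (C : comPzRingType) n (c : C) (A B : 'M[C]_n) :
  c *: (A * B) = A * (c *: B).
Proof. exact: scalemxAr. Qed.

(** * Averages over the powers of a matrix of finite order *)

Section CyclicAverage.
Variables (C : numFieldType) (n m : nat) (a : 'M[C]_n).
Hypotheses (m_gt0 : (0 < m)%N) (am : a ^+ m = 1).

Definition cavg (o : nat) (b : 'M[C]_n) : 'M[C]_n := o%:R^-1 *: \sum_(k < o) b ^+ k.
(** A partial inverse of [1 - b]: each inner sum times [1 - b] is [1 - b ^+ k], and averaging over k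
    gives 1 minus the projection [cavg]. *)
Definition cinv (o : nat) (b : 'M[C]_n) : 'M[C]_n :=
  o%:R^-1 *: \sum_(k < o) \sum_(j < k) b ^+ j.

Lemma mul_cavg : a * cavg m a = cavg m a.
Proof.
rewrite /cavg -scalerAr_mx; congr (_ *: _); apply/eqP; rewrite -subr_eq0.
by rewrite -{2}[\sum__ _]mul1r -mulrBl -subrX1 am subrr.
Qed.

Lemma mulX_cavg k : a ^+ k * cavg m a = cavg m a.
Proof. by elim: k => [|k IH]; rewrite ?expr0 ?mul1r // exprSr -mulrA mul_cavg. Qed.

Let m0 : (m%:R : C) != 0. Proof. by rewrite pnatr_eq0 -lt0n. Qed.

Lemma cavg_idem : cavg m a * cavg m a = cavg m a.
Proof.
rewrite {1}/cavg -scalerAl_mx mulr_suml.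
under eq_bigr => k _ do rewrite mulX_cavg.
by rewrite sumr_const card_ord -scaler_nat scalerA mulVf // scale1r.
Qed.

Lemma cavg_fix p (x : 'M[C]_(n, p)) : a *m x = x -> cavg m a *m x = x.
Proof.
move=> ax; have akx k : a ^+ k *m x = x.
  elim: k => [|k IH]; first by rewrite expr0 mul1mx.
  by rewrite exprSr -[a ^+ k * a]/(a ^+ k *m a) -mulmxA ax.
rewrite /cavg -scalemxAl mulmx_suml; under eq_bigr => k _ do rewrite akx.
by rewrite sumr_const card_ord -scaler_nat scalerA mulVf // scale1r.
Qed.

Lemma cavg_fixP p (x : 'M[C]_(n, p)) : (cavg m a *m x == x) = (a *m x == x).
Proof.
apply/eqP/eqP => [<-|]; last exact: cavg_fix.
by rewrite mulmxA -[a *m cavg m a]/(a * cavg m a) mul_cavg.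
Qed.

Lemma subr_cinv : (1 - a) * cinv m a = 1 - cavg m a.
Proof.
rewrite /cinv -scalerAr_mx mulr_sumr.
under eq_bigr => k _ do rewrite -opprB mulNr -subrX1 opprB.
rewrite sumrB sumr_const card_ord scalerBr -scaler_nat scalerA mulVf //.
by rewrite scale1r.
Qed.

Lemma cinv_comm : cinv m a * a = a * cinv m a.
Proof.
rewrite /cinv -scalerAl_mx -scalerAr_mx mulr_suml mulr_sumr; congr (_ *: _).
apply: eq_bigr => k _; rewrite mulr_suml mulr_sumr; apply: eq_bigr => j _.
by rewrite -exprSr exprS.
Qed.

Lemma cinv_subr : cinv m a * (1 - a) = 1 - cavg m a.
Proof. by rewrite -subr_cinv mulrBr mulrBl mulr1 mul1r cinv_comm. Qed.

Lemma cavg_subr : cavg m a * (1 - a) = 0.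
Proof.
rewrite mulrBr mulr1; apply/eqP; rewrite subr_eq0 eq_sym.
rewrite /cavg -scalerAl_mx mulr_suml; apply/eqP; congr (_ *: _).
transitivity (\sum_(k < m) a * a ^+ k).
  by apply: eq_bigr => k _; rewrite -exprSr exprS.
rewrite -mulr_sumr; apply/eqP; rewrite -subr_eq0.
by rewrite -{2}[\sum__ _]mul1r -mulrBl -subrX1 am subrr.
Qed.

End CyclicAverage.

Lemma cavg_conj (C : numFieldType) n m (a b b' : 'M[C]_n) :
  b' * b = 1 -> cavg m (b * a * b') = b * cavg m a * b'.
Proof.
move=> b'b; rewrite /cavg -scalerAr_mx -scalerAl_mx mulr_sumr mulr_suml; congr (_ *: _).
apply: eq_bigr => k _; elim: (nat_of_ord k) => [|j IH]; last first.
  by rewrite exprSr IH exprSr !mulrA -[b * _ * b' * b]mulrA b'b mulr1.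
have bb' : b * b' = 1 by apply: mulmx1C.
by rewrite !expr0 mulr1.
Qed.

(** A rank factorization p = c r of an idempotent satisfies r c = 1, and the trace is cyclic. *)
Lemma mxtrace_idem (C : fieldType) n (p : 'M[C]_n) : p * p = p -> \tr p = (\rank p)%:R.
Proof.
move=> pp; rewrite -{1}(mulmx_base p) mxtrace_mulC.
suff -> : row_base p *m col_base p = 1%:M by rewrite mxtrace1.
apply: (row_free_inj (row_base_free p)); rewrite mul1mx.
have /row_fullP[B Bc] := col_base_full p.
have pE : col_base p *m row_base p = p by apply: mulmx_base.
have ppE : col_base p *m (row_base p *m col_base p *m row_base p) = col_base p *m row_base p.
  by rewrite -mulmxA mulmxA !pE.
by rewrite -[LHS]mul1mx -Bc -mulmxA ppE mulmxA Bc mul1mx.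
Qed.

(** * The Gram matrix of the symplectic form and the dual basis *)

Section SkewForm.
Variables (C : numFieldType) (n : nat) (omega : {skew_symmetric 'cV[C]_n}).
Local Notation V := 'cV[C]_n.
Implicit Types x y z : V.

Lemma omC x y : omega x y = - omega y x.
Proof. by rewrite hermC /= expr1 mulN1r. Qed.
Lemma omPl a x y z : omega (a *: x + y) z = a * omega x z + omega y z.
Proof. exact: linearPl. Qed.
Lemma omPr a x y z : omega z (a *: x + y) = a * omega z x + omega z y.
Proof. exact: linearPr. Qed.
Lemma omZl a x z : omega (a *: x) z = a * omega x z.
Proof. exact: linearZl_LR. Qed.
Lemma omZr a x z : omega z (a *: x) = a * omega z x.
Proof. exact: linearZr_LR. Qed.
Lemma omxx x : omega x x = 0.
Proof. by apply/eqP; rewrite -[_ == _](mulrn_eq0 _ 2) mulr2n {1}omC addNr. Qed.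
Lemma om_suml (I : finType) (F : I -> V) z :
  omega (\sum_i F i) z = \sum_i omega (F i) z.
Proof. exact: linear_sumlz. Qed.
Lemma om_sumr (I : finType) (F : I -> V) z :
  omega z (\sum_i F i) = \sum_i omega z (F i).
Proof. exact: linear_sumr. Qed.

Lemma om_sum_delta x y : omega x y = \sum_i x i 0 * omega (delta_mx i 0) y.
Proof.
rewrite {1}(vec_sum_delta x) om_suml; apply: eq_bigr => i _; exact: omZl.
Qed.

Hypothesis omega_nondeg : nondegenerate omega.

Definition gram : 'M[C]_n := \matrix_(i, j) omega (delta_mx i 0) (delta_mx j 0).

Lemma omE x y : omega x y = (x^T *m gram *m y) 0 0.
Proof.
rewrite om_sum_delta -mulmxA !mxE; apply: eq_bigr => i _; rewrite !mxE; congr (_ * _).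
rewrite {1}(vec_sum_delta y) om_sumr; apply: eq_bigr => j _.
by rewrite omZr mulrC !mxE.
Qed.

Lemma gram_unit : gram \in unitmx.
Proof.
rewrite -row_free_unit -kermx_eq0; apply/eqP/row_matrixP => i; rewrite row0.
set v := row i _; have vG : v *m gram = 0 by rewrite /v -row_mul mulmx_ker row0.
have : v^T \in orthov omega fullv.
  by apply/mem_orthovP => y _; rewrite omE trmxK vG mul0mx mxE.
move: omega_nondeg; rewrite /nondegenerate => /eqP ->.
by rewrite memv0 => /eqP/(congr1 trmx); rewrite trmxK trmx0.
Qed.

(** The columns of the inverse Gram matrix form the basis dual to the standard one under [omega]. *)
Definition dualb j : V := col j (invmx gram).

Lemma om_dualb x j : omega x (dualb j) = x j 0.
Proof.
rewrite omE /dualb colE -mulmxA mulKVmx ?gram_unit //.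
by rewrite -colE !mxE.
Qed.

Lemma sum_dualb x : \sum_j omega x (dualb j) *: (delta_mx j 0 : V) = x.
Proof. by rewrite [RHS]vec_sum_delta; apply: eq_bigr => j _; rewrite om_dualb. Qed.

End SkewForm.

(** * The fixed space of k g and its orthogonal projection *)

Section FixedSpaces.
Variables (C : numFieldType) (n : nat) (gT : finGroupType).
Variables (omega : {skew_symmetric 'cV[C]_n}) (rG : mx_representation C [set: gT] n).
Local Notation V := 'cV[C]_n.
Implicit Types (x y z : V) (g h : gT).

Lemma rGM g h : rG (g * h)%g = rG g *m rG h.
Proof. by rewrite repr_mxM ?inE. Qed.
Lemma rG1 : rG 1%g = 1%:M. Proof. exact: repr_mx1. Qed.
Lemma rGV g : rG g^-1%g *m rG g = 1%:M. Proof. by rewrite -rGM mulVg rG1. Qed.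
Lemma rGVr g : rG g *m rG g^-1%g = 1%:M. Proof. by rewrite -rGM mulgV rG1. Qed.

Hypothesis isoG : forall g x y, omega (rG g *m x) (rG g *m y) = omega x y.

Section Kappa.
Variable k : C.
Hypothesis kk : k * k = 1.

(* As [k^2 = 1], the order of [k g] divides [2 |G|]; hence [fixp g] projects onto
   the fixed space of [k g]. *)
Let ord2 := (2 * #|gT|)%N.

Definition tw g : 'M[C]_n := 1 - k *: rG g.
Definition fixp g : 'M[C]_n := cavg ord2 (k *: rG g).
Definition twinv g : 'M[C]_n := cinv ord2 (k *: rG g).
Definition fixdim g : nat := \rank (fixp g).

Let ord2_gt0 : (0 < ord2)%N.
Proof. by rewrite muln_gt0 /= -cardsT cardG_gt0. Qed.

Let expr_tw g m : (k *: rG g) ^+ m = k ^+ m *: rG (g ^+ m)%g.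
Proof.
elim: m => [|m IH]; first by rewrite !expr0 expg0 rG1 scale1r.
rewrite exprS IH expgS rGM exprS -[_ * _]/(_ *m _).
by rewrite -scalemxAl -scalemxAr scalerA.
Qed.

Let tw_ord g : (k *: rG g) ^+ ord2 = 1.
Proof.
rewrite expr_tw /ord2 exprM expr2 kk expr1n scale1r mulnC expgM.
by rewrite -cardsT expg_cardG ?inE // expg1n rG1.
Qed.

Lemma fixp_idem g : fixp g *m fixp g = fixp g.
Proof. exact: cavg_idem. Qed.

Lemma tw_twinv g : tw g *m twinv g = 1 - fixp g.
Proof. exact: subr_cinv. Qed.

Lemma twinv_tw g : twinv g *m tw g = 1 - fixp g.
Proof. exact: cinv_subr. Qed.

Lemma fixp_tw g : fixp g *m tw g = 0.
Proof. exact: cavg_subr. Qed.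

Lemma act_fixp g : k *: rG g *m fixp g = fixp g.
Proof. exact: mul_cavg. Qed.

Lemma tw_fixp g : tw g *m fixp g = 0.
Proof. by rewrite mulmxBl mul1mx act_fixp subrr. Qed.

Lemma fixpP p g (x : 'M[C]_(n, p)) : (fixp g *m x == x) = (k *: rG g *m x == x).
Proof. exact: cavg_fixP. Qed.

Lemma fixp_conj g h : fixp (h * g * h^-1)%g = rG h *m fixp g *m rG h^-1%g.
Proof.
rewrite /fixp !rGM -[rG h *m _ *m _]/(rG h * rG g * rG h^-1%g).
rewrite scalerAl_mx scalerAr_mx; apply: cavg_conj; exact: rGV.
Qed.

Lemma fixdim_conj g h : fixdim (h * g * h^-1)%g = fixdim g.
Proof.
rewrite /fixdim fixp_conj mxrankMfree ?row_free_unit; last first.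
  by have [] := mulmx1_unit (rGV h).
rewrite -mxrank_tr trmx_mul mxrankMfree ?mxrank_tr //.
by rewrite row_free_unit unitmx_tr; have [] := mulmx1_unit (rGV h).
Qed.

(** As k^2 = 1, k g preserves [omega], so its fixed vectors are orthogonal to the image of
    [1 - k g]. *)
Lemma om_fixp_tw g x y : omega (fixp g *m x) (tw g *m y) = 0.
Proof.
have act_om : omega (fixp g *m x) (k *: rG g *m y) = omega (fixp g *m x) y.
  by rewrite -{1}act_fixp -mulmxA -!scalemxAl omZl omZr isoG mulrA kk mul1r.
by rewrite mulmxBl mul1mx addrC -scaleN1r omPr mulN1r act_om addNr.
Qed.

Lemma om_fixpl g x y : omega (fixp g *m x) (fixp g *m y) = omega (fixp g *m x) y.
Proof.
have {2}-> : y = fixp g *m y + tw g *m (twinv g *m y).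
  by rewrite mulmxA tw_twinv mulmxBl mul1mx addrC subrK.
by rewrite -[X in X + _]scale1r omPr om_fixp_tw mul1r addr0.
Qed.

Lemma om_fixpr g x y : omega (fixp g *m x) (fixp g *m y) = omega x (fixp g *m y).
Proof. by rewrite omC om_fixpl -omC. Qed.

Lemma om_fixp g x y : omega (fixp g *m x) y = omega x (fixp g *m y).
Proof. by rewrite -om_fixpl om_fixpr. Qed.

End Kappa.
End FixedSpaces.

(** * The plane V_r of a symplectic reflection *)

Section Reflections.
Variables (C : numFieldType) (n : nat) (gT : finGroupType).
Variables (omega : {skew_symmetric 'cV[C]_n}) (rG : mx_representation C [set: gT] n).
Hypothesis isoG : forall g x y, omega (rG g *m x) (rG g *m y) = omega x y.
Local Notation V := 'cV[C]_n.
Implicit Types (x y z : V) (g h r : gT).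

Let k1 : 1 * 1 = 1 :> C. Proof. by rewrite mulr1. Qed.

Definition reflp r : 'M[C]_n := 1 - fixp rG 1 r.

Lemma gact_sub1 r x : (Defs.gact rG r - \1%VF) x = - (tw rG 1 r *m x).
Proof.
rewrite add_lfunE opp_lfunE id_lfunE gactE /tw scale1r mulmxBl mul1mx opprB //.
Qed.

Lemma memv_lker1 r x :
  (x \in lker (Defs.gact rG r - \1%VF)) = (fixp rG 1 r *m x == x).
Proof.
rewrite memv_ker gact_sub1 oppr_eq0 fixpP // /tw scale1r mulmxBl mul1mx.
by rewrite subr_eq0 eq_sym.
Qed.

Lemma reflp_limg r x : reflp r *m x \in limg (Defs.gact rG r - \1%VF).
Proof.
rewrite /reflp -tw_twinv -mulmxA -[_ *m _]opprK rpredN -gact_sub1.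
exact/memv_img/memvf.
Qed.

Lemma limg_fixp r x : x \in limg (Defs.gact rG r - \1%VF) -> fixp rG 1 r *m x = 0.
Proof.
case/memv_imgP => y _ ->; rewrite gact_sub1 mulmxN mulmxA fixp_tw //.
by rewrite mul0mx oppr0.
Qed.

Lemma limg_lker_cap r : (limg (Defs.gact rG r - \1%VF) :&: lker (Defs.gact rG r - \1%VF))%VS = 0%VS.
Proof.
apply/eqP; rewrite -subv0; apply/subvP => x; rewrite memv_cap memv_lker1.
by case/andP => /limg_fixp -> /eqP <-; rewrite mem0v.
Qed.

Lemma daddv_reflp r x :
  daddv_pi (limg (Defs.gact rG r - \1%VF)) (lker (Defs.gact rG r - \1%VF)) x = reflp r *m x.
Proof.
have fx : fixp rG 1 r *m x \in lker (Defs.gact rG r - \1%VF).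
  by rewrite memv_lker1 mulmxA fixp_idem.
have {1}-> : x = reflp r *m x + fixp rG 1 r *m x by rewrite mulmxBl mul1mx subrK.
rewrite linearD /= daddv_pi_id ?limg_lker_cap ?reflp_limg //.
have := daddv_pi_add (limg_lker_cap r) (subvP (addvSr _ _) _ fx).
rewrite [X in _ + X]daddv_pi_id //; last by rewrite capvC limg_lker_cap.
by move/(canRL (addrK _)); rewrite subrr => ->; rewrite addr0.
Qed.

Lemma omega_reflE r x y : omega_refl omega rG r x y = omega (reflp r *m x) (reflp r *m y).
Proof. by rewrite /omega_refl !daddv_reflp. Qed.

Lemma omega_reflC r x y : omega_refl omega rG r x y = - omega_refl omega rG r y x.
Proof. by rewrite !omega_reflE omC. Qed.

Lemma omega_reflPl r a x y z :
  omega_refl omega rG r (a *: x + y) z =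
  a * omega_refl omega rG r x z + omega_refl omega rG r y z.
Proof. by rewrite !omega_reflE mulmxDr -scalemxAr omPl. Qed.

Lemma reflp_conj r h : reflp (h * r * h^-1)%g = rG h *m reflp r *m rG h^-1%g.
Proof. by rewrite /reflp fixp_conj // mulmxBr mulmxBl mulmx1 rGVr. Qed.

Lemma omega_refl_conj r h x y :
  omega_refl omega rG (h * r * h^-1)%g (rG h *m x) (rG h *m y) = omega_refl omega rG r x y.
Proof.
by rewrite !omega_reflE reflp_conj -!mulmxA ![rG h^-1%g *m (_ *m _)]mulmxA rGV !mul1mx isoG.
Qed.

Lemma sreflection_conj r h : ((h * r * h^-1)%g \in sreflections rG) = (r \in sreflections rG).
Proof.
suff sub r' h' : r' \in sreflections rG -> (h' * r' * h'^-1)%g \in sreflections rG.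
  apply/idP/idP => [/(sub _ h^-1%g)|]; last exact: sub.
  by rewrite invgK !mulgA mulVg mul1g mulgKV.
rewrite !inE => /eqP <-; apply/eqP.
have -> : (Defs.gact rG (h' * r' * h'^-1) - \1 =
    Defs.gact rG h' \o (Defs.gact rG r' - \1) \o Defs.gact rG h'^-1)%VF.
  apply/lfunP => x; rewrite !comp_lfunE !gact_sub1 !gactE !mulmxN; congr (- _).
  by rewrite /tw !scale1r !rGM !mulmxA mulmxBr mulmx1 !mulmxBl rGVr.
have inj g : lker (Defs.gact rG g) == 0%VS.
  apply/lker0P => x y; rewrite !gactE => /(congr1 (mulmx (rG g^-1%g))).
  by rewrite !mulmxA rGV !mul1mx.
rewrite !limg_comp (lker0_limgf (inj _)) limg_dim_eq //.
by rewrite (eqP (inj h')) capv0.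
Qed.

(** V_r is a plane, so an alternating expression in three of its vectors vanishes. *)
Lemma omega_refl_plane r x y z : r \in sreflections rG ->
  omega_refl omega rG r x y *: (reflp r *m z) +
  omega_refl omega rG r y z *: (reflp r *m x) +
  omega_refl omega rG r z x *: (reflp r *m y) = 0.
Proof.
rewrite inE => /eqP dim2.
have [v1 [v2 span12]] : exists v1 v2 : V, forall u : V, exists a b : C,
    reflp r *m u = a *: v1 + b *: v2.
  have := span_basis (vbasisP (limg (Defs.gact rG r - \1%VF))).
  have := etrans (size_tuple (vbasis (limg (Defs.gact rG r - \1%VF)))) dim2.
  case: (tval (vbasis _)) => [|v1 [|v2 []]] // _ spanE; exists v1, v2 => u.
  have := reflp_limg r u; rewrite -spanE span_cons span_seq1.
  by case/memv_addP => _ /vlineP[a ->] [_ /vlineP[b ->] ->]; exists a, b.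
rewrite !omega_reflE.
have [a [b xE]] := span12 x; have [c [d yE]] := span12 y; have [e [f zE]] := span12 z.
rewrite xE yE zE.
rewrite !omPl !omPr !omZl !omZr !omxx (omC omega v2 v1).
move: (omega v1 v2) => w.
by apply/matrixP => i j; rewrite !mxE; ring.
Qed.

Lemma rG_sub1 r z : rG r *m z - z = - (tw rG 1 r *m (reflp r *m z)).
Proof.
rewrite /reflp mulmxA mulmxBr mulmx1 tw_fixp // subr0.
by rewrite /tw scale1r mulmxBl mul1mx opprB.
Qed.

(** [r z - z] depends only on the component of z in V_r, so the plane identity applies. This is the
    Jacobi identity for the reflection terms of the commutator. *)
Lemma omega_refl_cyclic r x y z : r \in sreflections rG ->
  omega_refl omega rG r x y *: (rG r *m z - z) +
  omega_refl omega rG r y z *: (rG r *m x - x) +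
  omega_refl omega rG r z x *: (rG r *m y - y) = 0.
Proof.
move=> rR; rewrite !rG_sub1 !scalerN -!opprD.
have := congr1 (mulmx (tw rG 1 r)) (omega_refl_plane x y z rR).
by rewrite mulmx0 !mulmxDr -!scalemxAr => ->; rewrite oppr0.
Qed.

End Reflections.

(** * Multiplication by a reflection and the dimension of the fixed space *)

Section FixedDimension.
Variables (C : numFieldType) (n : nat) (gT : finGroupType).
Variables (omega : {skew_symmetric 'cV[C]_n}) (rG : mx_representation C [set: gT] n).
Hypothesis isoG : forall g x y, omega (rG g *m x) (rG g *m y) = omega x y.

Local Notation V := 'cV[C]_n.
Variable k : C.
Hypothesis kk : k * k = 1.

Lemma mulmx_cV_inj m (A B : 'M[C]_(m, n)) : (forall x : V, A *m x = B *m x) -> A = B.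
Proof.
by move=> AB; apply/matrixP => i j; have := AB (delta_mx j 0); rewrite -!colE => /matrixP/(_ i 0); rewrite !mxE.
Qed.

(* If [z] is fixed by [k r g] then [(k g - 1) z = (r^-1 - 1) z] lies in V_r and is
   orthogonal to the fixed space of [k g], whose projection to V_r is onto. *)
Lemma fixdim_refl (r g : gT) (x y : V) : r \in sreflections rG ->
    fixp rG k g *m x = x -> fixp rG k g *m y = y ->
  omega_refl omega rG r x y != 0 -> (fixdim rG k (r * g) < fixdim rG k g)%N.
Proof.
move=> rR xg yg wxy; pose q := reflp rG r.
have k1 : 1 * 1 = 1 :> C by rewrite mulr1.
have qq u v : omega (q *m u) v = omega (q *m u) (q *m v).
  rewrite /q /reflp !mulmxBl !mul1mx.
  have pu w : omega (u - fixp rG 1 r *m u) (fixp rG 1 r *m w) = 0.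
    rewrite -scaleN1r addrC omPl mulN1r (om_fixp isoG k1).
    by rewrite mulmxA fixp_idem // addNr.
  by rewrite -[v in LHS](subrK (fixp rG 1 r *m v)) -[v - _ in LHS]scale1r omPr pu addr0 mul1r.
have sub_fix (z : V) : fixp rG k (r * g) *m z = z -> fixp rG k g *m z = z /\ q *m z = 0.
  move=> zrg; have rgz : rG r *m (k *: rG g *m z) = z.
    have /eqP := zrg; rewrite fixpP // => /eqP {2}<-.
    by rewrite rGM -!scalemxAl -scalemxAr mulmxA.
  have gz : k *: rG g *m z = rG r^-1%g *m z by rewrite -{2}rgz mulmxA rGV mul1mx.
  pose w := rG r^-1%g *m z - z.
  have qw : q *m w = w.
    rewrite /q /reflp mulmxBl mul1mx.
    suff -> : fixp rG 1 r *m w = 0 by rewrite subr0.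
    have -> : w = tw rG 1 r *m (rG r^-1%g *m z).
      by rewrite /tw scale1r mulmxBl mul1mx mulmxA rGVr mul1mx.
    by rewrite mulmxA fixp_tw // mul0mx.
  have wtw : w = - (tw rG k g *m z).
    by rewrite /tw mulmxBl mul1mx gz opprB.
  have w_fix (u : V) : fixp rG k g *m u = u -> omega w (q *m u) = 0.
    move=> ug; rewrite -qw -qq qw wtw omC -ug -scaleN1r omZr.
    by rewrite (om_fixp_tw isoG kk) mulr0 oppr0.
  suff w0 : w = 0.
    have zr : rG r *m z = z.
      move/eqP: w0; rewrite subr_eq0 => /eqP rz.
      by rewrite -{1}rz mulmxA rGVr mul1mx.
    split; first by apply/eqP; rewrite fixpP // gz -{1}zr mulmxA rGV mul1mx.
    rewrite /q /reflp mulmxBl mul1mx; apply/eqP; rewrite subr_eq0 eq_sym fixpP //.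
    by rewrite scale1r zr.
  (* Orthogonality kills two of the three terms and leaves omega_r(x, y) w = 0. *)
  have := omega_refl_plane omega x y w rR.
  rewrite !omega_reflE -/q qw (omC omega _ w).
  rewrite !w_fix // oppr0 !scale0r !addr0 => /eqP.
  by rewrite scaler_eq0 -omega_reflE (negPf wxy) => /eqP.
have subE : fixp rG k g *m fixp rG k (r * g) = fixp rG k (r * g).
  apply: mulmx_cV_inj => z; rewrite -mulmxA.
  by have [|-> //] := sub_fix (fixp rG k (r * g) *m z); rewrite mulmxA fixp_idem.
have leP : ((fixp rG k (r * g))^T <= (fixp rG k g)^T)%MS.
  by rewrite -{1}subE trmx_mul submxMl.
rewrite /fixdim -mxrank_tr -[X in (_ < X)%N]mxrank_tr (ltn_leqif (mxrank_leqif_sup leP)).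
(* If the dimensions agreed, x would be fixed by k r g and its component in V_r would be 0. *)
apply: contra wxy => /submxP[D /(congr1 trmx)]; rewrite trmxK trmx_mul trmxK => PE.
rewrite omega_reflE -[x]xg PE -mulmxA.
have [|_] := sub_fix (fixp rG k (r * g) *m (D^T *m x)); first by rewrite mulmxA fixp_idem.
rewrite -/q => ->; rewrite -(scale0r 0) omZl mul0r //.
Qed.
End FixedDimension.

(** * Operators on S(V) (x) C[G] and its filtration by degree *)

Section SmashModule.
Variables (C : numFieldType) (n : nat) (gT : finGroupType).
Variables (omega : {skew_symmetric 'cV[C]_n}) (rG : mx_representation C [set: gT] n).
Variable eta : gT -> C.
Local Notation V := 'cV[C]_n.
Local Notation S := {mpoly C[n]}.
Local Notation M := {ffun gT -> S}.
Implicit Types (x y z : V) (a g h r : gT) (m : M) (f : S).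

(* Elements of S(V) (x) C[G] are encoded by their coefficients in S(V). *)
Definition mX x m : M := [ffun g => lin x * m g].
Definition mD (i : 'I_n) m : M := [ffun g => (m g)^`M(i)].
Definition mJ (d : nat) m : M := [ffun g => eulinv d (m g)].
Definition mG a m : M := [ffun g => subst (rG a) (m (a^-1 * g)%g)].
Definition mE m : M := [ffun g => euler (m g)].

Fact mX_linear x : linear (mX x).
Proof. by move=> b m m'; apply/ffunP => g; rewrite !ffunE mulrDr scalerAr. Qed.
Fact mD_linear i : linear (mD i).
Proof. by move=> b m m'; apply/ffunP => g; rewrite !ffunE linearP. Qed.
Fact mJ_linear d : linear (mJ d).
Proof. by move=> b m m'; apply/ffunP => g; rewrite !ffunE linearP. Qed.
Fact mG_linear a : linear (mG a).
Proof. by move=> b m m'; apply/ffunP => g; rewrite !ffunE linearP. Qed.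
Fact mE_linear : linear mE.
Proof. by move=> b m m'; apply/ffunP => g; rewrite !ffunE linearP. Qed.
HB.instance Definition _ x := GRing.isLinear.Build C M M _ (mX x) (mX_linear x).
HB.instance Definition _ i := GRing.isLinear.Build C M M _ (mD i) (mD_linear i).
HB.instance Definition _ d := GRing.isLinear.Build C M M _ (mJ d) (mJ_linear d).
HB.instance Definition _ a := GRing.isLinear.Build C M M _ (mG a) (mG_linear a).
HB.instance Definition _ := GRing.isLinear.Build C M M _ mE mE_linear.

Lemma mXPl b x y m : mX (b *: x + y) m = b *: mX x m + mX y m.
Proof. by apply/ffunP => g; rewrite !ffunE linearP mulrDl scalerAl. Qed.

Lemma mX_comm x y m : mX x (mX y m) = mX y (mX x m).
Proof. by apply/ffunP => g; rewrite !ffunE mulrCA. Qed.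

Lemma mG_mul a b m : mG a (mG b m) = mG (a * b) m.
Proof. by apply/ffunP => g; rewrite !ffunE subst_comp rGM invMg mulgA. Qed.

Lemma mG1 m : mG 1 m = m.
Proof. by apply/ffunP => g; rewrite !ffunE rG1 subst_id invg1 mul1g. Qed.

Lemma mG_X a x m : mG a (mX x m) = mX (rG a *m x) (mG a m).
Proof. by apply/ffunP => g; rewrite !ffunE substM subst_lin. Qed.

Lemma mG_J a d m : (0 < d)%N -> mG a (mJ d m) = mJ d (mG a m).
Proof. by move=> d0; apply/ffunP => g; rewrite !ffunE eulinv_subst. Qed.

Lemma mD_G a i m : mD i (mG a m) = \sum_j rG a i j *: mG a (mD j m).
Proof.
apply/ffunP => g; rewrite sum_ffunE !ffunE mderiv_subst.
by apply: eq_bigr => j _; rewrite !ffunE.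
Qed.

Lemma eulinv_linM d x f : eulinv d (lin x * f) = lin x * eulinv d.+1 f.
Proof.
rewrite linE !mulr_suml linear_sum /=; apply: eq_bigr => i _.
by rewrite -!scalerAl linearZ /= eulinvX.
Qed.

Lemma mJ_X d x m : mJ d (mX x m) = mX x (mJ d.+1 m).
Proof. by apply/ffunP => g; rewrite !ffunE eulinv_linM. Qed.

Lemma mJK d m : (0 < d)%N -> mE (mJ d m) + d%:R *: mJ d m = m.
Proof. by move=> d0; apply/ffunP => g; rewrite !ffunE eulinvK. Qed.

Lemma mD_X i x m : mD i (mX x m) = x i 0 *: m + mX x (mD i m).
Proof. by apply/ffunP => g; rewrite !ffunE mderivM mderiv_lin mul_mpolyC. Qed.

Lemma sum_mX_mD m : \sum_i mX (delta_mx i 0) (mD i m) = mE m.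
Proof.
apply/ffunP => g; rewrite sum_ffunE !ffunE eulerE.
by apply: eq_bigr => i _; rewrite !ffunE lin_delta.
Qed.

Fact mC_key : unit. Proof. by []. Qed.
(** The operator by which the commutator of x and y in [H] has to act. *)
Definition mC x y m : M := locked_with mC_key (omega x y *: m +
  \sum_(r in sreflections rG) (eta r * omega_refl omega rG r x y) *: mG r m).

Lemma mCE x y m : mC x y m = omega x y *: m +
  \sum_(r in sreflections rG) (eta r * omega_refl omega rG r x y) *: mG r m.
Proof. by rewrite /mC unlock. Qed.

Fact mC_linear x y : linear (mC x y).
Proof.
move=> b m m'; rewrite !mCE [b *: (_ + _)]scalerDr [RHS]addrACA; congr (_ + _).
  by rewrite scalerDr !scalerA mulrC.
rewrite scaler_sumr -big_split; apply: eq_bigr => r _.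
by rewrite linearP /= scalerDr !scalerA mulrC.
Qed.
HB.instance Definition _ x y := GRing.isLinear.Build C M M _ (mC x y) (mC_linear x y).

Section Filtration.

Definition homM d m : Prop := forall g, hom d (m g).

Lemma homM_lin d b m m' : homM d m -> homM d m' -> homM d (b *: m + m').
Proof. by move=> hm hm' g; rewrite !ffunE; apply: hom_lin. Qed.
Lemma homM0 d : homM d 0. Proof. by move=> g; rewrite ffunE; apply: hom0. Qed.
Lemma homM_sum d (I : Type) (s : seq I) (P : pred I) (F : I -> M) :
  (forall i, P i -> homM d (F i)) -> homM d (\sum_(i <- s | P i) F i).
Proof.
move=> hF; elim/big_ind: _ => // [|m m' hm hm']; first exact: homM0.
by rewrite -[m]scale1r; apply: homM_lin.
Qed.
Lemma homM_X d x m : homM d m -> homM d.+1 (mX x m).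
Proof. by move=> hm g; rewrite ffunE; apply: hom_linM. Qed.
Lemma homM_D d i m : homM d.+1 m -> homM d (mD i m).
Proof. by move=> hm g; rewrite ffunE; apply: hom_mderiv. Qed.
Lemma mD_homM0 i m : homM 0 m -> mD i m = 0.
Proof. by move=> hm; apply/ffunP => g; rewrite !ffunE mderiv_hom0. Qed.
Lemma homM_G d a m : homM d m -> homM d (mG a m).
Proof. by move=> hm g; rewrite ffunE; apply: hom_subst. Qed.
Lemma homM_J d e m : homM d m -> homM d (mJ e.+1 m).
Proof.
move=> hm g; rewrite ffunE; have := hm g; rewrite /hom => hg.
rewrite -[euler (eulinv _ _)](addrK (e.+1%:R *: eulinv e.+1 (m g))) eulinvK //.
apply/eqP; rewrite subr_eq -scalerDl -natrD; apply/eqP.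
rewrite -linearZ /= natrD scalerDl -hg eulerK //.
Qed.
Lemma homM_C d x y m : homM d m -> homM d (mC x y m).
Proof.
move=> hm; rewrite mCE; apply: homM_lin => //; apply: homM_sum => r _.
by rewrite -[_ *: _]addr0; apply: homM_lin (homM0 _); apply: homM_G.
Qed.

(* [low k m]: the degrees of the homogeneous components of [m] are at most
   [k - 2] and of the parity of [k]. *)
Fixpoint low k m : Prop :=
  match k with
  | 0 | 1 => m = 0
  | k.+2 => exists m1, homM k m1 /\ low k (m - m1)
  end.

Lemma low_ind2 (P : nat -> Prop) : P 0%N -> P 1%N -> (forall k, P k -> P k.+2) -> forall k, P k.
Proof.
move=> P0 P1 PS k; suff [] : P k /\ P k.+1 by [].
by elim: k => [|k [IH1 IH2]]; split => //; apply: PS.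
Qed.

Lemma low_lin k b m m' : low k m -> low k m' -> low k (b *: m + m').
Proof.
elim/low_ind2: k m m' => [||k IH] m m' /=.
- by move=> -> ->; rewrite scaler0 addr0.
- by move=> -> ->; rewrite scaler0 addr0.
case=> m1 [hm1 l1] [m2 [hm2 l2]]; exists (b *: m1 + m2); split; first exact: homM_lin.
by rewrite opprD addrACA -scalerBr; apply: IH.
Qed.

Lemma low0 k : low k 0.
Proof.
elim/low_ind2: k => //= k IH; exists 0; rewrite subrr; split => //; exact: homM0.
Qed.

Lemma lowD k m m' : low k m -> low k m' -> low k (m + m').
Proof. by move=> lm lm'; rewrite -[m]scale1r; apply: low_lin. Qed.
Lemma lowZ k b m : low k m -> low k (b *: m).
Proof. by move=> lm; rewrite -[_ *: _]addr0; apply: low_lin => //; apply: low0. Qed.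
Lemma lowB k m m' : low k m -> low k m' -> low k (m - m').
Proof. by move=> lm lm'; apply: lowD => //; rewrite -scaleN1r; apply: lowZ. Qed.
Lemma low_sum k (I : Type) (s : seq I) (P : pred I) (F : I -> M) :
  (forall i, P i -> low k (F i)) -> low k (\sum_(i <- s | P i) F i).
Proof. by move=> lF; elim/big_ind: _ => //; [apply: low0 | apply: lowD]. Qed.

Lemma low_up k m : low k m -> low k.+2 m.
Proof. by move=> lm; exists 0; rewrite subr0; split => //; apply: homM0. Qed.

Lemma low_hom k m : homM k m -> low k.+2 m.
Proof. by move=> hm; exists m; rewrite subrr; split => //; apply: low0. Qed.

Lemma low_raise (T : {linear M -> M}) k m :
  (forall d m', homM d m' -> homM d.+1 (T m')) -> low k m -> low k.+1 (T m).
Proof.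
move=> hT; elim/low_ind2: k m => [||k IH] m /=.
- by move=> ->; rewrite linear0.
- move=> ->; rewrite linear0; exists 0; rewrite subrr; split => //; exact: homM0.
case=> m1 [hm1 l1]; exists (T m1); split; first exact: hT.
by rewrite -linearB; apply: IH.
Qed.

Lemma low_keep (T : {linear M -> M}) k m :
  (forall d m', homM d m' -> homM d (T m')) -> low k m -> low k (T m).
Proof.
move=> hT; elim/low_ind2: k m => [||k IH] m /=; try by move=> ->; rewrite linear0.
case=> m1 [hm1 l1]; exists (T m1); split; first exact: hT.
by rewrite -linearB; apply: IH.
Qed.

Lemma low_X k x m : low k m -> low k.+1 (mX x m).
Proof. by apply: low_raise => d m'; apply: homM_X. Qed.
Lemma low_J k e m : low k m -> low k (mJ e.+1 m).
Proof. by apply: low_keep => d m'; apply: homM_J. Qed.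
Lemma low_C k x y m : low k m -> low k (mC x y m).
Proof. by apply: low_keep => d m'; apply: homM_C. Qed.
Lemma low_G k a m : low k m -> low k (mG a m).
Proof. by apply: low_keep => d m'; apply: homM_G. Qed.
Lemma low_D k i m : low k.+1 m -> low k (mD i m).
Proof.
elim/low_ind2: k m => [||k IH] m /=.
- by move=> ->; rewrite linear0.
- by case=> m1 [hm1 /eqP]; rewrite subr_eq0 => /eqP ->; rewrite mD_homM0.
case=> m1 [hm1 l1]; exists (mD i m1); split; first exact: homM_D.
by rewrite -linearB; apply: IH.
Qed.

(** Applying the Euler operator to m - m1 shows that (d - k) m1 lies one step lower in the
    filtration; so m itself does, and the descent ends at 0. *)
Lemma homM_low_eq0 d k m : (k < d.+2)%N || (odd k != odd d) ->
  homM d m -> low k m -> m = 0.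
Proof.
elim/low_ind2: k m => [||k IH] m //= kd hm [m1 [hm1 l1]]; apply: IH => //.
  case/orP: kd => [kd|]; last by rewrite /= negbK => ->; rewrite orbT.
  by rewrite (leq_trans (leqnSn _) (ltnW kd)).
have dk : (d%:R - k%:R : C) != 0.
  rewrite subr_eq0 eqr_nat; apply/eqP => dE; move: kd.
  by rewrite dE ltnn /= negbK eqxx.
have Em1 : mE m1 = k%:R *: m1 by apply/ffunP => g; rewrite !ffunE; apply: hm1.
have Em : mE m = d%:R *: m by apply/ffunP => g; rewrite !ffunE; apply: hm.
have m1E : (d%:R - k%:R) *: m1 = mE (m - m1) - d%:R *: (m - m1).
  by rewrite linearB /= Em Em1 scalerBr scalerBl opprB [RHS]addrC addrA subrK.
have l1' : low k m1.
  rewrite -[m1]scale1r -(mulVf dk) -scalerA m1E; apply/lowZ/lowB; last exact: lowZ.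
  apply: low_keep l1 => e m' hm' g; rewrite ffunE; have := hm' g; rewrite /hom => ->.
  by rewrite linearZ /= (hm' g).
by rewrite -[m](subrK m1); apply: lowD.
Qed.

End Filtration.
End SmashModule.

(** * Left multiplication by vectors: the Poincare homotopy and the PBW theorem *)

Section LeftMultiplication.
Variables (C : numFieldType) (n : nat) (gT : finGroupType).
Variables (omega : {skew_symmetric 'cV[C]_n}) (rG : mx_representation C [set: gT] n).
Variable eta : gT -> C.
Local Notation V := 'cV[C]_n.
Local Notation S := {mpoly C[n]}.
Local Notation M := {ffun gT -> S}.
Implicit Types (x y z : V) (a g h r : gT) (m : M) (f : nat).
Local Notation e_ i := (delta_mx i 0 : V).
Local Notation cM := (mC omega rG eta).
Local Notation gM := (mG rG).

Lemma mC_skew x y m : cM x y m = - cM y x m.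
Proof.
rewrite !mCE opprD -scaleNr -(omC omega) -sumrN; congr (_ + _).
by apply: eq_bigr => r _; rewrite -scaleNr -mulrN -(omega_reflC omega).
Qed.

Lemma mC_linl y m : linear (fun x => cM x y m).
Proof.
move=> b x z; rewrite !mCE omPl scalerDl -scalerA [b *: (_ + _)]scalerDr [RHS]addrACA.
congr (_ + _); rewrite scaler_sumr -big_split; apply: eq_bigr => r _ /=.
by rewrite omega_reflPl mulrDr scalerDl scalerA mulrCA.
Qed.

Lemma mC_linm x m : linear (fun y => cM x y m).
Proof. by move=> b y z; rewrite mC_skew mC_linl opprD -scalerN -!mC_skew. Qed.

Section Potential.
Variable lo : V -> M -> M.

(* Left multiplication by [x] is sought as [mX x + lo x]. The relation [x, y] = c(x, y)
   then reads [lo x (y m) - lo y (x m) = phi x y m]; [nextlo] is its solution by the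
   homotopy of the polynomial de Rham complex, given [lo] in lower degrees. *)
Definition addlo x m : M := mX x m + lo x m.
Definition phi x y m : M := cM x y m - addlo x (lo y m) + addlo y (lo x m).
Definition nextlo x m : M := \sum_j phi x (e_ j) (mD j (mJ 1 m)).

Hypothesis lo_linl : forall m, linear (lo^~ m).
Hypothesis lo_linr : forall x, linear (lo x).

Lemma addlo_linl m : linear (addlo^~ m).
Proof. by move=> b x y; rewrite /addlo mXPl lo_linl scalerDr addrACA. Qed.
Lemma addlo_linr x : linear (addlo x).
Proof. by move=> b m m'; rewrite /addlo linearP /= lo_linr scalerDr addrACA. Qed.

Let comb3 (b : C) (c c' l l' p p' : M) :
  (b *: c + c') - (b *: l + l') + (b *: p + p') = b *: (c - l + p) + (c' - l' + p').
Proof. by rewrite !scalerDr scalerN [RHS]addrACA opprD [b *: c - _ + _]addrACA. Qed.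

Lemma phi_linr x y : linear (phi x y).
Proof. by move=> b m m'; rewrite /phi linearP /= !lo_linr !addlo_linr comb3. Qed.
Lemma phi_linm x m : linear (fun y => phi x y m).
Proof.
by move=> b y z; rewrite /phi lo_linl !addlo_linr addlo_linl mC_linm comb3.
Qed.
Lemma phi_skew x y m : phi x y m = - phi y x m.
Proof. by rewrite /phi mC_skew !opprD !opprK addrAC. Qed.
Lemma phi_linl y m : linear (fun x => phi x y m).
Proof. by move=> b x z; rewrite phi_skew phi_linm opprD -scalerN -!phi_skew. Qed.

Lemma nextlo_linl m : linear (nextlo^~ m).
Proof.
move=> b x y; rewrite /nextlo scaler_sumr -big_split; apply: eq_bigr => j _.
exact: phi_linl.
Qed.
Lemma nextlo_linr x : linear (nextlo x).
Proof.
move=> b m m'; rewrite /nextlo scaler_sumr -big_split; apply: eq_bigr => j _.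
by rewrite !linearP /= phi_linr.
Qed.

Lemma phi_sumr x y (I : finType) (F : I -> M) : phi x y (\sum_i F i) = \sum_i phi x y (F i).
Proof.
pose F' := GRing.isLinear.Build C M M _ (phi x y) (phi_linr x y).
pose T : {linear M -> M} := HB.pack (phi x y) F'.
exact: (linear_sum T).
Qed.

Lemma phi_summ x m (F : 'I_n -> C) :
  \sum_j F j *: phi x (e_ j) m = phi x (\sum_j F j *: e_ j) m.
Proof.
pose F' := GRing.isLinear.Build C V M _ (fun y => phi x y m) (phi_linm x m).
pose T : {linear V -> M} := HB.pack (fun y => phi x y m) F'.
rewrite -[RHS]/(T _) linear_sum; apply: eq_bigr => j _.
by rewrite linearZ.
Qed.

Lemma phi_sum_delta x y m : \sum_j y j 0 *: phi x (e_ j) m = phi x y m.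
Proof. by rewrite phi_summ -vec_sum_delta. Qed.

Hypothesis lo_eqv : forall a x m, gM a (lo x m) = lo (rG a *m x) (gM a m).
Hypothesis isoG : forall g x y, omega (rG g *m x) (rG g *m y) = omega x y.
Hypothesis eta_central :
  forall r g, r \in sreflections rG -> eta (r ^ g)%g = eta r.

Lemma mG_C a x y m : gM a (cM x y m) = cM (rG a *m x) (rG a *m y) (gM a m).
Proof.
rewrite !mCE linearD linearZ linear_sum /= isoG; congr (_ + _).
have conjK : cancel (fun r => a * r * a^-1)%g (fun r => a^-1 * r * a)%g.
  by move=> r; rewrite !mulgA mulVg mul1g mulgKV.
have conjK' : cancel (fun r => a^-1 * r * a)%g (fun r => a * r * a^-1)%g.
  by move=> r; rewrite !mulgA mulgV mul1g mulgK.
rewrite [RHS](reindex (fun r => a * r * a^-1)%g); last first.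
  by exists (fun r => a^-1 * r * a)%g => r _; [apply: conjK | apply: conjK'].
apply: eq_big => [r|r rR]; first by rewrite sreflection_conj.
rewrite linearZ /= omega_refl_conj // !mG_mul mulgKV; congr (_ * _ *: _).
by rewrite -[LHS](eta_central a^-1 rR) conjgE invgK mulgA.
Qed.

Lemma mG_phi a x y m : gM a (phi x y m) = phi (rG a *m x) (rG a *m y) (gM a m).
Proof.
rewrite {1}/phi linearD linearB /= mG_C.
by rewrite /phi /addlo !linearD /= !mG_X !lo_eqv. Qed.

(** The sum over j pairs a basis of V with the derivatives dual to it, so it does not depend on the
    basis. *)
Lemma nextlo_eqv a x m : gM a (nextlo x m) = nextlo (rG a *m x) (gM a m).
Proof.
rewrite /nextlo linear_sum /=; under eq_bigr => j _ do rewrite mG_phi.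
under [RHS]eq_bigr => j _ do rewrite -mG_J // mD_G phi_sumr.
rewrite exchange_big /=; apply: eq_bigr => j _.
rewrite mulmx_delta -phi_summ; apply: eq_bigr => i _.
pose F' := GRing.isLinear.Build C M M _ _ (phi_linr (rG a *m x) (e_ i)).
pose T : {linear M -> M} := HB.pack (phi (rG a *m x) (e_ i)) F'.
by rewrite -[RHS]/(T _) linearZ.
Qed.

End Potential.

(* [f] bounds the recursion depth. *)
Fixpoint lof f : V -> M -> M :=
  if f is f'.+1 then nextlo (lof f') else fun=> fun=> 0.

Lemma lof_lin f : (forall m, linear ((lof f)^~ m)) /\ (forall x, linear (lof f x)).
Proof.
elim: f => [|f [IHl IHr]] /=; first by split=> [m|x] b u v; rewrite scaler0 addr0.
by split=> [m|x]; [apply: nextlo_linl | apply: nextlo_linr].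
Qed.
Let lof_linl f := (lof_lin f).1.
Let lof_linr f := (lof_lin f).2.

Lemma lof0 f x : lof f x 0 = 0.
Proof. by have := lof_linr f x (-1) 0 0; rewrite scaler0 addr0 scaleN1r addNr. Qed.

Lemma low_addlo lo k x m : (forall y, lo y 0 = 0) ->
    (forall j y m', low j.+1 m' -> low j (lo y m')) ->
  low k m -> low k.+1 (addlo lo x m).
Proof.
move=> lo0 low_lo lm; apply: lowD; first exact: low_X.
case: k lm => [->|k lm]; first by rewrite lo0; apply: low0.
exact/low_up/low_lo.
Qed.

Lemma low_phi lo k x y m : (forall y, lo y 0 = 0) ->
    (forall j y m', low j.+1 m' -> low j (lo y m')) ->
  low k m -> low k (phi lo x y m).
Proof.
move=> lo0 low_lo lm; case: k lm => [->|k lm].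
  by rewrite /phi /addlo !lo0 !linear0 !addr0 subr0.
apply: lowD; first apply: lowB; first exact: low_C.
  exact/low_addlo/low_lo.
exact/low_addlo/low_lo.
Qed.

(** In [nextlo] the derivative lowers the level by one and [phi] preserves it, since [addlo]
    restores what [lo] has lowered. *)
Lemma low_lof f k x m : low k.+1 m -> low k (lof f x m).
Proof.
elim: f k x m => [|f IH] k x m lm /=; first exact: low0.
by apply: low_sum => j _; apply: low_phi => //; [apply: lof0 | apply/low_D/low_J].
Qed.

(** At level k, [nextlo] evaluates the previous approximation only at levels below k, so each
    further iteration settles one more level. *)
Lemma lof_succ f k x m : (k <= f.+1)%N -> low k m -> lof f x m = lof f.+1 x m.
Proof.
elim: f k x m => [|f IH] k x m kf lm.
  have -> : m = 0 by case: k kf lm => [|[|]].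
  by rewrite !lof0.
rewrite /= /nextlo; apply: eq_bigr => j _.
have {lm} : low k.-1 (mD j (mJ 1 m)).
  by case: k kf lm => [|k] kf lm; [rewrite lm !linear0 | apply/low_D/low_J].
move: (mD j _) => {}m lm; have kf1 : (k.-1 <= f.+1)%N by case: k kf {lm}.
have loE y : lof f y m = nextlo (lof f) y m by apply: IH kf1 lm.
have lo2E u y : lof f u (nextlo (lof f) y m) = nextlo (lof f) u (nextlo (lof f) y m).
  rewrite -loE; case: k kf kf1 lm => [|[|k]] kf kf1 lm; try by rewrite lm lof0 -[RHS]/(lof f.+1 u 0) !lof0.
  by apply: (IH k); [exact: ltnW | exact: low_lof].
by rewrite /phi /addlo !loE !lo2E.
Qed.

Lemma lof_leq f f' k x m : (k <= f.+1)%N -> (f <= f')%N -> low k m -> lof f x m = lof f' x m.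
Proof.
move=> kf ff' lm; rewrite -(subnKC ff'); elim: (f' - f)%N => [|d IH]; first by rewrite addn0.
by rewrite IH addnS; apply: lof_succ lm; rewrite (leq_trans kf) // ltnS leq_addr.
Qed.

(** A general element has components of both parities, hence two adjacent levels. *)
Definition lowsum k m := exists m1, low k m1 /\ low k.+1 (m - m1).

Lemma lowsum_succ k m : lowsum k m -> lowsum k.+1 m.
Proof.
case=> m1 [l1 l2]; exists (m - m1); split => //.
by rewrite opprB addrC subrK; apply: low_up.
Qed.

Lemma lowsum_leq k k' m : (k <= k')%N -> lowsum k m -> lowsum k' m.
Proof.
move=> kk' lm; rewrite -(subnKC kk'); elim: (k' - k)%N => [|d IH]; first by rewrite addn0.
by rewrite addnS; apply: lowsum_succ.
Qed.

Lemma lowsum_lin k b m m' : lowsum k m -> lowsum k m' -> lowsum k (b *: m + m').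
Proof.
case=> m1 [l1 l2] [m2 [l3 l4]]; exists (b *: m1 + m2); split; first exact: low_lin.
by rewrite opprD addrACA -scalerBr; apply: low_lin.
Qed.

Lemma ex_lowsum m : exists k, lowsum k m.
Proof.
have delta g (p : S) : exists k, lowsum k [ffun h => if h == g then p else 0].
  elim/mpolyind: p => [|b u p _ _ [k lk]].
    exists 0%N, 0; split; first exact: low0.
    by rewrite subr0; apply/ffunP => h; rewrite !ffunE if_same.
  exists (maxn (mdeg u).+2 k).
  have -> : [ffun h => if h == g then b *: 'X_[u] + p else 0] =
      b *: [ffun h => if h == g then 'X_[u] else 0] + [ffun h => if h == g then p else 0] :> M.
    by apply/ffunP => h; rewrite !ffunE; case: eqP => // _; rewrite scaler0 addr0.
  apply: lowsum_lin; last by apply: lowsum_leq lk; apply: leq_maxr.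
  apply: (@lowsum_leq (mdeg u).+2); first exact: leq_maxl.
  exists [ffun h => if h == g then 'X_[u] else 0]; rewrite subrr; split; last exact: low0.
  apply: low_hom => h; rewrite ffunE; case: eqP => _; last exact: hom0.
  by rewrite /hom eulerX.
have [k lk] : exists k : {ffun gT -> nat}, forall g, lowsum (k g) [ffun h => if h == g then m g else 0].
  exists [ffun g => projT1 (cid (delta g (m g)))] => g; rewrite ffunE.
  exact: projT2 (cid (delta g (m g))).
have [K kK] : exists K, forall g, (k g <= K)%N.
  by exists (\max_g k g)%N => g; apply: leq_bigmax.
exists K.
have -> : m = \sum_g [ffun h => if h == g then m g else 0].
  apply/ffunP => h; rewrite sum_ffunE (bigD1 h) //= big1 => [|g gh]; rewrite !ffunE ?eqxx ?addr0 //.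
  by rewrite eq_sym (negPf gh).
elim/big_ind: _ => [|p q lp lq|g _]; last exact: (lowsum_leq (kK g) (lk g)).
  by exists 0; rewrite subrr; split; apply: low0.
by rewrite -[p]scale1r; apply: lowsum_lin.
Qed.

(* The lower order part of left multiplication by [x] on the symmetrized PBW basis. *)
Definition lo x m : M := lof (projT1 (cid (ex_lowsum m))) x m.

Lemma loE k f x m : lowsum k m -> (k <= f)%N -> lo x m = lof f x m.
Proof.
rewrite /lo; case: (cid _) => k' lk' /= lk kf.
have stab j f1 f2 : lowsum j m -> (j <= f1)%N -> (f1 <= f2)%N -> lof f1 x m = lof f2 x m.
  case=> m1 [l1 l2] jf1 f12; rewrite -(subrK m1 m) -[_ - m1]scale1r !lof_linr.
  congr (_ *: _ + _); [exact: lof_leq l2 | apply: lof_leq l1 => //; exact: leqW].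
rewrite (stab k' k' (maxn k' f)) ?leq_maxl //; apply/esym.
by apply: (stab k) => //; apply: leq_maxr.
Qed.

Lemma lo_linl m : linear (lo^~ m).
Proof.
by have [k lk] := ex_lowsum m; move=> b x y; rewrite !(loE _ lk (leqnn k)) lof_linl.
Qed.

Lemma lo_linr x : linear (lo x).
Proof.
move=> b m m'; have [k lk] := ex_lowsum m; have [k' lk'] := ex_lowsum m'.
have lk2 := lowsum_leq (leq_maxl k k') lk; have lk2' := lowsum_leq (leq_maxr k k') lk'.
by rewrite (loE _ (lowsum_lin b lk2 lk2') (leqnn _)) (loE _ lk2 (leqnn _)) (loE _ lk2' (leqnn _)) lof_linr.
Qed.

Lemma lo0 x : lo x 0 = 0.
Proof. by have := lo_linr x (-1) 0 0; rewrite scaler0 addr0 scaleN1r addNr. Qed.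

Lemma low_lowsum k m : low k m -> lowsum k m.
Proof. by move=> lm; exists m; rewrite subrr; split => //; apply: low0. Qed.

Lemma low_lo k x m : low k.+1 m -> low k (lo x m).
Proof. by move=> lm; rewrite (loE _ (low_lowsum lm) (leqnn _)); apply: low_lof. Qed.

Lemma lowsum_lower (T : M -> M) k m : linear T ->
  (forall j m', low j.+1 m' -> low j (T m')) -> lowsum k m -> lowsum k (T m).
Proof.
move=> Tlin lowT [m1 [l1 l2]].
have TB : T (m - m1) = T m - T m1 by rewrite addrC -scaleN1r Tlin scaleN1r addrC.
case: k l1 l2 => [|k] l1 l2; last first.
  by apply: lowsum_succ; exists (T m1); split; [exact: lowT | rewrite -TB; exact: lowT].
have := lowT _ _ l2; rewrite l1 subr0 => ->; exists 0; rewrite subrr; split; exact: low0.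
Qed.

(** At sufficient depth the iterates are stable, so [lo] is a fixed point of [nextlo]. *)
Lemma lo_rec x m : lo x m = nextlo lo x m.
Proof.
have [k lk] := ex_lowsum m; rewrite (loE _ lk (leqnSn _)) /= /nextlo.
apply: eq_bigr => j _; have : lowsum k (mD j (mJ 1 m)).
  apply: (@lowsum_lower (fun m => mD j (mJ 1 m))) lk => [b u v|i m' lm'].
    by rewrite !linearP.
  exact/low_D/low_J.
move: (mD j _) => m' lm'; have lofE y : lof k y m' = lo y m' by rewrite (loE _ lm' (leqnn k)).
rewrite /phi /addlo !lofE; have lof2E u y : lof k u (lo y m') = lo u (lo y m').
  rewrite (loE u (k := k) (f := k)) //.
  by apply: lowsum_lower lm' => [|i m'']; [exact: lo_linr | exact: low_lo].
by rewrite !lof2E.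
Qed.

Hypothesis isoG : forall g x y, omega (rG g *m x) (rG g *m y) = omega x y.
Hypothesis eta_central :
  forall r g, r \in sreflections rG -> eta (r ^ g)%g = eta r.

Lemma lof_eqv f a x m : gM a (lof f x m) = lof f (rG a *m x) (gM a m).
Proof.
elim: f a x m => [|f IH] a x m /=; first by rewrite linear0.
by apply: nextlo_eqv.
Qed.

Lemma lo_eqv a x m : gM a (lo x m) = lo (rG a *m x) (gM a m).
Proof.
have [k lk] := ex_lowsum m; have lk' : lowsum k (gM a m).
  case: lk => m1 [l1 l2]; exists (gM a m1); split; first exact: low_G.
  by rewrite -linearB; apply: low_G.
by rewrite (loE _ lk (leqnn _)) (loE _ lk' (leqnn _)) lof_eqv.
Qed.

Fact lmul_key : unit. Proof. by []. Qed.
Definition lmul x m : M := locked_with lmul_key (addlo lo x m).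
Lemma lmul_addlo x m : lmul x m = addlo lo x m. Proof. by rewrite /lmul unlock. Qed.
Lemma lmulE x m : lmul x m = mX x m + lo x m. Proof. exact: lmul_addlo. Qed.

Lemma lmul_linl m : linear (lmul^~ m).
Proof. by move=> b x y; rewrite !lmul_addlo; apply: (addlo_linl lo_linl). Qed.
Lemma lmul_linr x : linear (lmul x).
Proof. by move=> b u v; rewrite !lmul_addlo; apply: (addlo_linr lo_linr). Qed.
HB.instance Definition _ x := GRing.isLinear.Build C M M _ (lmul x) (lmul_linr x).

Lemma lmul_eqv a x m : gM a (lmul x m) = lmul (rG a *m x) (gM a m).
Proof. by rewrite !lmulE linearD /= mG_X lo_eqv. Qed.

Lemma low_lmul k x m : low k m -> low k.+1 (lmul x m).
Proof. by rewrite lmul_addlo; apply: low_addlo => *; [apply: lo0 | apply: low_lo]. Qed.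

Lemma lmulDl x y m : lmul (x + y) m = lmul x m + lmul y m.
Proof. by rewrite -[x]scale1r lmul_linl !scale1r. Qed.

Lemma lmulBl x y m : lmul (x - y) m = lmul x m - lmul y m.
Proof. by rewrite addrC -scaleN1r lmul_linl scaleN1r addrC. Qed.

Lemma lmulZl b x m : lmul (b *: x) m = b *: lmul x m.
Proof. by have := lmul_linl m b x (x - x); rewrite lmulBl !subrr !addr0. Qed.

Lemma lmul0r x : lmul x 0 = 0.
Proof. exact: linear0. Qed.
Lemma lmulDr x m m' : lmul x (m + m') = lmul x m + lmul x m'.
Proof. exact: linearD. Qed.
Lemma lmulBr x m m' : lmul x (m - m') = lmul x m - lmul x m'.
Proof. exact: linearB. Qed.
Lemma lmulNr x m : lmul x (- m) = - lmul x m.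
Proof. exact: linearN. Qed.
Lemma lmulZr x b m : lmul x (b *: m) = b *: lmul x m.
Proof. exact: linearZ. Qed.
Lemma lmul_sumr x (I : finType) (P : pred I) (F : I -> M) :
  lmul x (\sum_(i | P i) F i) = \sum_(i | P i) lmul x (F i).
Proof. exact: linear_sum. Qed.

Lemma lmul0l m : lmul 0 m = 0.
Proof. by rewrite -(scale0r (0 : V)) lmulZl scale0r. Qed.

(** The scalar part of the commutator is central, and moving z across r replaces it by r z; what
    remains for each reflection is [omega_refl_cyclic]. *)
Lemma mC_jacobi x y z m :
  (cM x y (lmul z m) - lmul z (cM x y m)) + (cM y z (lmul x m) - lmul x (cM y z m)) +
  (cM z x (lmul y m) - lmul y (cM z x m)) = 0.
Proof.
have comE u v w : cM u v (lmul w m) - lmul w (cM u v m) =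
    \sum_(r in sreflections rG)
       lmul ((eta r * omega_refl omega rG r u v) *: (rG r *m w - w)) (gM r m).
  rewrite !mCE lmulDr lmulZr lmul_sumr opprD addrACA subrr add0r -sumrB.
  by apply: eq_bigr => r _; rewrite lmulZr lmulZl lmulBl scalerBr lmul_eqv.
rewrite !comE -!big_split big1 // => r rR /=.
rewrite -!lmulDl -!scalerA -!scalerDr omega_refl_cyclic // scaler0.
exact: lmul0l.
Qed.

Local Notation Phi := (phi lo).

Lemma phiE x y m : Phi x y m = cM x y m - lmul x (lo y m) + lmul y (lo x m).
Proof. by rewrite !lmul_addlo. Qed.

(** A rearrangement that turns the defect of the commutation relation into the defect of [lo] as a
    potential of [Phi]. *)
Lemma lmul_comm_phi x y m :
  lmul x (lmul y m) - lmul y (lmul x m) - cM x y m =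
  lo x (mX y m) - lo y (mX x m) - Phi x y m.
Proof.
rewrite phiE (lmulE y m) (lmulE x m) !lmulDr (lmulE x (mX y m)) (lmulE y (mX x m)).
rewrite (mX_comm y x).
move: (mX x _) (lo x (mX y m)) (lo y (mX x m)) (lmul x _) (lmul y _) (cM x y m) => a b c d e f.
by apply/ffunP => g; rewrite !ffunE; ring.
Qed.

(** Closedness of [Phi]: once the commutation relation holds at m and at each [lo w m], the cyclic
    sum becomes the Jacobi identity of [mC]. *)
Lemma phi_cyclic x y z m :
    (forall u v, lmul u (lmul v m) - lmul v (lmul u m) = cM u v m) ->
    (forall u v w, lmul u (lmul v (lo w m)) - lmul v (lmul u (lo w m)) = cM u v (lo w m)) ->
  Phi x y (mX z m) + Phi y z (mX x m) + Phi z x (mX y m) = 0.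
Proof.
move=> comm comm_lo.
have loX u v : lo u (mX v m) = lo v (mX u m) + Phi u v m.
  have := lmul_comm_phi u v m; rewrite comm subrr => /esym/eqP.
  by rewrite subr_eq0 subr_eq addrC => /eqP.
have cX u v w : cM u v (mX w m) = cM u v (lmul w m) - cM u v (lo w m).
  by rewrite -linearB /= lmulE addrK.
rewrite !(phiE _ _ (mX _ _)) !cX -!comm_lo (loX y z) (loX z x) (loX x y) !phiE.
rewrite !lmulDr !lmulNr -[RHS](mC_jacobi x y z m).
move: (lmul z (cM x y m)) (lmul x (cM y z m)) (lmul y (cM z x m)) => d1 d2 d3.
move: (cM x y _) (cM y z _) (cM z x _) => c1 c2 c3.
move: (lmul x (lo z (mX y m))) (lmul y (lo x (mX z m))) (lmul z (lo y (mX x m))) => b1 b2 b3.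
move: (lmul x (lmul y _)) (lmul y (lmul x _)) (lmul y (lmul z _)) => a1 a2 a3.
move: (lmul z (lmul y _)) (lmul z (lmul x _)) (lmul x (lmul z _)) => a4 a5 a6.
by apply/ffunP => g; rewrite !ffunE; ring.
Qed.

(** The Poincare lemma: [lo] is the homotopy applied to [Phi], hence a potential of it as far as
    [Phi] is closed, and the induction supplies closedness at the derivatives of m. *)
Lemma lmul_comm_low k m x y : low k m -> lmul x (lmul y m) - lmul y (lmul x m) = cM x y m.
Proof.
elim/ltn_ind: k m x y => -[|k] IH m x y lm; first by rewrite lm !lmul0r subrr linear0.
apply/eqP; rewrite -subr_eq0 lmul_comm_phi subr_eq0; apply/eqP.
(* [mJ 1 (mX v m) = mX v (mJ 2 m)]. The terms where the derivative hits v give [Phi x y m'] twice,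
   which completes [mE m'] to m. *)
pose m' := mJ 2 m; have lm' : low k.+1 m' by apply: low_J.
have DE j : low k (mD j m') by apply: low_D.
have mE' : mE m' + 2%:R *: m' = m by apply: mJK.
have loXE u v : lo u (mX v m) = Phi u v m' + \sum_j Phi u (delta_mx j 0) (mX v (mD j m')).
  rewrite lo_rec /nextlo -(phi_sum_delta lo_linl lo_linr u v m') -big_split.
  apply: eq_bigr => j _; rewrite mJ_X mD_X.
  exact: (phi_linr lo_linr).
rewrite !loXE opprD addrACA -sumrB -(phi_skew lo x y).
rewrite -[RHS]/(Phi x y m) -mE' -sum_mX_mD.
have cycE j : Phi x (delta_mx j 0) (mX y (mD j m')) - Phi y (delta_mx j 0) (mX x (mD j m')) =
    Phi x y (mX (delta_mx j 0) (mD j m')).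
  have cyc : Phi x y (mX (delta_mx j 0) (mD j m')) + Phi y (delta_mx j 0) (mX x (mD j m')) +
      Phi (delta_mx j 0) x (mX y (mD j m')) = 0.
    apply: phi_cyclic => [u v|u v w]; first exact: (IH k).
    case: k IH lm lm' DE => [|k] IH lm lm' DE.
      by rewrite (DE j) lo0 !lmul0r subrr linear0.
    by apply: (IH k) => //; apply: low_lo.
  move/eqP: cyc; rewrite (phi_skew lo (delta_mx j 0) x) subr_eq0 => /eqP <-.
  by rewrite addrK.
under eq_bigr => j _ do rewrite cycE.
rewrite -(phi_sumr lo_linr) addrC -mulr2n -scaler_nat.
pose F' := GRing.isLinear.Build C M M _ _ (phi_linr lo_linr x y).
pose T : {linear M -> M} := HB.pack (Phi x y) F'.
by rewrite -![Phi x y _]/(T _) -linearZ -linearD.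
Qed.

Lemma lmul_comm m x y : lmul x (lmul y m) - lmul y (lmul x m) = cM x y m.
Proof.
have [k [m1 [l1 l2]]] := ex_lowsum m.
rewrite -[m](subrK m1); move: (m - m1) l2 => m2 l2.
rewrite [RHS]linearD /= !lmulDr -(lmul_comm_low x y l1) -(lmul_comm_low x y l2).
by rewrite opprD addrACA.
Qed.

End LeftMultiplication.

(** * The action of [H] on S(V) (x) C[G], symbols and symmetrization *)

Section Symbols.
Variables (C : numFieldType) (n : nat) (gT : finGroupType).
Variables (omega : {skew_symmetric 'cV[C]_n}) (rG : mx_representation C [set: gT] n).
Variable eta : gT -> C.
Hypothesis isoG : forall g x y, omega (rG g *m x) (rG g *m y) = omega x y.
Hypothesis eta_central :
  forall r g, r \in sreflections rG -> eta (r ^ g)%g = eta r.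
Local Notation V := 'cV[C]_n.
Local Notation S := {mpoly C[n]}.
Local Notation M := {ffun gT -> S}.
Local Notation H := (sra omega rG eta).
Local Notation e_ i := (delta_mx i 0 : V).
Local Notation hv := (sra_vec omega rG eta).
Local Notation hg := (sra_grp omega rG eta).
Local Notation lmul := (lmul omega rG eta).
Local Notation gM := (mG rG).
Implicit Types (x y z : V) (a g : gT) (m P Q : M) (h : H) (b c : C).

Lemma sra_scalerAl b h h' : b *: (h * h') = (b *: h) * h'.
Proof. exact: palg_scalerAl. Qed.
Lemma sra_scalerAr b h h' : b *: (h * h') = h * (b *: h').
Proof. exact: palg_scalerAr. Qed.

Lemma hv_linear : linear hv. Proof. by move=> b x y; apply: sra_vec_linear. Qed.
HB.instance Definition _ := GRing.isLinear.Build C V H _ hv hv_linear.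

Section Module.

Fixpoint ev (s : aterm C (V + gT)) (m : M) : M :=
  match s with
  | AVar (inl x) => lmul x m
  | AVar (inr g) => gM g m
  | AZero => 0
  | AOpp s => - ev s m
  | AAdd s t => ev s m + ev t m
  | AOne => m
  | AMul s t => ev s (ev t m)
  | AScale b s => b *: ev s m
  end.

Lemma ev_linear s : linear (ev s).
Proof.
elim: s => [[x|g]||s IH|s IHs t IHt||s IHs t IHt|c s IH] b m m' //=.
- by rewrite linearP.
- by rewrite linearP.
- by rewrite scaler0 addr0.
- by rewrite IH opprD scalerN.
- by rewrite IHs IHt scalerDr addrACA.
- by rewrite IHt IHs.
- by rewrite IH scalerDr !scalerA mulrC.
Qed.

(** The substantial relations are [lmul_eqv] and [lmul_comm]; with them the action on terms descends
    to [H]. *)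
Lemma ev_congr s t : acongr (sra_rel omega rG eta) s t -> ev s =1 ev t.
Proof.
have evD u m m' : ev u (m + m') = ev u m + ev u m'.
  by rewrite -[m]scale1r ev_linear !scale1r.
elim=> {s t} //=.
- move=> s t []; rewrite /=.
  + by move=> b x y m; rewrite /= lmul_linl.
  + by move=> m; rewrite mG1.
  + by move=> g h m; rewrite mG_mul.
  + by move=> g x m; rewrite lmul_eqv // gactE.
  + move=> x y m; rewrite lmul_comm // mCE; congr (_ + _).
    apply/esym; rewrite (big_morph (fun s => ev s m) (id1 := 0) (op1 := +%R)) //.
- by move=> s t _ IH m; rewrite IH.
- by move=> s t u _ IH1 _ IH2 m; rewrite IH1.
- by move=> s s' _ IH m; rewrite IH.
- by move=> s s' t t' _ IH1 _ IH2 m; rewrite IH1 IH2.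
- by move=> s s' t t' _ IH1 _ IH2 m; rewrite IH2 IH1.
- by move=> b s s' _ IH m; rewrite IH.
- by move=> s t u m; rewrite addrA.
- by move=> s t m; rewrite addrC.
- by move=> s m; rewrite add0r.
- by move=> s m; rewrite addNr.
- by move=> s t u m; rewrite evD.
- by move=> b c s m; rewrite scalerA.
- by move=> s m; rewrite scale1r.
- by move=> b s t m; rewrite scalerDr.
- by move=> b c s m; rewrite scalerDl.
- move=> b s t m; have ev0 : ev s 0 = 0.
    by have := ev_linear s (-1) 0 0; rewrite scaler0 addr0 scaleN1r addNr.
  by have := ev_linear s b (ev t m) 0; rewrite ev0 !addr0.
Qed.

Definition act h m : M := ev (generic_quotient.repr h) m.

Lemma act_pclass s m : act (pclass _ s) m = ev s m.
Proof. by apply/ev_congr/repr_pclass. Qed.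

Lemma act_lin b h h' m : act (b *: h + h') m = b *: act h m + act h' m.
Proof.
elim/palg_ind: h => s; elim/palg_ind: h' => t.
by rewrite /GRing.scale /GRing.add /= !palgE !act_pclass.
Qed.

Lemma act_mul h h' m : act (h * h') m = act h (act h' m).
Proof.
elim/palg_ind: h => s; elim/palg_ind: h' => t.
by rewrite /GRing.mul /= !palgE !act_pclass.
Qed.

Lemma act_vec x m : act (hv x) m = lmul x m.
Proof. exact: act_pclass. Qed.
Lemma act_grp g m : act (hg g) m = gM g m.
Proof. exact: act_pclass. Qed.

End Module.

(** The tensor f (x) g. *)
Definition dl g (f : S) : M := [ffun h => if h == g then f else 0].

Lemma dl_linear g : linear (dl g).
Proof.
by move=> b f f'; apply/ffunP => h; rewrite !ffunE; case: eqP => // _; rewrite scaler0 addr0.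
Qed.
HB.instance Definition _ g := GRing.isLinear.Build C S M _ (dl g) (dl_linear g).

Lemma dlE g f : dl g f g = f. Proof. by rewrite ffunE eqxx. Qed.

Lemma dl_sum P : P = \sum_g dl g (P g).
Proof.
apply/ffunP => h; rewrite sum_ffunE (bigD1 h) //= big1 => [|g gh]; rewrite !ffunE ?eqxx ?addr0 //.
by rewrite eq_sym (negPf gh).
Qed.

Lemma mD_dl i g f : mD i (dl g f) = dl g (f^`M(i)).
Proof. by apply/ffunP => h; rewrite !ffunE; case: eqP => // _; rewrite mderivC. Qed.

Lemma mG_dl a g f : gM a (dl g f) = dl (a * g)%g (subst (rG a) f).
Proof.
apply/ffunP => h; rewrite !ffunE -(inj_eq (mulgI a)) mulKVg.
by case: eqP => // _; rewrite linear0.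
Qed.

Lemma homM_dl d g f : hom d f -> homM d (dl g f).
Proof. by move=> hf h; rewrite ffunE; case: eqP => // _; apply: hom0. Qed.

(* [Sym k h P]: [h] is a combination of words with at most [k - 2] vectors, of
   the parity of [k], and [P] is its symbol in degree [k - 2]. *)
Inductive Sym : nat -> H -> M -> Prop :=
| Sym0 k : Sym k 0 0
| Sym_lin k b h h' P P' : Sym k h P -> Sym k h' P' -> Sym k (b *: h + h') (b *: P + P')
| Sym_grp g : Sym 2 (hg g) (dl g 1)
| Sym_vec k x h P : Sym k h P -> Sym k.+1 (hv x * h) (mX x P)
| Sym_up k h P : Sym k h P -> Sym k.+2 h 0.

Lemma SymD k h h' P P' : Sym k h P -> Sym k h' P' -> Sym k (h + h') (P + P').
Proof. by move=> s s'; rewrite -[h]scale1r -[P]scale1r; apply: Sym_lin. Qed.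
Lemma SymZ k b h P : Sym k h P -> Sym k (b *: h) (b *: P).
Proof.
by move=> s; rewrite -[_ *: h]addr0 -[_ *: P]addr0; apply: Sym_lin => //; apply: Sym0.
Qed.
Lemma SymN k h P : Sym k h P -> Sym k (- h) (- P).
Proof. by move=> s; rewrite -scaleN1r -(scaleN1r P); apply: SymZ. Qed.
Lemma SymB k h h' P P' : Sym k h P -> Sym k h' P' -> Sym k (h - h') (P - P').
Proof. by move=> s s'; apply: SymD => //; apply: SymN. Qed.
Lemma Sym_sum k (I : Type) (r : seq I) (p : pred I) (F : I -> H) (G : I -> M) :
  (forall i, p i -> Sym k (F i) (G i)) ->
  Sym k (\sum_(i <- r | p i) F i) (\sum_(i <- r | p i) G i).
Proof.
move=> s; elim/big_rec2: _ => [|i P h pi s']; [exact: Sym0 | by apply: SymD s'; apply: s].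
Qed.

Lemma Sym_hom k h P : Sym k h P -> if k is k'.+2 then homM k' P else h = 0 /\ P = 0.
Proof.
elim=> {k h P}.
- by move=> [|[|k]] //; apply: homM0.
- move=> [|[|k]] b h h' P P' _ + _ + /=; last by apply: homM_lin.
    by move=> [-> ->] [-> ->]; rewrite !scaler0 !addr0.
  by move=> [-> ->] [-> ->]; rewrite !scaler0 !addr0.
- by move=> g; apply/homM_dl/hom1.
- move=> [|[|k]] x h P _ /= => [[-> ->]|[_ ->]|]; last exact: homM_X.
    by rewrite mulr0 linear0.
  by rewrite linear0; apply: homM0.
- by move=> k h P _ _; apply: homM0.
Qed.

Lemma Sym_low2 k h P : Sym k h P -> (k < 2)%N -> h = 0 /\ P = 0.
Proof. by move/Sym_hom; case: k => [|[]]. Qed.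

Lemma Sym_homM k h P : Sym k.+2 h P -> homM k P.
Proof. exact: Sym_hom. Qed.

Let act0 m : act 0 m = 0.
Proof. by have := act_lin (-1) 0 0 m; rewrite scaler0 addr0 scaleN1r addNr. Qed.

(** [lmul x] is [mX x] up to [lo], which lowers the degree; so h sends 1 (x) 1 to its symbol plus
    lower terms. *)
Lemma Sym_act k h P : Sym k h P ->
  low k (act h (dl 1 1)) /\ low k.-2 (act h (dl 1 1) - P).
Proof.
suff lowk : Sym k h P -> low k.-2 (act h (dl 1 1) - P).
  move=> s; split; last exact: lowk.
  case: k s lowk => [|[|k]] s lowk; try by have [//|-> _] := Sym_low2 s; rewrite act0.
  by exists P; split; [apply: Sym_homM s | apply: lowk].
elim=> {k h P}.
- by move=> k; rewrite act0 subrr; apply: low0.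
- move=> k b h h' P P' _ l _ l'; rewrite act_lin opprD addrACA -scalerBr.
  exact: low_lin.
- by move=> g; rewrite act_grp mG_dl mulg1 subst1 subrr.
- move=> k x h P s l; rewrite act_mul act_vec.
  have [k2|k2] := ltnP k 2.
    have [-> ->] := Sym_low2 s k2; rewrite act0 lmul0r linear0 subrr; exact: low0.
  case: k k2 s l => [|[|k]] // _ s l.
  have -> : lmul x (act h (dl 1 1)) - mX x P =
      lmul x (act h (dl 1 1) - P) + lo omega rG eta x P.
    by rewrite lmulBr (lmulE _ _ _ x P) opprD -[RHS]addrA subrK.
  apply: lowD; first exact: low_lmul.
  exact/low_lo/low_hom/(Sym_homM s).
- move=> k h P s l; rewrite subr0 /=.
  case: k s l => [|[|k]] s l; try by have [//|-> _] := Sym_low2 s; rewrite act0.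
  by exists P; split; [apply: Sym_homM s | apply: l].
Qed.

(** The independence half of the PBW theorem: two symbols of h differ by a homogeneous element that
    lies in a level too low for its degree. *)
Lemma Sym_uniq k h P P' : Sym k h P -> Sym k h P' -> P = P'.
Proof.
move=> s s'; have [k2|k2] := ltnP k 2.
  by have [_ ->] := Sym_low2 s k2; have [_ ->] := Sym_low2 s' k2.
case: k k2 s s' => [|[|k]] // _ s s'.
apply/eqP; rewrite -subr_eq0; apply/eqP; apply: (@homM_low_eq0 _ _ _ k k).
- by rewrite leqW.
- by rewrite -scaleN1r addrC; apply: homM_lin; apply: Sym_homM; eassumption.
have -> : P - P' = act h (dl 1 1) - P' - (act h (dl 1 1) - P).
  by rewrite opprB [RHS]addrC addrA subrK.
by apply: lowB; [have [] := Sym_act s' | have [] := Sym_act s].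
Qed.

Definition fil k h := exists P, Sym k h P.

Lemma Sym_fil k h P : Sym k h P -> fil k h. Proof. by exists P. Qed.
Lemma fil0 k : fil k 0. Proof. exists 0; exact: Sym0. Qed.
Lemma fil_lin k b h h' : fil k h -> fil k h' -> fil k (b *: h + h').
Proof. by move=> [P s] [P' s']; exists (b *: P + P'); apply: Sym_lin. Qed.
Lemma filD k h h' : fil k h -> fil k h' -> fil k (h + h').
Proof. by move=> [P s] [P' s']; exists (P + P'); apply: SymD. Qed.
Lemma filZ k b h : fil k h -> fil k (b *: h).
Proof. by move=> [P s]; exists (b *: P); apply: SymZ. Qed.
Lemma fil_sum k (I : Type) (r : seq I) (p : pred I) (F : I -> H) :
  (forall i, p i -> fil k (F i)) -> fil k (\sum_(i <- r | p i) F i).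
Proof. by move=> f; elim/big_ind: _ => //; [apply: fil0 | apply: filD]. Qed.
Lemma fil_vec k x h : fil k h -> fil k.+1 (hv x * h).
Proof. by move=> [P s]; exists (mX x P); apply: Sym_vec. Qed.
Lemma fil_up k h : fil k h -> fil k.+2 h.
Proof. by move=> [P s]; exists 0; apply: Sym_up s. Qed.
Lemma fil_low2 k h : fil k h -> (k < 2)%N -> h = 0.
Proof. by move=> [P s] /(Sym_low2 s)[]. Qed.

Lemma fil_leq k j h : (k <= j)%N -> odd k = odd j -> fil k h -> fil j h.
Proof.
move=> kj okj f; have -> : j = (k + (j - k)./2.*2)%N.
  by rewrite even_halfK ?subnKC // oddB // okj addbb.
elim: (j - k)./2 => [|d IH]; first by rewrite addn0.
by rewrite doubleS !addnS; apply: fil_up.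
Qed.

Lemma Sym_Gl a k h P : Sym k h P -> Sym k (hg a * h) (gM a P).
Proof.
elim=> {k h P} [k|k b h h' P P' _ s _ s'|g|k x h P _ s|k h P _ s].
- by rewrite mulr0 linear0; apply: Sym0.
- by rewrite mulrDr -sra_scalerAr linearP; apply: Sym_lin.
- by rewrite -sra_grpM mG_dl subst1; apply: Sym_grp.
- by rewrite mulrA sra_grp_vec gactE mG_X -mulrA; apply: Sym_vec.
- by rewrite linear0; apply: Sym_up s.
Qed.

Definition mR a m : M := [ffun g => m (g * a^-1)%g].

Lemma Sym_Gr a k h P : Sym k h P -> Sym k (h * hg a) (mR a P).
Proof.
elim=> {k h P} [k|k b h h' P P' _ s _ s'|g|k x h P _ s|k h P _ s].
- rewrite mul0r (_ : mR a 0 = 0); first exact: Sym0.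
  by apply/ffunP => g; rewrite !ffunE.
- rewrite mulrDl -sra_scalerAl (_ : mR a _ = b *: mR a P + mR a P'); first exact: Sym_lin.
  by apply/ffunP => g; rewrite !ffunE.
- rewrite -sra_grpM (_ : mR a _ = dl (g * a)%g 1); first exact: Sym_grp.
  by apply/ffunP => h; rewrite !ffunE -(inj_eq (mulIg a)) mulgKV.
- rewrite -mulrA (_ : mR a _ = mX x (mR a P)); first exact: Sym_vec.
  by apply/ffunP => g; rewrite !ffunE.
- rewrite (_ : mR a 0 = 0); first exact: Sym_up s.
  by apply/ffunP => g; rewrite !ffunE.
Qed.

(** The symbol of right multiplication by x, which becomes g x when moved to the left across g. *)
Definition mT x m : M := [ffun g => lin (rG g *m x) * m g].

Lemma mT_linear x : linear (mT x).
Proof. by move=> b m m'; apply/ffunP => g; rewrite !ffunE mulrDr scalerAr. Qed.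
HB.instance Definition _ x := GRing.isLinear.Build C M M _ (mT x) (mT_linear x).

Lemma Sym_Vr x k h P : Sym k h P -> Sym k.+1 (h * hv x) (mT x P).
Proof.
elim=> {k h P} [k|k b h h' P P' _ s _ s'|g|k y h P _ s|k h P _ s].
- by rewrite mul0r linear0; apply: Sym0.
- by rewrite mulrDl -sra_scalerAl linearP; apply: Sym_lin.
- rewrite sra_grp_vec gactE (_ : mT x _ = mX (rG g *m x) (dl g 1)).
    exact/Sym_vec/Sym_grp.
  by apply/ffunP => h; rewrite !ffunE; case: eqP => [->//|]; rewrite !mulr0.
- rewrite -mulrA (_ : mT x _ = mX y (mT x P)); first exact: Sym_vec.
  by apply/ffunP => g; rewrite !ffunE mulrCA.
- by rewrite linear0; apply: Sym_up s.
Qed.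

(** Both levels carry the offset two, so one offset is removed from their sum. The subtraction is
    truncated only if k + j < 2, and then h = 0. *)
Lemma fil_mul k j h h' : fil k h -> fil j h' -> fil (k + j - 2) (h * h').
Proof.
move=> [P s] [Q t].
have low2 (i : nat) u (R : M) : Sym i u R -> (i + j < 2)%N -> fil (i + j - 2) (u * h').
  move=> su ij2; have [-> _] := Sym_low2 su (leq_ltn_trans (leq_addr j i) ij2).
  by rewrite mul0r; apply: fil0.
elim: s => {k h P} [k|k b u u' P P' _ s _ s'|g|k x h P s IH|k h P s IH].
- by rewrite mul0r; apply: fil0.
- by rewrite mulrDl -sra_scalerAl; apply: fil_lin.
- by rewrite addKn; exists (gM g Q); apply: Sym_Gl.
- have [kj2|kj2] := ltnP (k + j) 2.
    have [-> _] := Sym_low2 s (leq_ltn_trans (leq_addr j k) kj2).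
    by rewrite mulr0 mul0r; apply: fil0.
  by rewrite -mulrA addSn subSn //; apply: fil_vec.
- have [kj2|kj2] := ltnP (k + j) 2.
    have [-> _] := Sym_low2 s (leq_ltn_trans (leq_addr j k) kj2).
    by rewrite mul0r; apply: fil0.
  by rewrite addSn addSn -(subnK kj2) addn2 !subSS subn0; apply/fil_up/IH.
Qed.

Definition commv x y : H :=
  omega x y *: (1 : H) + \sum_(r in sreflections rG) (eta r * omega_refl omega rG r x y) *: hg r.

Lemma commvE x y : hv x * hv y - hv y * hv x = commv x y.
Proof. exact: sra_commutator. Qed.

Lemma commv_mull x y h : commv x y * h =
  omega x y *: h + \sum_(r in sreflections rG) (eta r * omega_refl omega rG r x y) *: (hg r * h).
Proof.
rewrite mulrDl -sra_scalerAl mul1r mulr_suml; congr (_ + _).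
by apply: eq_bigr => r _; rewrite -sra_scalerAl.
Qed.

Lemma fil_commv k x y h : fil k h -> fil k (commv x y * h).
Proof.
move=> f; rewrite commv_mull; apply: fil_lin => //; apply: fil_sum => r _.
by apply: filZ; case: f => P s; exists (gM r P); apply: Sym_Gl.
Qed.

(* The symmetrization map in degree [d]. *)
Fixpoint ell d P : H :=
  if d is d'.+1 then d%:R^-1 *: \sum_i hv (e_ i) * ell d' (mD i P)
  else \sum_g (P g)@_0 *: hg g.

Lemma ell_linear d : linear (ell d).
Proof.
elim: d => [|d IH] b P P' /=.
  rewrite scaler_sumr -big_split; apply: eq_bigr => g _ /=.
  by rewrite !ffunE mcoeffD mcoeffZ scalerDl scalerA.
rewrite [b *: (_ *: _)]scalerA [b * _]mulrC -scalerA -scalerDr; congr (_ *: _).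
rewrite scaler_sumr -big_split; apply: eq_bigr => i _ /=.
by rewrite linearP IH mulrDr -sra_scalerAr.
Qed.
HB.instance Definition _ d := GRing.isLinear.Build C M H _ (ell d) (ell_linear d).

Let natSn0 d : (d.+1%:R : C) != 0. Proof. by rewrite pnatr_eq0. Qed.

Lemma sum_mX_mD_hom d P : homM d P -> \sum_i mX (e_ i) (mD i P) = d%:R *: P.
Proof. by move=> hP; rewrite sum_mX_mD; apply/ffunP => g; rewrite !ffunE; apply: hP. Qed.

Lemma Sym_ell d P : homM d P -> Sym d.+2 (ell d P) P.
Proof.
elim: d P => [|d IH] P hP /=.
  have {2}-> : P = \sum_g (P g)@_0 *: dl g 1.
    rewrite {1}(dl_sum P); apply: eq_bigr => g _.
    by rewrite {1}(hom0_const (hP g)) -[_%:MP]mulr1 mul_mpolyC linearZ.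
  by apply: Sym_sum => g _; apply: SymZ; apply: Sym_grp.
have PE : P = d.+1%:R^-1 *: \sum_i mX (e_ i) (mD i P).
  by rewrite (sum_mX_mD_hom hP) scalerA mulVf ?natSn0 // scale1r.
rewrite [X in Sym _ _ X]PE; apply: SymZ; apply: Sym_sum => i _; apply: Sym_vec.
exact/IH/homM_D.
Qed.

(** Both terms have symbol [mX x P]; distributing x over the positions of the symmetrized product
    costs commutators, two levels lower. *)
Lemma ell_lmul d x P : homM d P -> fil d.+1 (hv x * ell d P - ell d.+1 (mX x P)).
Proof.
have ellX d' P' : ell d'.+1 (mX x P') = d'.+1%:R^-1 *:
    (hv x * ell d' P' + \sum_i hv (e_ i) * ell d' (mX x (mD i P'))).
  rewrite /=; congr (_ *: _).
  under eq_bigr => i _ do rewrite mD_X linearP /= mulrDr -sra_scalerAr sra_scalerAl -linearZ /=.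
  by rewrite big_split /= -mulr_suml -linear_sum -vec_sum_delta.
elim: d P => [|d IH] P hP.
  rewrite ellX big1 => [|i _]; last by rewrite mD_homM0 // !linear0 mulr0.
  by rewrite addr0 invr1 scale1r subrr; apply: fil0.
have dE : \sum_i hv (e_ i) * ell d (mD i P) = d.+1%:R *: ell d.+1 P.
  by rewrite /= scalerA mulfV ?natSn0 // scale1r.
have -> : hv x * ell d.+1 P - ell d.+2 (mX x P) = d.+2%:R^-1 *:
    \sum_i (hv (e_ i) * (hv x * ell d (mD i P) - ell d.+1 (mX x (mD i P))) +
            commv x (e_ i) * ell d (mD i P)).
  (* Of d + 2 copies of x times [ell d.+1 P], one cancels a term of [ellX]; the other d + 1 are
     expanded by [dE]. *)
  have hE : hv x * ell d.+1 P = d.+2%:R^-1 *: (d.+2%:R *: (hv x * ell d.+1 P)).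
    by rewrite scalerA mulVf ?natSn0 // scale1r.
  rewrite [in LHS]hE ellX -scalerBr.
  congr (_ *: _); rewrite opprD addrA.
  have -> : d.+2%:R *: (hv x * ell d.+1 P) - hv x * ell d.+1 P = d.+1%:R *: (hv x * ell d.+1 P).
    by rewrite -[d.+2]addn1 natrD scalerDl scale1r addrK.
  rewrite sra_scalerAr -dE mulr_sumr -sumrB; apply: eq_bigr => i _.
  by rewrite mulrBr -commvE mulrBl !mulrA [RHS]addrC [RHS]addrA subrK.
apply/filZ/fil_sum => i _; apply: filD; first exact/fil_vec/IH/homM_D.
exact/fil_commv/(Sym_fil (Sym_ell (homM_D _ hP))).
Qed.

(** The spanning half of the PBW theorem: along the construction of h, each vector is absorbed into
    the symmetrization modulo a lower level. *)
Lemma Sym_sub_ell k h P : Sym k.+2 h P -> fil k (h - ell k P).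
Proof.
suff H k' : Sym k' h P -> if k' is j.+2 then fil j (h - ell j P) else True by apply: (H k.+2).
elim=> {k k' h P} [|k b h h' P P' _ s _ s'|g|k x h P s IH|k h P s IH] //.
- by move=> [|[|k]] //; rewrite linear0 subrr; apply: fil0.
- case: k s s' => [|[|k]] // s s'.
  by rewrite linearP /= opprD addrACA -scalerBr; apply: fil_lin.
- rewrite /= (bigD1 g) //= dlE mcoeff1 eqxx scale1r big1 ?addr0 ?subrr => [|a ag].
    exact: fil0.
  by rewrite ffunE (negPf ag) mcoeff0 scale0r.
- case: k s IH => [//|[|k]] s IH.
    by have [//|-> ->] := Sym_low2 s; rewrite mulr0 linear0 linear0 subrr; apply: fil0.
  have -> : hv x * h - ell k.+1 (mX x P) =
      hv x * (h - ell k P) + (hv x * ell k P - ell k.+1 (mX x P)).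
    by rewrite mulrBr addrA subrK.
  by apply: filD; [apply: fil_vec | apply/ell_lmul/(Sym_homM s)].
- by rewrite linear0 subr0; exists P.
Qed.

Lemma Sym0_fil k h : Sym k.+2 h 0 -> fil k h.
Proof. by move/Sym_sub_ell; rewrite linear0 subr0. Qed.

End Symbols.

(** * Exactness of the Koszul complex off the fixed space *)

Section KoszulHomotopy.
Variables (C : numFieldType) (n : nat).
Local Notation S := {mpoly C[n]}.
Local Notation V := 'cV[C]_n.
Local Notation e_ i := (delta_mx i 0 : V).
Variables p T Ti : 'M[C]_n.
Hypotheses (pp : p *m p = p) (Tp : T *m p = 0) (TTi : T *m Ti = 1 - p) (TiT : Ti *m T = 1 - p).
Implicit Types (f : S) (P : 'I_n -> S).

Let q : 'M[C]_n := 1 - p.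
Local Notation D := (ederiv q).
Let qp : q *m p = 0. Proof. by rewrite mulmxBl mul1mx pp subrr. Qed.

Let lin_mulmx2 (A B : 'M[C]_n) j : lin (A *m (B *m e_ j)) = \sum_k B k j *: lin (A *m e_ k).
Proof.
rewrite (mulmx_delta B) mulmx_sumr linear_sum; apply: eq_bigr => k _.
by rewrite -scalemxAr linearZ.
Qed.

Lemma subst_qderiv f : D (subst p f) = 0.
Proof.
rewrite ederivE; under eq_bigr => k _ do rewrite mderiv_subst mulr_sumr.
rewrite exchange_big big1 // => j _ /=.
transitivity (lin (q *m (p *m e_ j)) * subst p (f^`M(j))).
  by rewrite lin_mulmx2 mulr_suml; apply: eq_bigr => k _; rewrite -scalerAl -scalerAr.
by rewrite mulmxA qp mul0mx linear0 mul0r.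
Qed.

(* [knorm K] is the product of the [1 - D / k] for [0 < k <= K]; it kills the
   eigenvectors of [D] of eigenvalues 1, ..., K. *)
Fixpoint knorm K f : S :=
  if K is K'.+1 then knorm K' f - K%:R^-1 *: D (knorm K' f) else f.

Lemma knorm_linear K : linear (knorm K).
Proof.
elim: K => [//|K IH] a f g /=; rewrite IH linearP /=.
rewrite [K.+1%:R^-1 *: (_ + _)]scalerDr opprD addrACA scalerBr; congr (_ - _ + _).
by rewrite !scalerA mulrC.
Qed.
HB.instance Definition _ K := GRing.isLinear.Build C S S _ (knorm K) (knorm_linear K).

Lemma hom_qderiv d f : hom d f -> hom d (D f).
Proof.
case: d => [|d] hf.
  by rewrite ederivE big1 => [|k _]; [apply: hom0 | rewrite mderiv_hom0 // mulr0].
by rewrite ederivE; apply: hom_sum => k _; apply/hom_linM/hom_mderiv.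
Qed.

Lemma hom_knorm d K f : hom d f -> hom d (knorm K f).
Proof. by move=> hf; elim: K => //= K IH; apply/homB/homZ/hom_qderiv. Qed.

Lemma knorm_pM K x f : knorm K (lin (p *m x) * f) = lin (p *m x) * knorm K f.
Proof.
elim: K => //= K ->; rewrite ederivM ederiv_lin mulmxA qp mul0mx linear0.
by rewrite mul0r add0r mulrBr scalerAr.
Qed.

Let natSn0 d : (d.+1%:R : C) != 0. Proof. by rewrite pnatr_eq0. Qed.

Let coef_knorm K (f g : S) :
  K.+1%:R^-1 *: f - K.+2%:R^-1 *: (K.+1%:R^-1 *: (f + g)) =
  K.+2%:R^-1 *: (f - K.+1%:R^-1 *: g).
Proof.
rewrite scalerDr scalerDr !scalerA scalerBr opprD addrA scalerA -scalerBl; congr (_ *: _ - _).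
have := natSn0 K; have := natSn0 K.+1; rewrite -[K.+2]addn1 natrD.
by move: (K.+1%:R : C) => k k2 k1; field; rewrite k1 k2.
Qed.

(** The product of the [1 - (1 + D) / k]: what [knorm] does to the cofactor of a vector of
    D-eigenvalue 1. *)
Fixpoint qnorm K f : S :=
  if K is K'.+1 then qnorm K' f - K%:R^-1 *: (qnorm K' f + D (qnorm K' f)) else f.

Lemma knorm_qM K x f : knorm K (lin (q *m x) * f) = lin (q *m x) * qnorm K f.
Proof.
have qq : q *m q = q by rewrite mulmxBr mulmx1 qp subr0.
elim: K => //= K ->; rewrite ederivM ederiv_lin mulmxA qq -mulrDr.
by rewrite mulrBr scalerAr.
Qed.

(** The factors are (k - 1 - D) / k. The first is -D, and the others are those of [knorm K] up to
    the total scalar 1 / (K + 1). *)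
Lemma qnormE K f : qnorm K.+1 f = - (K.+1%:R^-1 *: D (knorm K f)).
Proof.
elim: K => [|K IH]; first by rewrite /= invr1 !scale1r opprD addrA subrr add0r.
rewrite -[LHS]/(qnorm K.+1 f - K.+2%:R^-1 *: (qnorm K.+1 f + D (qnorm K.+1 f))) IH.
have negE (b : C) (X Y : S) : - X - b *: (- X - Y) = - (X - b *: (X + Y)).
  by rewrite -!mul_mpolyC; ring.
rewrite [D (- _)]linearN /= [D (_ *: _)]linearZ /= negE -scalerDr coef_knorm.
by rewrite [D (_ - _)]linearB /= [D (_ *: _)]linearZ.
Qed.

(** D counts the degree along the image of q, at most d on f. [knorm K] kills the eigenvalues 1,
    ..., K and fixes the kernel of D, so it is the restriction to the image of p. *)
Lemma knorm_subst d K f : hom d f -> (d <= K)%N -> knorm K f = subst p f.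
Proof.
elim: d K f => [|d IH] K f hf dK.
  have Df g : hom 0 g -> D g = 0.
    by move=> hg; rewrite ederivE big1 // => k _; rewrite mderiv_hom0 ?mulr0.
  have -> : subst p f = f by rewrite (hom0_const hf) substE comp_mpolyC.
  by elim: K {dK} => //= K ->; rewrite Df // scaler0 subr0.
case: K dK => // K dK.
have fE : f = d.+1%:R^-1 *: \sum_i 'X_i * f^`M(i).
  by rewrite (hom_euler hf) scalerA mulVf ?natSn0 // scale1r.
rewrite [in LHS]fE [in RHS]fE !linearZ !linear_sum; congr (_ *: _); apply: eq_bigr => i _.
have {1}-> : 'X_i = lin (p *m e_ i) + lin (q *m e_ i) :> S.
  by rewrite -linearD -mulmxDl /= addrC subrK mul1mx lin_delta.
have hD := hom_mderiv i hf.
rewrite mulrDl linearD /= -!/(knorm K.+1 _) knorm_pM knorm_qM qnormE.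
by rewrite !(IH _ _ hD) // 1?leqW // subst_qderiv scaler0 oppr0 mulr0 addr0 substM substX.
Qed.

Lemma qnorm_hom0 d f : hom d f -> qnorm d.+1 f = 0.
Proof. by move=> hf; rewrite qnormE (knorm_subst hf) // subst_qderiv scaler0 oppr0. Qed.

Lemma qderivE f : D f = \sum_j lin (T *m e_ j) * \sum_k Ti j k *: f^`M(k).
Proof.
rewrite ederivE /q -TTi.
under [RHS]eq_bigr => j _ do rewrite mulr_sumr.
rewrite exchange_big; apply: eq_bigr => k _ /=.
rewrite -mulmxA lin_mulmx2 mulr_suml; apply: eq_bigr => j _.
by rewrite -scalerAl -scalerAr.
Qed.

(** Each factor of [knorm] subtracts a multiple of D, which [qderivE] places in the ideal generated
    by the image of T; the factors telescope from f to [subst p f]. *)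
Lemma koszul_reduce0 d f : hom d.+1 f ->
  exists F : 'I_n -> S, (forall j, hom d (F j)) /\
    f - subst p f = \sum_j lin (T *m e_ j) * F j.
Proof.
move=> hf; rewrite -(knorm_subst hf (leqnn _)).
elim: {1}d.+1 => [|K [F [hF FE]]] /=.
  exists (fun=> 0); split=> [j|]; first exact: hom0.
  by rewrite subrr big1 // => j _; rewrite mulr0.
exists (fun j => F j + K.+1%:R^-1 *: \sum_k Ti j k *: (knorm K f)^`M(k)); split=> [j|].
  apply/homD/homZ/hom_sum => // k _; apply/homZ/hom_mderiv; exact: hom_knorm.
under eq_bigr => j _ do rewrite mulrDr -scalerAr.
by rewrite big_split -FE -scaler_sumr -qderivE opprB addrA addrAC.
Qed.

Definition mulP (A : 'M[C]_n) P i : S := \sum_j A i j *: P j.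

Lemma mulP_comp (A B : 'M[C]_n) P i : mulP A (mulP B P) i = mulP (A *m B) P i.
Proof.
rewrite /mulP; under eq_bigr => k _ do rewrite scaler_sumr.
rewrite exchange_big; apply: eq_bigr => k _ /=.
by rewrite mxE scaler_suml; apply: eq_bigr => l _; rewrite scalerA.
Qed.

Lemma mulP1 P i : P i = mulP p P i + mulP q P i.
Proof.
have qE j : q i j = (i == j)%:R - p i j by rewrite /q -[1]/(1%:M) !mxE.
rewrite /mulP -big_split (bigD1 i) //= big1 => [|k ki]; rewrite -scalerDl qE [p i _ + _]addrC subrK.
  by rewrite eqxx scale1r addr0.
by rewrite eq_sym (negPf ki) scale0r.
Qed.

Lemma hom_mulP d (A : 'M[C]_n) P i : (forall j, hom d (P j)) -> hom d (mulP A P i).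
Proof. by move=> hP; apply: hom_sum => j _; apply: homZ. Qed.

(* The Koszul differentials for [T = 1 - k g], whose kernel is the image of [p]. *)
Definition kdiff P : S := \sum_i lin (T *m e_ i) * P i.
Definition kbound (W : 'I_n -> 'I_n -> S) i : S := \sum_j lin (T *m e_ j) * (W i j - W j i).

Lemma kdiff_bound W : kdiff (kbound W) = 0.
Proof.
pose A i j := lin (T *m e_ i) * (lin (T *m e_ j) * W i j).
transitivity (\sum_i \sum_j A i j - \sum_i \sum_j A j i).
  rewrite -sumrB; apply: eq_bigr => i _; rewrite mulr_sumr -sumrB; apply: eq_bigr => j _.
  by rewrite /A; ring.
by rewrite [X in _ - X]exchange_big subrr.
Qed.

Lemma kdiffB P Q : kdiff (fun i => P i - Q i) = kdiff P - kdiff Q.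
Proof. by rewrite -sumrB; apply: eq_bigr => i _; rewrite mulrBr. Qed.

Lemma kboundD W W' i : kbound (fun i j => W i j + W' i j) i = kbound W i + kbound W' i.
Proof. by rewrite -big_split; apply: eq_bigr => j _ /=; ring. Qed.

Lemma kboundZ b W i : kbound (fun i j => b *: W i j) i = b *: kbound W i.
Proof.
by rewrite scaler_sumr; apply: eq_bigr => j _ /=; rewrite -scalerBr scalerAr.
Qed.

Lemma qnorm_linear K : linear (qnorm K).
Proof. by elim: K => [//|K IH] a f g /=; rewrite IH linearP /= -!mul_mpolyC; ring. Qed.
HB.instance Definition _ K := GRing.isLinear.Build C S S _ (qnorm K) (qnorm_linear K).

Lemma hom_qnorm d K f : hom d f -> hom d (qnorm K f).
Proof.
by move=> hf; elim: K => //= K IH; apply/homB/homZ/homD/hom_qderiv.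
Qed.

Lemma sum_Tp (F : 'I_n -> S) : \sum_k lin (T *m e_ k) * (\sum_l p k l *: F l) = 0.
Proof.
under eq_bigr => k _ do rewrite mulr_sumr.
rewrite exchange_big big1 // => l _ /=.
transitivity (lin (T *m (p *m e_ l)) * F l).
  by rewrite lin_mulmx2 mulr_suml; apply: eq_bigr => k _; rewrite -scalerAl -scalerAr.
by rewrite mulmxA Tp mul0mx linear0 mul0r.
Qed.

(** Cartan's formula: on cycles along q, [1 + D] is the boundary of a contraction with Ti.
    Differentiating [kdiff P = 0] supplies the summand P i. *)
Lemma koszul_homotopy P i : kdiff P = 0 -> (forall j, mulP q P j = P j) ->
  P i + D (P i) = kbound (fun i j => \sum_k Ti j k *: (P i)^`M(k)) i.
Proof.
move=> dP qP; rewrite /kbound; under eq_bigr => j _ do rewrite mulrBr.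
rewrite sumrB -qderivE addrC; congr (_ + _).
have diffP k : \sum_j lin (T *m e_ j) * (P j)^`M(k) = - \sum_j T k j *: P j.
  have : (kdiff P)^`M(k) = 0 by rewrite dP mderiv0.
  rewrite /kdiff linear_sum => /eqP; under eq_bigr => j _ do rewrite /= mderivM mderiv_lin mulmx_deltaE mul_mpolyC.
  by rewrite big_split /= addrC addr_eq0 => /eqP.
rewrite -sumrN.
transitivity (\sum_k Ti i k *: (\sum_j T k j *: P j)).
  by rewrite -[LHS]qP /q -TiT -mulP_comp.
under [RHS]eq_bigr => j _ do rewrite mulr_sumr -sumrN.
rewrite exchange_big; apply: eq_bigr => k _ /=.
rewrite -[X in _ *: X]opprK -diffP scalerN scaler_sumr -sumrN; apply: eq_bigr => j _.
by rewrite scalerAr.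
Qed.

(** On the q-part of a cycle the homotopy applies, as 1 + D has no eigenvalue 0; the p-part is
    reduced one coefficient at a time by [koszul_reduce0]. *)
Lemma koszul_reduce1 d P : (forall i, hom d.+1 (P i)) -> kdiff P = 0 ->
  exists W : 'I_n -> 'I_n -> S, (forall i j, hom d (W i j)) /\
    forall i, P i - mulP p (subst p \o P) i = kbound W i.
Proof.
move=> hP dP; pose Q := mulP q P.
have dQ : kdiff Q = 0.
  rewrite -dP; have -> : kdiff P = kdiff Q + kdiff (mulP p P).
    by rewrite -big_split; apply: eq_bigr => i _; rewrite /= -mulrDr [in LHS](mulP1 P) addrC.
  by rewrite [X in _ + X]sum_Tp addr0.
have hQ i : hom d.+1 (Q i) by apply: hom_mulP.
have [W1 [hW1 W1E]] : exists W : 'I_n -> 'I_n -> S, (forall i j, hom d (W i j)) /\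
    forall i, Q i = kbound W i.
  have qQ K j : mulP q (qnorm K \o Q) j = (qnorm K \o Q) j.
    rewrite /= -[in RHS](_ : mulP q Q j = Q j); last first.
      by rewrite mulP_comp mulmxBr mulmx1 qp subr0.
    by rewrite /mulP linear_sum; apply: eq_bigr => k _; rewrite linearZ.
  (* In degree d + 1 the eigenvalues of 1 + D are 1, ..., d + 2, each killed by one factor. *)
  suff [W [hW WE]] : exists W : 'I_n -> 'I_n -> S, (forall i j, hom d (W i j)) /\
      forall i, Q i - qnorm d.+2 (Q i) = kbound W i.
    by exists W; split => // i; rewrite -WE (qnorm_hom0 (hQ i)) subr0.
  elim: d.+2 => [|K [W [hW WE]]].
    exists (fun _ _ => 0); split=> [i j|i]; first exact: hom0.
    by rewrite subrr /kbound big1 // => j _; rewrite subrr mulr0.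
  have dQK : kdiff (qnorm K \o Q) = 0.
    have -> : kdiff (qnorm K \o Q) = kdiff Q - kdiff (fun i => Q i - qnorm K (Q i)).
      by rewrite kdiffB opprB addrC subrK.
    have -> : kdiff (fun i => Q i - qnorm K (Q i)) = kdiff (kbound W).
      by rewrite /kdiff; apply: eq_bigr => i _; rewrite WE.
    by rewrite dQ kdiff_bound subr0.
  exists (fun i j => W i j +
    K.+1%:R^-1 *: \sum_k Ti j k *: ((qnorm K \o Q) i)^`M(k)); split=> [i j|i].
    apply/homD/homZ/hom_sum => // k _; apply/homZ/hom_mderiv; exact: hom_qnorm.
  rewrite kboundD kboundZ -(koszul_homotopy _ dQK) // -WE /=.
  by rewrite opprB addrA addrAC.
have [F FE] := choice (fun l => koszul_reduce0 (hP l)).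
(* The transposes of the new terms drop out of [kbound] because T kills the image of p. *)
exists (fun i j => \sum_l p i l *: F l j + W1 i j); split=> [i j|i].
  by apply/homD => //; apply: hom_sum => l _; apply: homZ; have [] := FE l.
rewrite kboundD -W1E [in LHS](mulP1 P) addrAC; congr (_ + _).
rewrite /kbound; under [RHS]eq_bigr => j _ do rewrite mulrBr.
rewrite sumrB sum_Tp subr0 /mulP -sumrB.
under [RHS]eq_bigr => j _ do rewrite mulr_sumr.
rewrite exchange_big; apply: eq_bigr => l _ /=.
rewrite -scalerBr (proj2 (FE l)) scaler_sumr; apply: eq_bigr => j _.
by rewrite scalerAr.
Qed.

End KoszulHomotopy.

(** * The Poisson bracket and Brylinski's homotopy on a symplectic subspace *)

Section PoissonBracket.
Variables (C : numFieldType) (n : nat) (omega : {skew_symmetric 'cV[C]_n}).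
Hypothesis omega_nondeg : nondegenerate omega.
Local Notation S := {mpoly C[n]}.
Local Notation V := 'cV[C]_n.
Local Notation e_ i := (delta_mx i 0 : V).
Local Notation dual := (dualb omega).
Implicit Types (x y z : V) (f g : S).

Fact pb_key : unit. Proof. by []. Qed.
(** The Poisson bracket {x, f}, extending [omega] on vectors. *)
Definition pb x f : S := locked_with pb_key (\sum_j omega x (e_ j) *: f^`M(j)).
Lemma pbE x f : pb x f = \sum_j omega x (e_ j) *: f^`M(j).
Proof. by rewrite /pb unlock. Qed.

Lemma pb_linear x : linear (pb x).
Proof.
move=> b f g; rewrite !pbE scaler_sumr -big_split; apply: eq_bigr => j _ /=.
by rewrite linearP /= scalerDr !scalerA mulrC.
Qed.
HB.instance Definition _ x := GRing.isLinear.Build C S S _ (pb x) (pb_linear x).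

Lemma pbM x f g : pb x (f * g) = pb x f * g + f * pb x g.
Proof.
rewrite !pbE mulr_suml mulr_sumr -big_split; apply: eq_bigr => j _ /=.
by rewrite mderivM scalerDr scalerAl scalerAr.
Qed.

Lemma pb_lin x y : pb x (lin y) = (omega x y)%:MP.
Proof.
rewrite pbE {2}(vec_sum_delta y) om_sumr rmorph_sum; apply: eq_bigr => j _ /=.
by rewrite mderiv_lin omZr -mul_mpolyC -mpolyCM mulrC.
Qed.

Lemma sum_dual y : \sum_j omega (e_ j) y *: dual j = y.
Proof.
set z := \sum_j _; apply/eqP; rewrite -subr_eq0; apply/eqP.
have om0 x : omega x (z - y) = 0.
  rewrite om_sum_delta big1 // => i _; rewrite addrC -scaleN1r omPr mulN1r om_sumr.
  rewrite (bigD1 i) //= big1 => [|j ji]; rewrite omZr om_dualb // mxE ?eqxx.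
    by rewrite mulr1 addr0 addNr mulr0.
  by rewrite (negPf ji) mulr0.
rewrite -(sum_dualb omega_nondeg (z - y)) big1 // => j _.
by rewrite omC om0 oppr0 scale0r.
Qed.

Variable p : 'M[C]_n.
Hypotheses (pp : p *m p = p) (omp : forall x y, omega (p *m x) y = omega x (p *m y)).

Lemma sum_omp : \sum_k omega (p *m e_ k) (p *m dual k) = (\rank p)%:R.
Proof.
rewrite -mxtrace_idem //; apply: eq_bigr => k _.
by rewrite -omp mulmxA pp om_dualb // mulmx_deltaE.
Qed.

Lemma subst_pb x f : subst p f = f -> subst p (pb x f) = pb x f.
Proof.
move=> fp; have fE j : f^`M(j) = \sum_k p j k *: subst p (f^`M(k)) by rewrite -mderiv_subst fp.
rewrite pbE linear_sum; apply: eq_bigr => j _ /=.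
rewrite linearZ /= [in LHS]fE [in RHS]fE linear_sum /=; congr (_ *: _).
by apply: eq_bigr => k _; rewrite linearZ /= subst_comp pp.
Qed.

Lemma euler_subst_p f : subst p f = f -> \sum_j lin (p *m e_ j) * f^`M(j) = euler f.
Proof.
move=> fp; rewrite -{2}fp euler_subst eulerE linear_sum.
transitivity (\sum_j \sum_k lin (p *m e_ j) * (p j k *: subst p (f^`M(k)))).
  by apply: eq_bigr => j _; rewrite -{1}fp mderiv_subst mulr_sumr.
rewrite exchange_big; apply: eq_bigr => k _ /=.
rewrite substM substX; have -> : lin (p *m e_ k) = \sum_j p j k *: lin (p *m e_ j).
  rewrite -{1}pp -mulmxA (mulmx_delta p) mulmx_sumr linear_sum; apply: eq_bigr => j _.
  by rewrite -scalemxAr linearZ.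
by rewrite mulr_suml; apply: eq_bigr => j _; rewrite -scalerAl -scalerAr.
Qed.

Lemma sum_lin_pb f : subst p f = f ->
  \sum_k lin (p *m dual k) * pb (p *m e_ k) f = euler f.
Proof.
move=> fp; rewrite -(euler_subst_p fp).
transitivity (\sum_k \sum_j lin (p *m dual k) * (omega (p *m e_ k) (e_ j) *: f^`M(j))).
  by apply: eq_bigr => k _; rewrite pbE mulr_sumr.
rewrite exchange_big; apply: eq_bigr => j _ /=.
have -> : lin (p *m e_ j) = \sum_k omega (p *m e_ k) (e_ j) *: lin (p *m dual k).
  rewrite -{1}pp -mulmxA -{1}(sum_dual (p *m e_ j)) mulmx_sumr linear_sum.
  by apply: eq_bigr => k _; rewrite -scalemxAr linearZ /= omp.
by rewrite mulr_suml; apply: eq_bigr => k _; rewrite -scalerAl -scalerAr.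
Qed.

(** By the Leibniz rule the brackets of dual vectors add up to the trace of p and the other terms to
    the Euler operator. So multiplication by the dual basis inverts the divergence up to a
    scalar. *)
Lemma brylinski0 d f : hom d f -> subst p f = f ->
  \sum_k pb (p *m e_ k) (lin (p *m dual k) * f) = (\rank p + d)%:R *: f.
Proof.
move=> hf fp; under eq_bigr => k _ do rewrite pbM pb_lin.
rewrite big_split sum_lin_pb // hf natrD scalerDl -sum_omp -mulr_suml; congr (_ + _).
by rewrite -mul_mpolyC rmorph_sum.
Qed.

(** The same homotopy one step further in the complex. As the divergence of P is 0, only brackets of
    vectors survive in the second sum; they return P i, whence the - 1. *)
Lemma brylinski1 d (P : 'I_n -> S) : (forall i, hom d (P i)) ->
    (forall i, subst p (P i) = P i) -> (forall i, \sum_l p i l *: P l = P i) ->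
    \sum_l pb (p *m e_ l) (P l) = 0 ->
  forall i, \sum_l p i l *: (\sum_k pb (p *m e_ k) (lin (p *m dual k) * P l)) -
    \sum_k p i k *: (\sum_l pb (p *m e_ l) (lin (p *m dual k) * P l)) =
    ((\rank p + d)%:R - 1) *: P i.
Proof.
move=> hP sP pP divP i; rewrite scalerBl scale1r; congr (_ - _).
  under eq_bigr => l _ do rewrite (brylinski0 (hP l)) // scalerA mulrC -scalerA.
  by rewrite -scaler_sumr pP.
under eq_bigr => k _.
  under eq_bigr => l _ do rewrite pbM pb_lin.
  rewrite big_split /= -mulr_sumr divP mulr0 addr0.
  under eq_bigr => l _ do rewrite -omp mulmxA pp om_dualb // mulmx_deltaE mul_mpolyC.
  rewrite pP; over.
by rewrite pP.
Qed.

End PoissonBracket.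

(** * Twisted commutators, their symbols, and averaging under conjugation *)

Section TraceComplex.
Variables (C : numFieldType) (n : nat) (gT : finGroupType).
Variables (omega : {skew_symmetric 'cV[C]_n}) (rG : mx_representation C [set: gT] n).
Variable eta : gT -> C.
Hypothesis omega_nondeg : nondegenerate omega.
Hypothesis isoG : forall g x y, omega (rG g *m x) (rG g *m y) = omega x y.
Hypothesis eta_central :
  forall r g, r \in sreflections rG -> eta (r ^ g)%g = eta r.
Variable k : C.
Hypothesis kk : k * k = 1.
Local Notation V := 'cV[C]_n.
Local Notation S := {mpoly C[n]}.
Local Notation M := {ffun gT -> S}.
Local Notation H := (sra omega rG eta).
Local Notation e_ i := (delta_mx i 0 : V).
Local Notation hv := (sra_vec omega rG eta).
Local Notation hg := (sra_grp omega rG eta).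
Local Notation gM := (mG rG).
Local Notation Sym := (@Sym C n gT omega rG eta).
Local Notation ell := (ell omega rG eta).
Local Notation cmv := (commv omega rG eta).
Implicit Types (x y z : V) (a g : gT) (m P Q : M) (h : H) (b c : C) (u : 'I_n -> H).

Fact br_key : unit. Proof. by []. Qed.
Definition br x h : H := locked_with br_key (hv x * h - k *: (h * hv x)).
Lemma brE x h : br x h = hv x * h - k *: (h * hv x). Proof. by rewrite /br unlock. Qed.

Lemma br_linear x : linear (br x).
Proof.
move=> b h h'; rewrite !brE mulrDr mulrDl -sra_scalerAr -sra_scalerAl scalerBr.
by rewrite scalerDr opprD addrACA !scalerA [k * b]mulrC.
Qed.
HB.instance Definition _ x := GRing.isLinear.Build C H H _ (br x) (br_linear x).

Lemma br_linl h : linear (br^~ h).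
Proof.
move=> b x y; rewrite !brE linearP mulrDr mulrDl /= -sra_scalerAr -sra_scalerAl scalerBr.
by rewrite scalerDr opprD addrACA !scalerA [k * b]mulrC.
Qed.

Lemma br_suml (F : 'I_n -> C) (G : 'I_n -> V) h :
  br (\sum_i F i *: G i) h = \sum_i F i *: br (G i) h.
Proof.
pose F' := GRing.isLinear.Build C V H _ (br^~ h) (br_linl h).
pose T : {linear V -> H} := HB.pack (br^~ h) F'.
rewrite -[LHS]/(T _) linear_sum; apply: eq_bigr => j _.
by rewrite linearZ.
Qed.

Lemma br_mulmx (A : 'M[C]_n) i h : br (A *m e_ i) h = \sum_j A j i *: br (e_ j) h.
Proof. by rewrite mulmx_delta br_suml. Qed.

Lemma br_grp x g : br x (hg g) = hv (tw rG k g *m x) * hg g.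
Proof.
rewrite brE sra_grp_vec gactE sra_scalerAl -linearZ -mulrBl -linearB /=.
by rewrite /tw mulmxBl mul1mx scalemxAl.
Qed.

Lemma br_vec x y h : br x (hv y * h) = cmv x y * h + hv y * br x h.
Proof.
by rewrite !brE -commvE mulrBr mulrBl -sra_scalerAr !mulrA addrA subrK.
Qed.

(** The twist enters twice and k^2 = 1, so only the ordinary commutator with [x, y] remains. *)
Lemma br_br x y h : br x (br y h) - br y (br x h) = cmv x y * h - h * cmv x y.
Proof.
rewrite -commvE mulrBl mulrBr !brE !mulrBr !mulrBl !scalerBr.
rewrite -!sra_scalerAr -!sra_scalerAl !scalerA kk !scale1r !mulrA.
have subBB (p q r s : H) : p - q - (r - s) = (p + s) - (q + r).
  by rewrite opprB addrACA opprD.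
have subBBB (p q r s t v : H) : (p - t - (v - s)) - (q - v - (t - r)) = p - q - (r - s).
  by rewrite (subBB p) (subBB q) (subBB p) [v + t]addrC opprB addrA subrK.
exact: subBBB.
Qed.

Definition kM x P : M := [ffun g => lin (tw rG k g *m x) * P g].

Lemma kM_linear x : linear (kM x).
Proof. by move=> b m m'; apply/ffunP => g; rewrite !ffunE mulrDr scalerAr. Qed.
HB.instance Definition _ x := GRing.isLinear.Build C M M _ (kM x) (kM_linear x).

Lemma Sym_br x d h P : Sym d h P -> Sym d.+1 (br x h) (kM x P).
Proof.
move=> s; rewrite brE (_ : kM x P = mX x P - k *: mT rG x P).
  by apply: SymB; [apply: Sym_vec | apply/SymZ/Sym_Vr].
apply/ffunP => g; rewrite !ffunE /tw mulmxBl mul1mx -scalemxAl linearB linearZ /=.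
by rewrite mulrBl scalerAl.
Qed.

(* With [Bd] below, noncommutative Koszul differentials; [Dd \o Bd] has average 0. *)
Definition Dd u : H := \sum_j br (e_ j) (u j).

Lemma Dd_lin b u u' : Dd (fun i => b *: u i + u' i) = b *: Dd u + Dd u'.
Proof.
by rewrite /Dd scaler_sumr -big_split; apply: eq_bigr => j _; rewrite linearP.
Qed.
Lemma DdB u u' : Dd (fun i => u i - u' i) = Dd u - Dd u'.
Proof. by rewrite /Dd -sumrB; apply: eq_bigr => j _; rewrite linearB. Qed.
Lemma DdD u u' : Dd (fun i => u i + u' i) = Dd u + Dd u'.
Proof. by rewrite /Dd -big_split; apply: eq_bigr => j _; rewrite linearD. Qed.

Lemma Sym_Dd d u (P : 'I_n -> M) : (forall i, Sym d (u i) (P i)) ->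
  Sym d.+1 (Dd u) [ffun g => kdiff (tw rG k g) (fun i => P i g)].
Proof.
move=> s; rewrite (_ : finfun _ = \sum_j kM (e_ j) (P j)).
  by apply: Sym_sum => j _; apply: Sym_br.
by apply/ffunP => g; rewrite sum_ffunE ffunE; apply: eq_bigr => j _; rewrite ffunE.
Qed.

Definition Bd (w : 'I_n -> 'I_n -> H) i : H := \sum_j br (e_ j) (w i j - w j i).

Lemma Sym_Bd d (w : 'I_n -> 'I_n -> H) (W : 'I_n -> 'I_n -> M) i :
  (forall i j, Sym d (w i j) (W i j)) ->
  Sym d.+1 (Bd w i) [ffun g => kbound (tw rG k g) (fun i j => W i j g) i].
Proof.
move=> s; rewrite (_ : finfun _ = \sum_j kM (e_ j) (W i j - W j i)).
  by apply: Sym_sum => j _; apply/Sym_br/SymB.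
by apply/ffunP => g; rewrite sum_ffunE ffunE; apply: eq_bigr => j _; rewrite !ffunE.
Qed.

Lemma Dd_Bd w : Dd (Bd w) =
  \sum_i \sum_j (cmv (e_ i) (e_ j) * w i j - w i j * cmv (e_ i) (e_ j)).
Proof.
transitivity (\sum_i \sum_j br (e_ i) (br (e_ j) (w i j)) -
              \sum_i \sum_j br (e_ i) (br (e_ j) (w j i))).
  rewrite -sumrB; apply: eq_bigr => i _; rewrite -sumrB linear_sum.
  by apply: eq_bigr => j _; rewrite !linearB.
rewrite [X in _ - X]exchange_big -sumrB; apply: eq_bigr => i _; rewrite -sumrB.
by apply: eq_bigr => j _; apply: br_br.
Qed.

Definition conj a h : H := hg a * h * hg a^-1%g.

Lemma conj_linear a : linear (conj a).
Proof.
by move=> b h h'; rewrite /conj mulrDr mulrDl -sra_scalerAr -sra_scalerAl.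
Qed.
HB.instance Definition _ a := GRing.isLinear.Build C H H _ (conj a) (conj_linear a).

Lemma conjM a a' h : conj a (conj a' h) = conj (a * a')%g h.
Proof. by rewrite /conj invMg !sra_grpM !mulrA. Qed.

Lemma hgV a : hg a^-1%g * hg a = 1.
Proof. by rewrite -sra_grpM mulVg sra_grp1. Qed.

Lemma conj_mul a h h' : conj a (h * h') = conj a h * conj a h'.
Proof. by rewrite /conj !mulrA -[_ * hg a^-1%g * hg a]mulrA hgV mulr1. Qed.

Lemma conj_vec a x : conj a (hv x) = hv (rG a *m x).
Proof. by rewrite /conj sra_grp_vec gactE -mulrA -sra_grpM mulgV sra_grp1 mulr1. Qed.

Lemma conj_br a x h : conj a (br x h) = br (rG a *m x) (conj a h).
Proof. by rewrite !brE linearB linearZ /= !conj_mul !conj_vec. Qed.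

Definition conjP a P : M := [ffun g => subst (rG a) (P (a^-1 * g * a)%g)].

Lemma conjP_linear a : linear (conjP a).
Proof. by move=> b m m'; apply/ffunP => g; rewrite !ffunE linearP. Qed.
HB.instance Definition _ a := GRing.isLinear.Build C M M _ (conjP a) (conjP_linear a).

Lemma Sym_conj a d h P : Sym d h P -> Sym d (conj a h) (conjP a P).
Proof.
move=> s; rewrite (_ : conjP a P = mR a^-1%g (gM a P)); first exact/Sym_Gr/Sym_Gl.
by apply/ffunP => g; rewrite !ffunE invgK mulgA.
Qed.

Definition av h : H := #|gT|%:R^-1 *: \sum_a conj a h.

Lemma av_linear : linear av.
Proof.
move=> b h h'; rewrite /av [b *: (_ *: _)]scalerA [b * _]mulrC -scalerA -scalerDr.
congr (_ *: _); rewrite scaler_sumr -big_split.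
by apply: eq_bigr => a _; rewrite linearP.
Qed.
HB.instance Definition _ := GRing.isLinear.Build C H H _ av av_linear.

Lemma av_conj a h : av (conj a h) = av h.
Proof.
rewrite /av; congr (_ *: _); under eq_bigr => a' _ do rewrite conjM.
by rewrite [RHS](reindex_inj (mulIg a)).
Qed.

Lemma av_idem h : av (av h) = av h.
Proof.
rewrite {2}/av linearZ linear_sum /=; under eq_bigr => a _ do rewrite av_conj.
by rewrite sumr_const -scaler_nat scalerA mulVf ?natr_card_neq0 // scale1r.
Qed.

Lemma av_comm_grp a h : av (hg a * h) = av (h * hg a).
Proof.
rewrite -[RHS](av_conj a) /conj !mulrA -[_ * hg a * hg a^-1%g]mulrA.
by rewrite -sra_grpM mulgV sra_grp1 mulr1.
Qed.

(** [x, y] lies in C[G], and the average does not see a group element move from one end to the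
    other. *)
Lemma av_commv x y h : av (cmv x y * h - h * cmv x y) = 0.
Proof.
rewrite linearB /=; apply/eqP; rewrite subr_eq0; apply/eqP.
rewrite /commv mulrDl mulrDr !linearD /=; congr (_ + _).
  by rewrite -sra_scalerAl -sra_scalerAr mul1r mulr1.
rewrite mulr_suml mulr_sumr !linear_sum; apply: eq_bigr => r _.
by rewrite -sra_scalerAl -sra_scalerAr !linearZ /= av_comm_grp.
Qed.

Lemma av_Dd_Bd w : av (Dd (Bd w)) = 0.
Proof.
rewrite Dd_Bd linear_sum big1 // => i _; rewrite linear_sum big1 // => j _.
exact: av_commv.
Qed.

(** The diagonal action on V (x) [H], which makes [Dd] equivariant. *)
Definition conjT a u i : H := \sum_j rG a i j *: conj a (u j).
Definition avT u i : H := #|gT|%:R^-1 *: \sum_a conjT a u i.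

Lemma Dd_conjT a u : Dd (conjT a u) = conj a (Dd u).
Proof.
rewrite /Dd linear_sum; under eq_bigr => i _ do rewrite linear_sum.
rewrite exchange_big; apply: eq_bigr => j _ /=.
by rewrite conj_br br_mulmx; apply: eq_bigr => i _; rewrite linearZ.
Qed.

Lemma Dd_avT u : Dd (avT u) = av (Dd u).
Proof.
rewrite /av; under eq_bigr => a _ do rewrite -Dd_conjT.
rewrite /Dd exchange_big scaler_sumr; apply: eq_bigr => j _ /=.
by rewrite linearZ linear_sum.
Qed.

Definition conjTP a (P : 'I_n -> M) i : M := \sum_j rG a i j *: conjP a (P j).
Definition avTP (P : 'I_n -> M) i : M := #|gT|%:R^-1 *: \sum_a conjTP a P i.

Lemma Sym_avT d u (P : 'I_n -> M) i : (forall i, Sym d (u i) (P i)) -> Sym d (avT u i) (avTP P i).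
Proof.
move=> s; apply: SymZ; apply: Sym_sum => a _; apply: Sym_sum => j _.
by apply: SymZ; apply: Sym_conj.
Qed.

Local Notation p g := (fixp rG k g).
Local Notation fdim g := (fixdim rG k g).

(* Within the fixed space of [k g], commutators act on symbols by the Poisson
   bracket, up to terms supported on elements with a smaller fixed space. *)
Definition nice_symbol g x f (Z : M) :=
  Z g = pb omega x f /\ forall g', g' != g -> (fdim g <= fdim g')%N -> Z g' = 0.

(** Since (1 - k g) x = 0, the leading symbol of the commutator vanishes, and the bracket appears
    two levels below. The reflection terms sit on the elements r g; by [fixdim_refl] a nonzero
    coefficient forces a smaller fixed space. *)
Lemma Sym_br_ell g x d f : p g *m x = x -> subst (p g) f = f -> hom d f ->
  exists Z, Sym d.+1 (br x (ell d (dl g f))) Z /\ nice_symbol g x f Z.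
Proof.
move=> xg; elim: d f => [|d IH] f fg hf.
  exists 0; split; last by split=> [|g' _ _]; rewrite ffunE // pbE big1 // => j _; rewrite mderiv_hom0 // scaler0.
  have -> : ell 0 (dl g f) = f@_0 *: hg g.
    rewrite /= (bigD1 g) //= big1 => [|a ag]; first by rewrite dlE addr0.
    by rewrite ffunE (negPf ag) mcoeff0 scale0r.
  rewrite linearZ /= br_grp -xg mulmxA tw_fixp // mul0mx linear0 mul0r scaler0.
  exact: Sym0.
(* As f lives on the fixed space, its symmetrization can be built from the vectors [p g *m e_ j] and
   polynomials on that space, so that the induction applies. *)
pose F j := subst (p g) (f^`M(j)).
have hF j : hom d (F j) by apply/hom_subst/hom_mderiv.
have FF j : subst (p g) (F j) = F j by rewrite /F subst_comp fixp_idem.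
have [Z ZP] := choice (fun j => IH (F j) (FF j) (hF j)).
have pe j : p g *m (p g *m e_ j) = p g *m e_ j by rewrite mulmxA fixp_idem.
have ellE : ell d.+1 (dl g f) =
    d.+1%:R^-1 *: \sum_j hv (p g *m e_ j) * ell d (dl g (F j)).
  rewrite /=; congr (_ *: _).
  transitivity (\sum_i \sum_j p g i j *: (hv (e_ i) * ell d (dl g (F j)))).
    apply: eq_bigr => i _; rewrite mD_dl -{1}fg mderiv_subst linear_sum linear_sum mulr_sumr.
    by apply: eq_bigr => j _; rewrite !linearZ /= -sra_scalerAr.
  rewrite exchange_big; apply: eq_bigr => j _ /=.
  rewrite mulmx_delta linear_sum mulr_suml; apply: eq_bigr => i _.
  by rewrite linearZ /= -sra_scalerAl.
pose Z' := d.+1%:R^-1 *: \sum_j (omega x (p g *m e_ j) *: dl g (F j) +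
  (\sum_(r in sreflections rG) (eta r * omega_refl omega rG r x (p g *m e_ j)) *: gM r (dl g (F j))) +
  mX (p g *m e_ j) (Z j)).
exists Z'; split.
  rewrite ellE linearZ linear_sum /=; apply: SymZ; apply: Sym_sum => j _.
  rewrite br_vec; apply: SymD; last by apply: Sym_vec; have [] := ZP j.
  have Sl : Sym d.+2 (ell d (dl g (F j))) (dl g (F j)) by apply/Sym_ell/homM_dl.
  rewrite commv_mull; apply: SymD; first exact: SymZ.
  by apply: Sym_sum => r _; apply: SymZ; apply: Sym_Gl.
have reflE g' : (fdim g <= fdim g')%N -> forall j,
    (\sum_(r in sreflections rG) (eta r * omega_refl omega rG r x (p g *m e_ j)) *: gM r (dl g (F j))) g' = 0.
  move=> gg' j; rewrite sum_ffunE big1 // => r rR; rewrite ffunE mG_dl ffunE.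
  case: eqP => [rg|_]; last by rewrite scaler0.
  have [->|w0] := eqVneq (omega_refl omega rG r x (p g *m e_ j)) 0; first by rewrite mulr0 scale0r.
  have := fixdim_refl isoG kk rR xg (pe j) w0.
  by rewrite -rg ltnNge gg'.
split=> [|g' g'g gg'].
  have d0 : (d.+1%:R : C) != 0 by rewrite pnatr_eq0.
  have fE : f = d.+1%:R^-1 *: \sum_j lin (p g *m e_ j) * F j.
    rewrite (_ : \sum_j _ = d.+1%:R *: f); first by rewrite scalerA mulVf // scale1r.
    rewrite -[in RHS]fg -linearZ -(hom_euler hf) linear_sum.
    by apply: eq_bigr => j _; rewrite /= substM substX.
  rewrite ffunE sum_ffunE [in RHS]fE [RHS]linearZ /=; congr (_ *: _); rewrite linear_sum.
  apply: eq_bigr => j _ /=; rewrite pbM pb_lin mul_mpolyC !ffunE reflE // addr0 eqxx.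
  by have [_ [-> _]] := ZP j.
rewrite ffunE sum_ffunE big1 ?scaler0 // => j _; rewrite !ffunE reflE // (negPf g'g).
by have [_ [_ ->]] := ZP j; rewrite // mulr0 scaler0 !addr0.
Qed.

End TraceComplex.

(** * Sums of twisted commutators that lie in the span of G *)

Section TraceIndependence.
Variables (C : numFieldType) (n : nat) (gT : finGroupType).
Variables (omega : {skew_symmetric 'cV[C]_n}) (rG : mx_representation C [set: gT] n).
Variable eta : gT -> C.
Hypothesis omega_nondeg : nondegenerate omega.
Hypothesis isoG : forall g x y, omega (rG g *m x) (rG g *m y) = omega x y.
Hypothesis eta_central :
  forall r g, r \in sreflections rG -> eta (r ^ g)%g = eta r.
Variable k : C.
Hypothesis kk : k * k = 1.
Local Notation V := 'cV[C]_n.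
Local Notation S := {mpoly C[n]}.
Local Notation M := {ffun gT -> S}.
Local Notation H := (sra omega rG eta).
Local Notation e_ i := (delta_mx i 0 : V).
Local Notation Sym := (@Sym C n gT omega rG eta).
Local Notation fil := (@fil C n gT omega rG eta).
Local Notation ell := (ell omega rG eta).
Implicit Types (x y z : V) (a g : gT) (P Q : M) (h : H) (b c : C) (u : 'I_n -> H).

Local Notation p g := (fixp rG k g).
Local Notation E g := (fixdim rG k g).
Local Notation br := (@br C n gT omega rG eta k).
Local Notation Dd := (@Dd C n gT omega rG eta k).
Local Notation Bd := (@Bd C n gT omega rG eta k).

Lemma sum_br_mulmx (A : 'M[C]_n) (X : 'I_n -> H) :
  \sum_l br (e_ l) (\sum_m A l m *: X m) = \sum_m br (A *m e_ m) (X m).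
Proof.
under eq_bigr => l _ do rewrite linear_sum.
rewrite exchange_big; apply: eq_bigr => m _ /=.
by rewrite br_mulmx; apply: eq_bigr => l _; rewrite linearZ.
Qed.

Lemma ell_dl_sum d g (c : 'I_n -> C) (F : 'I_n -> S) :
  ell d (dl g (\sum_m c m *: F m)) = \sum_m c m *: ell d (dl g (F m)).
Proof. by rewrite !linear_sum; apply: eq_bigr => m _; rewrite !linearZ. Qed.

Lemma ell_split d P : ell d P = \sum_g ell d (dl g (P g)).
Proof. by rewrite {1}(dl_sum P) linear_sum. Qed.

(* The symbols that are supported on the fixed spaces: [P] lies in
   [V_g (x) S(V_g)] for each [g]. *)
Definition reduced (P : 'I_n -> M) : Prop := forall g i,
  subst (p g) (P i g) = P i g /\ mulP (p g) (fun j => P j g) i = P i g.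

Lemma avTPE (P : 'I_n -> M) i g : avTP rG P i g =
  #|gT|%:R^-1 *: \sum_a \sum_j rG a i j *: subst (rG a) (P j (a^-1 * g * a)%g).
Proof.
rewrite ffunE sum_ffunE; congr (_ *: _); apply: eq_bigr => a _.
by rewrite sum_ffunE; apply: eq_bigr => j _; rewrite !ffunE.
Qed.

Lemma fixp_conjC a g : p g *m rG a = rG a *m p (a^-1 * g * a)%g.
Proof.
have {1}-> : g = (a * (a^-1 * g * a) * a^-1)%g by rewrite !mulgA mulgV mul1g mulgK.
by rewrite fixp_conj // -[LHS]mulmxA rGV mulmx1.
Qed.

Lemma reduced_avTP (P : 'I_n -> M) : reduced P -> reduced (avTP rG P).
Proof.
move=> redP g i; have substP a j : subst (p g) (subst (rG a) (P j (a^-1 * g * a)%g)) =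
    subst (rG a) (P j (a^-1 * g * a)%g).
  by rewrite subst_comp fixp_conjC -subst_comp (proj1 (redP _ _)).
split.
  rewrite avTPE linearZ linear_sum; congr (_ *: _); apply: eq_bigr => a _ /=.
  by rewrite linear_sum; apply: eq_bigr => j _; rewrite linearZ /= substP.
rewrite /mulP; under eq_bigr => l _ do rewrite avTPE scalerA mulrC -scalerA scaler_sumr.
rewrite -scaler_sumr exchange_big avTPE; congr (_ *: _); apply: eq_bigr => a _ /=.
transitivity (mulP (p g *m rG a) (fun j => subst (rG a) (P j (a^-1 * g * a)%g)) i).
  by rewrite -mulP_comp.
rewrite fixp_conjC -mulP_comp; apply: eq_bigr => m _; congr (_ *: _).
rewrite -[in RHS](proj2 (redP _ m)) linear_sum; apply: eq_bigr => j _.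
by rewrite linearZ.
Qed.

Lemma avTP_eq0 e (P : 'I_n -> M) : (forall g i, (e <= E g)%N -> P i g = 0) ->
  forall g i, (e <= E g)%N -> avTP rG P i g = 0.
Proof.
move=> P0 g i eg; rewrite avTPE big1 ?scaler0 // => a _; rewrite big1 // => j _.
by rewrite P0 ?linear0 ?scaler0 // -{2}[a]invgK fixdim_conj.
Qed.

(** At each g the symbol of u is a Koszul cycle, hence a reduced symbol plus a boundary. Subtracting
    [Bd] of a lift removes the boundary without changing the average. *)
Lemma koszul_step d u (P : 'I_n -> M) : (forall i, Sym d.+3 (u i) (P i)) ->
    Sym d.+4 (Dd u) 0 ->
  exists u' (P' : 'I_n -> M), [/\ forall i, Sym d.+3 (u' i) (P' i), Dd u' = av (Dd u), reduced P' &
    forall e, (forall g i, (e <= E g)%N -> P i g = 0) ->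
              forall g i, (e <= E g)%N -> P' i g = 0].
Proof.
move=> Su D0; have hP g i : hom d.+1 (P i g) by apply: (Sym_homM (Su i)).
have dP g : kdiff (tw rG k g) (fun i => P i g) = 0.
  have := Sym_uniq isoG eta_central (Sym_Dd _ Su) D0.
  by move/ffunP/(_ g); rewrite !ffunE.
have kosz g : exists W : 'I_n -> 'I_n -> S, (forall i j, hom d (W i j)) /\
    forall i, P i g - mulP (p g) (subst (p g) \o (fun j => P j g)) i = kbound (tw rG k g) W i.
  apply: koszul_reduce1 (dP g) => //; first exact: fixp_idem.
  - exact: tw_fixp.
  - exact: tw_twinv.
  - exact: twinv_tw.
have [W WP] := choice kosz.
pose Wm i j : M := [ffun g => W g i j].
have Sw i j : Sym d.+2 (ell d (Wm i j)) (Wm i j).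
  by apply: Sym_ell => // g; rewrite ffunE; have [] := WP g.
pose w i j := ell d (Wm i j).
pose P1 i : M := [ffun g => mulP (p g) (subst (p g) \o (fun j => P j g)) i].
have Su1 i : Sym d.+3 (u i - Bd w i) (P1 i).
  rewrite (_ : P1 i = P i - [ffun g => kbound (tw rG k g) (fun i j => Wm i j g) i]).
    by apply: SymB => //; apply: Sym_Bd.
  apply/ffunP => g; rewrite !ffunE.
  have -> : kbound (tw rG k g) (fun i j => Wm i j g) i = kbound (tw rG k g) (W g) i.
    by apply: eq_bigr => j _; rewrite !ffunE.
  by rewrite -(proj2 (WP g)) opprB addrC subrK.
have red1 : reduced P1.
  move=> g i; split.
    rewrite ffunE linear_sum; apply: eq_bigr => j _.
    by rewrite linearZ /= subst_comp fixp_idem.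
  rewrite (_ : mulP _ _ i = mulP (p g) (mulP (p g) (subst (p g) \o (fun j => P j g))) i).
    by rewrite mulP_comp fixp_idem // ffunE.
  by apply: eq_bigr => j _; rewrite ffunE.
exists (avT (fun i => u i - Bd w i)), (avTP rG P1); split.
- by move=> i; apply: Sym_avT.
- by rewrite Dd_avT DdB linearB /= av_Dd_Bd // subr0.
- exact: reduced_avTP.
move=> e P0; apply: avTP_eq0 => g i eg; rewrite ffunE /mulP big1 // => j _ /=.
by rewrite P0 // linear0 scaler0.
Qed.

(** Two levels below the top, the symbol of [Dd u] at g0 is the divergence of P plus an element of
    the ideal of [1 - k g0], which dies on the fixed space. Other elements contribute nothing: P is
    0 on larger fixed spaces, and [nice_symbol] excludes the rest. *)
Lemma divergence_step d u (P : 'I_n -> M) Q g0 : (forall i, Sym d.+3 (u i) (P i)) ->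
    reduced P -> Sym d.+2 (Dd u) Q -> Q g0 = 0 ->
    (forall g i, (E g0 < E g)%N -> P i g = 0) ->
  \sum_l pb omega (p g0 *m e_ l) (P l g0) = 0.
Proof.
move=> Su redP SQ Q0 P0.
have hP g i : hom d.+1 (P i g) by apply: (Sym_homM (Su i)).
have pe g l : p g *m (p g *m e_ l) = p g *m e_ l by rewrite mulmxA fixp_idem.
have [Z ZP] := choice (fun gl : gT * 'I_n => Sym_br_ell eta isoG kk
  (pe gl.1 gl.2) (proj1 (redP gl.1 gl.2)) (hP gl.1 gl.2)).
have [R RP] := choice (fun l => Sym_sub_ell (Su l)).
pose X g l := ell d.+1 (dl g (P l g)).
have DE : Dd u = \sum_g \sum_l br (p g *m e_ l) (X g l) +
    Dd (fun l => u l - ell d.+1 (P l)).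
  rewrite DdB; have -> : Dd (fun l => ell d.+1 (P l)) = \sum_g \sum_l br (p g *m e_ l) (X g l).
    under [RHS]eq_bigr => g _ do rewrite -sum_br_mulmx.
    rewrite exchange_big; apply: eq_bigr => l _; rewrite -linear_sum; congr (br _ _).
    rewrite [LHS]ell_split; apply: eq_bigr => g _.
    by rewrite -{1}(proj2 (redP g l)) /mulP ell_dl_sum.
  by rewrite addrC subrK.
have SR := Sym_Dd k RP.
have SX : Sym d.+2 (\sum_g \sum_l br (p g *m e_ l) (X g l)) (\sum_g \sum_l Z (g, l)).
  by apply: Sym_sum => g _; apply: Sym_sum => l _; have [] := ZP (g, l).
have := SymD SX SR; rewrite -DE => /(Sym_uniq isoG eta_central SQ)/ffunP/(_ g0).
rewrite Q0 [RHS]ffunE [X in _ = _ + X]ffunE sum_ffunE (bigD1 g0) //= [X in _ + X + _]big1 => [|g gg0]; last first.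
  rewrite sum_ffunE big1 // => l _; have [SZ [_ Z0]] := ZP (g, l).
  have [gle|glt] := leqP (E g) (E g0); first by apply: Z0 => //; rewrite eq_sym.
  have Z00 : Z (g, l) = 0.
    apply: (Sym_uniq isoG eta_central SZ); rewrite -[(g, l).1]/g -[(g, l).2]/l P0 //.
    by rewrite [dl g 0]linear0 [ell _ 0]linear0 [br _ 0]linear0; apply: Sym0.
  by rewrite Z00 ffunE.
rewrite addr0 sum_ffunE => /(congr1 (subst (p g0))); rewrite linear0 linearD /=.
have -> : subst (p g0) (kdiff (tw rG k g0) (fun i => R i g0)) = 0.
  rewrite linear_sum big1 // => l _ /=.
  by rewrite substM subst_lin mulmxA fixp_tw // mul0mx linear0 mul0r.
rewrite addr0 linear_sum => SZ; rewrite [RHS]SZ; apply: eq_bigr => l _.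
have [_ [-> _]] := ZP (g0, l).
by rewrite /= subst_pb ?fixp_idem //; have [] := redP g0 l.
Qed.

(** On the elements with [E g = e] the symbol is a Poisson boundary by [brylinski1]. Its lift pairs
    only with fixed vectors, so [Bd w] drops two levels and [Sym_br_ell] gives its symbol. *)
Lemma brylinski_step d e (P : 'I_n -> M) : (0 < e)%N ->
    (forall i, homM d.+1 (P i)) -> reduced P ->
    (forall g, E g = e -> \sum_l pb omega (p g *m e_ l) (P l g) = 0) ->
  exists w (Z : 'I_n -> M), [/\ forall i, Sym d.+3 (Bd w i) (Z i), forall g i, E g = e -> Z i g = P i g &
    forall g i, (e < E g)%N -> Z i g = 0].
Proof.
(* The scalar of [brylinski1] for rank e and degree d + 1; it is nonzero as e > 0. *)
move=> e0 hP redP div0; pose c : C := (e + d)%:R.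
have c0 : c != 0 by rewrite pnatr_eq0 -lt0n addn_gt0 e0.
have pe g l : p g *m (p g *m e_ l) = p g *m e_ l by rewrite mulmxA fixp_idem.
pose f g l m := lin (p g *m dualb omega m) * P l g.
have hf g l m : hom d.+2 (f g l m) by apply/hom_linM/hP.
have pf g l m : subst (p g) (f g l m) = f g l m.
  by rewrite /f substM subst_lin mulmxA fixp_idem // (proj1 (redP g l)).
have [Z ZP] := choice (fun t : gT * 'I_n * 'I_n * 'I_n => Sym_br_ell eta isoG kk
  (pe t.1.1.1 t.1.1.2) (pf t.1.1.1 t.1.2 t.2) (hf t.1.1.1 t.1.2 t.2)).
pose N g l m := ell d.+2 (dl g (f g l m)).
pose w i j := c^-1 *: \sum_(g | E g == e) \sum_m p g j m *: \sum_l p g i l *: N g l m.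
have BdE i : Bd w i = c^-1 *: \sum_(g | E g == e)
    (\sum_m \sum_l p g i l *: br (p g *m e_ m) (N g l m) -
     \sum_m p g i m *: \sum_l br (p g *m e_ l) (N g l m)).
  have -> : Bd w i = \sum_j br (e_ j) (w i j) - \sum_j br (e_ j) (w j i).
    by rewrite -sumrB; apply: eq_bigr => j _; rewrite linearB.
  rewrite sumrB scalerBr; congr (_ - _).
    under eq_bigr => j _ do rewrite linearZ linear_sum.
    rewrite -scaler_sumr exchange_big /=; congr (_ *: _); apply: eq_bigr => g _.
    rewrite sum_br_mulmx; apply: eq_bigr => m _.
    by rewrite linear_sum; apply: eq_bigr => l _; rewrite linearZ.
  under eq_bigr => j _ do rewrite linearZ linear_sum.
  rewrite -scaler_sumr exchange_big /=; congr (_ *: _); apply: eq_bigr => g _.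
  under eq_bigr => j _ do rewrite linear_sum.
  rewrite exchange_big; apply: eq_bigr => m _ /=.
  rewrite -sum_br_mulmx scaler_sumr; apply: eq_bigr => j _.
  by rewrite linearZ.
pose Zt i : M := c^-1 *: \sum_(g | E g == e)
    (\sum_m \sum_l p g i l *: Z (g, m, l, m) - \sum_m p g i m *: \sum_l Z (g, l, l, m)).
have ZtE i g0 : Zt i g0 = c^-1 *: \sum_(g | E g == e)
    (\sum_m \sum_l p g i l *: Z (g, m, l, m) g0 - \sum_m p g i m *: \sum_l Z (g, l, l, m) g0).
  rewrite ffunE sum_ffunE; congr (_ *: _); apply: eq_bigr => g _.
  rewrite !ffunE !sum_ffunE; congr (_ - _); apply: eq_bigr => m _.
    by rewrite sum_ffunE; apply: eq_bigr => l _; rewrite ffunE.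
  by rewrite ffunE sum_ffunE.
have Zoff g g0 j l m : E g = e -> (e <= E g0)%N -> g0 != g -> Z (g, j, l, m) g0 = 0.
  by move=> Eg eg0 g0g; have [_ [_ ->]] := ZP (g, j, l, m); rewrite //= Eg.
exists w, Zt; split.
- move=> i; rewrite BdE; apply: SymZ; apply: Sym_sum => g _; apply: SymB.
    apply: Sym_sum => m _; apply: Sym_sum => l _; apply: SymZ.
    by have [] := ZP (g, m, l, m).
  apply: Sym_sum => m _; apply: SymZ; apply: Sym_sum => l _.
  by have [] := ZP (g, l, l, m).
- move=> g0 i Eg0; rewrite ZtE (bigD1 g0) ?Eg0 //= [X in _ + X]big1 ?addr0; last first.
    move=> g /andP[/eqP Eg gg0]; rewrite !big1 ?subrr // => m _.
      by rewrite big1 ?scaler0 // => l _; rewrite Zoff ?Eg0 // eq_sym.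
    by rewrite big1 // => l _; rewrite Zoff ?scaler0 ?Eg0 // eq_sym.
  have hP0 l : hom d.+1 (P l g0) by apply: hP.
  have := brylinski1 omega_nondeg (fixp_idem rG kk g0) (om_fixp isoG kk g0) hP0
    (fun l => proj1 (redP g0 l)) (fun l => proj2 (redP g0 l)) (div0 g0 Eg0) i.
  rewrite -/(E g0) Eg0 addnS -natr1 addrK -/c => bryl.
  rewrite -[RHS]scale1r -(mulVf c0) -scalerA -bryl; congr (_ *: (_ - _)).
    rewrite exchange_big; apply: eq_bigr => l _ /=; rewrite scaler_sumr.
    by apply: eq_bigr => m _; have [_ [-> _]] := ZP (g0, m, l, m).
  apply: eq_bigr => m _; congr (_ *: _); apply: eq_bigr => l _.
  by have [_ [-> _]] := ZP (g0, l, l, m).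
move=> g0 i eg0; rewrite ZtE big1 ?scaler0 // => g /eqP Eg.
have g0g : g0 != g by apply: contraTneq eg0 => ->; rewrite Eg ltnn.
rewrite !big1 ?subrr // => m _.
  by rewrite big1 ?scaler0 // => l _; rewrite Zoff ?(ltnW eg0).
by rewrite big1 // => l _; rewrite Zoff ?scaler0 ?(ltnW eg0).
Qed.

(* Combinations of the elements of G without eigenvalue [k], as [k = k^-1]. *)
Definition span0 h := exists Q, Sym 2 h Q /\ forall g, (0 < E g)%N -> Q g = 0.

Lemma Sym_ups i d h P : Sym d h P -> Sym (d + i.*2.+2) h 0.
Proof.
elim: i d P => [|i IH] d P s; first by rewrite addn2; apply: Sym_up s.
by rewrite doubleS addnS addnS; apply: Sym_up (IH _ _ s).
Qed.

(** At level 2 the symbol is the one that defines [span0]; at higher levels it is 0. *)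
Lemma span0_symbol j h Q : span0 h -> Sym (2 + j.*2) h Q -> forall g, (0 < E g)%N -> Q g = 0.
Proof.
move=> [Q' [s Q'0]] sQ g Eg; case: j sQ => [|j] sQ.
  by rewrite (Sym_uniq isoG eta_central sQ s) Q'0.
by rewrite (Sym_uniq isoG eta_central sQ (Sym_ups j s)) ffunE.
Qed.

Lemma span0_av h : span0 h -> span0 (av h).
Proof.
move=> [Q [s Q0]]; exists (#|gT|%:R^-1 *: \sum_a conjP rG a Q); split.
  by apply: SymZ; apply: Sym_sum => a _; apply: Sym_conj.
move=> g Eg; rewrite ffunE sum_ffunE big1 ?scaler0 // => a _.
by rewrite ffunE Q0 ?linear0 // -{2}[a]invgK fixdim_conj.
Qed.

Lemma fixp_eq0 g : E g = 0%N -> p g = 0.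
Proof. by move/eqP; rewrite mxrank_eq0 => /eqP. Qed.

(** Induction on the level of the arguments and, within a level, on a bound for the fixed spaces
    that carry their symbol. Each step replaces [Dd u] by its average, and averaging is
    idempotent. *)
Theorem span0_Dd_eq0 j u : (forall i, fil j.*2.+1 (u i)) -> span0 (Dd u) -> av (Dd u) = 0.
Proof.
elim: j u => [|j IHj] u fu sDu.
  have -> : Dd u = 0 by rewrite /Dd big1 // => i _; rewrite (fil_low2 (fu i)) // linear0.
  by rewrite linear0.
have [P SP] := choice fu; rewrite doubleS in SP.
suff inner e : forall u (P : 'I_n -> M), (forall i, Sym j.*2.+3 (u i) (P i)) ->
    span0 (Dd u) -> (forall g i, (e <= E g)%N -> P i g = 0) -> av (Dd u) = 0.
  (* Fixed spaces have dimension at most n, so the vanishing condition is empty at n + 1. *)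
  apply: (inner n.+1 u P) => // g i ng.
  by have := leq_trans ng (rank_leq_row (p g)); rewrite ltnn.
elim: e => [|e IHe] {u fu sDu P SP} u P SP sDu P0.
  apply: IHj => // i; apply: Sym0_fil.
  have <- : P i = 0 by apply/ffunP => g; rewrite P0 // ffunE.
  exact: SP.
have Dup w : span0 (Dd w) -> Sym j.*2.+4 (Dd w) 0.
  by case=> Q [s _]; have := Sym_ups j s; rewrite add2n.
have [u2 [P2 [SP2 Du2 red2 P20]]] := koszul_step SP (Dup _ sDu).
have {}P20 := P20 _ P0.
have sDu2 : span0 (Dd u2) by rewrite Du2; apply: span0_av.
rewrite -av_idem -Du2.
case: e IHe P0 P20 => [|e] IHe P0 P20.
  (* A reduced symbol vanishes where the fixed space is 0. *)
  apply: (IHe _ P2) => // g i _; case: (posnP (E g)) => [Eg|]; last exact: P20.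
  rewrite -(proj2 (red2 g i)) fixp_eq0 // /mulP big1 // => l _.
  by rewrite mxE scale0r.
have div0 g : E g = e.+1 -> \sum_l pb omega (p g *m e_ l) (P2 l g) = 0.
  move=> Eg; have SD := Sym_Dd k SP2.
  have [Q SQ] : fil j.*2.+2 (Dd u2).
    case: sDu2 => Q [s _]; apply: (@fil_leq _ _ _ _ _ _ 2) => //=; first by rewrite odd_double.
    by exists Q.
  apply: (divergence_step SP2 red2 SQ) => [|g' i]; last by rewrite Eg => /P20.
  by apply: (span0_symbol (j := j) sDu2); rewrite ?add2n ?Eg.
have hP2 i : homM j.*2.+1 (P2 i) by apply: Sym_homM (SP2 i).
have [w [Z [SZ Ze Zlt]]] := brylinski_step (ltn0Sn e) hP2 red2 div0.
have D3 : Dd (avT (fun i => u2 i - Bd w i)) = av (Dd u2).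
  by rewrite Dd_avT DdB linearB /= av_Dd_Bd // subr0.
rewrite -av_idem -D3; apply: (IHe _ (avTP rG (fun i => P2 i - Z i))).
- by move=> i; apply: Sym_avT => i'; apply: SymB.
- by rewrite D3; apply: span0_av.
apply: avTP_eq0 => g i; rewrite !ffunE leq_eqVlt => /orP[/eqP Eg|Eg].
  by rewrite Ze // subrr.
by rewrite Zlt // P20 // subrr.
Qed.

End TraceIndependence.

(** * Reduction to twisted commutators and elements without eigenvalue k *)

Section TraceSpanning.
Variables (C : numFieldType) (n : nat) (gT : finGroupType).
Variables (omega : {skew_symmetric 'cV[C]_n}) (rG : mx_representation C [set: gT] n).
Variable eta : gT -> C.
Hypothesis omega_nondeg : nondegenerate omega.
Hypothesis isoG : forall g x y, omega (rG g *m x) (rG g *m y) = omega x y.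
Hypothesis eta_central :
  forall r g, r \in sreflections rG -> eta (r ^ g)%g = eta r.
Variable k : C.
Hypothesis kk : k * k = 1.
Local Notation V := 'cV[C]_n.
Local Notation S := {mpoly C[n]}.
Local Notation M := {ffun gT -> S}.
Local Notation H := (sra omega rG eta).
Local Notation e_ i := (delta_mx i 0 : V).
Local Notation Sym := (@Sym C n gT omega rG eta).
Local Notation fil := (@fil C n gT omega rG eta).
Local Notation ell := (ell omega rG eta).
Implicit Types (x y z : V) (a g : gT) (P Q : M) (h : H) (b c : C) (u : 'I_n -> H).

Local Notation p g := (fixp rG k g).
Local Notation E g := (fixdim rG k g).
Local Notation br := (@br C n gT omega rG eta k).
Local Notation Dd := (@Dd C n gT omega rG eta k).
Local Notation span0 := (@span0 C n gT omega rG eta k).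

Lemma subst0_hom d (f : S) : hom d.+1 f -> subst 0 f = 0.
Proof.
move=> hf; have fE : f = d.+1%:R^-1 *: \sum_i 'X_i * f^`M(i).
  by rewrite (hom_euler hf) scalerA mulVf ?scale1r // pnatr_eq0.
rewrite fE linearZ linear_sum /= big1 ?scaler0 // => i _.
by rewrite substM substX mul0mx linear0 mul0r.
Qed.

(** [koszul_reduce0] writes the difference of the symbol and its restriction as a Koszul
    differential; symmetrizing the coefficients lifts it to [Dd u]. *)
Lemma span_koszul_step d h P : Sym d.+3 h P ->
  exists u (P' : M), [/\ forall i, fil d.+2 (u i), Sym d.+3 (h - Dd u) P' &
    forall g, P' g = subst (p g) (P g)].
Proof.
move=> s; have kosz g := koszul_reduce0 (fixp_idem rG kk g) (tw_twinv rG k g) (Sym_homM s g).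
have [F FP] := choice kosz.
pose Fm j : M := [ffun g => F g j].
have SF j : Sym d.+2 (ell d (Fm j)) (Fm j).
  by apply: Sym_ell => // g; rewrite ffunE; have [] := FP g.
exists (fun j => ell d (Fm j)), [ffun g => subst (p g) (P g)]; split=> [i||g]; last by rewrite ffunE.
  by exists (Fm i).
rewrite (_ : finfun _ = P - [ffun g => kdiff (tw rG k g) (fun i => Fm i g)]).
  by apply: SymB s _; apply: Sym_Dd.
apply/ffunP => g; rewrite !ffunE.
have -> : kdiff (tw rG k g) (fun i => Fm i g) = \sum_j lin (tw rG k g *m e_ j) * F g j.
  by apply: eq_bigr => j _; rewrite ffunE.
by rewrite -(proj2 (FP g)) opprB addrC subrK.
Qed.

(** By [brylinski0] the symbol on [E g = e] is a divergence up to the scalar e + d. Its lift pairs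
    only with fixed vectors, so the commutators stay at the level of h. *)
Lemma span_brylinski_step d e h P : (0 < e)%N -> Sym d.+2 h P ->
    (forall g, subst (p g) (P g) = P g) -> (forall g, (e < E g)%N -> P g = 0) ->
  exists u (P' : M), [/\ forall i, fil d.+3 (u i), Sym d.+2 (h - Dd u) P' &
    forall g, (e <= E g)%N -> P' g = 0].
Proof.
move=> e0 s redP P0; pose c : C := (e + d)%:R.
have c0 : c != 0 by rewrite pnatr_eq0 -lt0n addn_gt0 e0.
have pe g l : p g *m (p g *m e_ l) = p g *m e_ l by rewrite mulmxA fixp_idem.
pose f g l := lin (p g *m dualb omega l) * P g.
have hf g l : hom d.+1 (f g l) by apply/hom_linM/(Sym_homM s).
have pf g l : subst (p g) (f g l) = f g l.
  by rewrite /f substM subst_lin mulmxA fixp_idem // redP.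
have [Z ZP] := choice (fun t : gT * 'I_n => Sym_br_ell eta isoG kk
  (pe t.1 t.2) (pf t.1 t.2) (hf t.1 t.2)).
pose N g l := ell d.+1 (dl g (f g l)).
pose u j := c^-1 *: \sum_(g | E g == e) \sum_l p g j l *: N g l.
have uE : Dd u = c^-1 *: \sum_(g | E g == e) \sum_l br (p g *m e_ l) (N g l).
  rewrite /Dd; under eq_bigr => j _ do rewrite linearZ linear_sum.
  rewrite -scaler_sumr exchange_big /=; congr (_ *: _); apply: eq_bigr => g _.
  exact: sum_br_mulmx.
exists u, (P - c^-1 *: \sum_(g | E g == e) \sum_l Z (g, l)); split=> [i||g eg].
- apply/filZ/fil_sum => g _; apply: fil_sum => l _; apply: filZ.
  by exists (dl g (f g l)); apply/Sym_ell/homM_dl.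
- apply: SymB => //; rewrite uE; apply: SymZ; apply: Sym_sum => g _; apply: Sym_sum => l _.
  by have [] := ZP (g, l).
have Zoff g' : E g' = e -> g' != g -> \sum_l Z (g', l) g = 0.
  move=> Eg' g'g; rewrite big1 // => l _.
  by have [_ [_ ->]] := ZP (g', l); rewrite //= 1?eq_sym ?Eg'.
rewrite !ffunE sum_ffunE; have [Eg|gne] := eqVneq (E g) e; last first.
  rewrite P0 ?big1 ?scaler0 ?subrr // => [g' /eqP Eg'|]; last by rewrite ltn_neqAle eq_sym gne.
  by rewrite sum_ffunE Zoff //; apply: contraNneq gne => <-; rewrite Eg'.
rewrite (bigD1 g) ?Eg //= [X in _ *: (_ + X)]big1 ?addr0 => [|g' /andP[/eqP Eg' g'g]]; last first.
  by rewrite sum_ffunE Zoff.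
rewrite sum_ffunE (eq_bigr (fun l => pb omega (p g *m e_ l) (f g l))) => [|l _]; last first.
  by have [_ [-> _]] := ZP (g, l).
rewrite (brylinski0 omega_nondeg (fixp_idem rG kk g) (om_fixp isoG kk g) (Sym_homM s g)) //.
by rewrite -/(E g) Eg scalerA mulVf // scale1r subrr.
Qed.

(** The double induction of [span0_Dd_eq0], on the symbol of h itself. The Poisson homotopy
    multiplies a symbol by a vector, hence the level d + 1 of u. *)
Theorem span0_Dd_span d h : fil d h ->
  exists u s, [/\ forall i, fil d.+1 (u i), span0 s & h = Dd u + s].
Proof.
have D0 : Dd (fun=> 0) = 0 by rewrite /Dd big1 // => i _; rewrite linear0.
have zero j : exists u s, [/\ forall i, fil j (u i), span0 s & 0 = Dd u + s].
  exists (fun=> 0), 0; rewrite D0 addr0; split=> // [i|]; first exact: fil0.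
  by exists 0; split=> [|g _]; [apply: Sym0 | rewrite ffunE].
elim/low_ind2: d h => [||d IHd] h; try by move/fil_low2 => -> //; apply: zero.
case=> P sP; suff inner e : forall h P, Sym d.+2 h P -> (forall g, (e <= E g)%N -> P g = 0) ->
    exists u s, [/\ forall i, fil d.+3 (u i), span0 s & h = Dd u + s].
  apply: (inner n.+1 h P) => // g ng.
  by have := leq_trans ng (rank_leq_row (p g)); rewrite ltnn.
have drop h' h1 u1 : h1 = h' - Dd u1 -> (forall i, fil d.+3 (u1 i)) ->
    (exists u s, [/\ forall i, fil d.+3 (u i), span0 s & h1 = Dd u + s]) ->
    exists u s, [/\ forall i, fil d.+3 (u i), span0 s & h' = Dd u + s].
  move=> h1E fu1 [u [s [fu ss hE]]]; exists (fun i => u i + u1 i), s; split=> // [i|].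
    exact: filD.
  by rewrite DdD addrAC -hE h1E subrK.
elim: e => [|e IHe] {sP h P} h P sP P0.
  have [u [s [fu ss hE]]] : exists u s, [/\ forall i, fil d.+1 (u i), span0 s & h = Dd u + s].
    apply: IHd; apply: Sym0_fil; have <- // : P = 0.
    by apply/ffunP => g; rewrite P0 // ffunE.
  by exists u, s; split=> // i; apply: fil_up.
have [u1 [P1 [fu1 sP1 P1E]]] : exists u1 (P1 : M), [/\ forall i, fil d.+3 (u1 i), Sym d.+2 (h - Dd u1) P1 &
    forall g, P1 g = subst (p g) (P g)].
  case: d sP {IHd IHe zero drop} => [|d] sP.
    exists (fun=> 0), P; rewrite D0 subr0; split=> // [i|g]; first exact: fil0.
    by rewrite (hom0_const (Sym_homM sP g)) substE comp_mpolyC.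
  have [u [P' [fu s P'E]]] := span_koszul_step sP; exists u, P'; split=> // i.
  exact: fil_up.
apply: (drop _ _ u1 erefl fu1).
have P10 g : (e < E g)%N -> P1 g = 0 by move=> eg; rewrite P1E P0 // linear0.
have red1 g : subst (p g) (P1 g) = P1 g by rewrite P1E subst_comp fixp_idem.
case: e IHe P0 P10 => [|e] IHe P0 P10.
  (* Where the fixed space is 0, constants are what [span0] keeps, and polynomials of positive
     degree restrict to 0. *)
  case: d sP1 {sP IHd fu1 drop zero} IHe => [|d] sP1 IHe.
    exists (fun=> 0), (h - Dd u1); rewrite D0 add0r; split=> // [i|]; first exact: fil0.
    by exists P1; split.
  apply: (IHe _ P1) => // g _; case: (posnP (E g)) => [Eg|]; last exact: P10.
  by rewrite -red1 fixp_eq0 // (subst0_hom (Sym_homM sP1 g)).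
have [u2 [P2 [fu2 sP2 P20]]] := span_brylinski_step (ltn0Sn e) sP1 red1 P10.
exact: (drop _ _ u2 erefl fu2 (IHe _ _ sP2 P20)).
Qed.

End TraceSpanning.

(** * The parity grading of [H] *)

Section Parity.
Variables (C : numFieldType) (n : nat) (gT : finGroupType).
Variables (omega : {skew_symmetric 'cV[C]_n}) (rG : mx_representation C [set: gT] n).
Variable eta : gT -> C.
Hypothesis isoG : forall g x y, omega (rG g *m x) (rG g *m y) = omega x y.
Hypothesis eta_central :
  forall r g, r \in sreflections rG -> eta (r ^ g)%g = eta r.
Local Notation S := {mpoly C[n]}.
Local Notation M := {ffun gT -> S}.
Local Notation H := (sra omega rG eta).
Local Notation hv := (sra_vec omega rG eta).
Local Notation hg := (sra_grp omega rG eta).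
Local Notation fil := (@fil C n gT omega rG eta).
Implicit Types (h : H) (m : M).

Definition sgM m : M := [ffun g => subst (-1)%:M (m g)].
Lemma sgM_linear : linear sgM.
Proof. by move=> b m m'; apply/ffunP => g; rewrite !ffunE linearP. Qed.
HB.instance Definition _ := GRing.isLinear.Build C M M _ sgM sgM_linear.

Lemma subst_opp_hom d (f : S) : hom d f -> subst (-1)%:M f = (-1) ^+ d *: f.
Proof.
elim: d f => [|d IH] f hf.
  by rewrite expr0 scale1r (hom0_const hf) substE comp_mpolyC.
have fE : f = d.+1%:R^-1 *: \sum_i 'X_i * f^`M(i).
  by rewrite (hom_euler hf) scalerA mulVf ?scale1r // pnatr_eq0.
rewrite [in LHS]fE [in RHS]fE linearZ linear_sum scalerA mulrC -scalerA scaler_sumr /=.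
congr (_ *: _); apply: eq_bigr => i _.
rewrite substM substX (IH _ (hom_mderiv i hf)) mul_scalar_mx linearZ /= lin_delta.
by rewrite exprS -scalerAl -scalerAr scalerA.
Qed.

Lemma low_sgM d m : low d m -> sgM m = (-1) ^+ d *: m.
Proof.
elim/low_ind2: d m => [||d IH] m /=; try by move=> ->; rewrite linear0 scaler0.
case=> m1 [hm1 l1]; rewrite -[m](subrK m1) linearD /= IH //.
rewrite !exprS mulrA mulN1r opprK mul1r [RHS]scalerDr; congr (_ + _).
by apply/ffunP => g; rewrite !ffunE (subst_opp_hom (hm1 g)).
Qed.

(** If h kills 1 (x) 1, its symbol lies in a level too low for its degree and is 0; so h drops two
    levels, and so on. *)
Lemma fil_act_eq0 d h : fil d h -> act h (dl 1 1) = 0 -> h = 0.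
Proof.
elim/low_ind2: d h => [||d IH] h; try by move/fil_low2 => ->.
case=> P s h0; apply: IH => //; apply: Sym0_fil; have <- // : P = 0.
apply: (@homM_low_eq0 _ _ _ d d); [by rewrite leqW | exact: Sym_homM s |].
have [_] := Sym_act isoG eta_central s.
by rewrite /= h0 sub0r => /(lowZ (-1)); rewrite scaleN1r opprK.
Qed.

Lemma fil_parity d j h : odd d != odd j -> fil d h -> fil j h -> h = 0.
Proof.
move=> dj fd fj; apply: (fil_act_eq0 fd).
have [P sP] := fd; have [Q sQ] := fj.
have [ld _] := Sym_act isoG eta_central sP; have [lj _] := Sym_act isoG eta_central sQ.
move: (act h _) ld lj => m ld lj; have := low_sgM ld; rewrite (low_sgM lj).
rewrite -(signr_odd _ d) -(signr_odd _ j).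
suff two (b : C) : b *: m = - b *: m -> b != 0 -> m = 0.
  by case: (odd d) (odd j) dj => [] [] // _; rewrite ?expr0 ?expr1 => e;
    apply: (two 1); rewrite ?oner_eq0 // scaleN1r -?scaleN1r -?e.
move=> /eqP; rewrite -subr_eq0 -scalerBl opprK -mulr2n scaler_eq0 mulrn_eq0 /=.
by move=> + b0; rewrite (negPf b0) => /eqP.
Qed.

(** [homogeneous] in terms of levels, a form in which the action of -1 on V separates the two
    parities. *)
Definition hp (b : bool) h := exists d, odd d = b /\ fil d h.

Lemma hp0 b : hp b 0. Proof. by exists b; split; [case: b | apply: fil0]. Qed.

Lemma hp_common b h h' : hp b h -> hp b h' -> exists d, [/\ odd d = b, fil d h & fil d h'].
Proof.
move=> [d [od fd]] [d' [od' fd']]; case: (leqP d d') => dd'.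
  by exists d'; split=> //; apply: fil_leq fd; rewrite // od.
by exists d; split=> //; apply: fil_leq fd'; rewrite ?(ltnW dd') // od.
Qed.

Lemma hp_lin b c h h' : hp b h -> hp b h' -> hp b (c *: h + h').
Proof.
by move=> p p'; have [d [od fd fd']] := hp_common p p'; exists d; split=> //; apply: fil_lin.
Qed.

Lemma hp_mul b b' h h' : hp b h -> hp b' h' -> hp (b (+) b') (h * h').
Proof.
move=> [d [od fd]] [d' [od' fd']]; exists (d + d')%N; rewrite oddD od od'; split=> //.
(* Raising one factor by two levels keeps the subtraction in [fil_mul] exact. *)
by have := fil_mul (fil_up fd) fd'; rewrite !addSn !subSS subn0.
Qed.

Lemma hp_vec x : hp true (hv x).
Proof.
exists 3; split=> //; exists (mX x (dl 1%g 1)).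
by rewrite -[hv x]mulr1 -sra_grp1; apply/Sym_vec/Sym_grp.
Qed.

Lemma hp_grp g : hp false (hg g).
Proof. by exists 2; split=> //; exists (dl g 1); apply: Sym_grp. Qed.

Lemma homogeneous_hp b h : homogeneous b h -> hp b h.
Proof.
elim=> {b h} [x|g|b|b c h h' _ p _ p'|b b' h h' _ p _ p'].
- exact: hp_vec.
- exact: hp_grp.
- exact: hp0.
- exact: hp_lin.
- exact: hp_mul.
Qed.

Lemma hp_homogeneous b h : hp b h -> homogeneous b h.
Proof.
case=> d [<- [P s]]; elim: s => {d h P} [d|d c h h' P P' _ p _ p'|g|d x h P _ p|d h P _ p] /=.
- exact: homogeneous_0.
- exact: homogeneous_lin.
- exact: homogeneous_grp.
- exact: (homogeneous_mul (homogeneous_vec _ _ _ x) p).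
- by rewrite negbK.
Qed.

Lemma hp_parity h : hp true h -> hp false h -> h = 0.
Proof.
by move=> [d [od fd]] [j [oj fj]]; apply: fil_parity fd fj; rewrite od oj.
Qed.

Lemma hp_split h : exists h0 h1, [/\ hp false h0, hp true h1 & h = h0 + h1].
Proof.
pose sp h := exists h0 h1, [/\ hp false h0, hp true h1 & h = h0 + h1].
have hpS b c h' : hp b h' -> hp b (c *: h').
  by move=> p; rewrite -[_ *: _]addr0; apply: hp_lin => //; apply: hp0.
have hpD b h' h'' : hp b h' -> hp b h'' -> hp b (h' + h'').
  by move=> p p'; rewrite -[h']scale1r; apply: hp_lin.
have even h' : hp false h' -> sp h'.
  by move=> p; exists h', 0; rewrite addr0; split=> //; apply: hp0.
have spZ c h' : sp h' -> sp (c *: h').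
  move=> [h0 [h1 [p0 p1 ->]]]; exists (c *: h0), (c *: h1); rewrite scalerDr.
  by split=> //; apply: hpS.
have spD h' h'' : sp h' -> sp h'' -> sp (h' + h'').
  move=> [h0 [h1 [p0 p1 ->]]] [h2 [h3 [p2 p3 ->]]].
  by exists (h0 + h2), (h1 + h3); rewrite addrACA; split=> //; apply: hpD.
have spM h' h'' : sp h' -> sp h'' -> sp (h' * h'').
  move=> [h0 [h1 [p0 p1 ->]]] [h2 [h3 [p2 p3 ->]]].
  exists (h0 * h2 + h1 * h3), (h0 * h3 + h1 * h2); split.
  - by apply: hpD; [apply: (hp_mul p0 p2) | apply: (hp_mul p1 p3)].
  - by apply: hpD; [apply: (hp_mul p0 p3) | apply: (hp_mul p1 p2)].
  by rewrite mulrDl !mulrDr [h1 * h2 + _]addrC addrACA.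
rewrite -/(sp h); elim/palg_ind: h; elim=> [[x|g]||s IH|s IHs t IHt||s IHs t IHt|c s IH].
- exists 0, (hv x); rewrite add0r; split=> //; [exact: hp0 | exact: hp_vec].
- exact/even/hp_grp.
- exact/even/hp0.
- by have := spZ (-1) _ IH; rewrite scaleN1r /GRing.opp /= palg_oppE.
- by have := spD _ _ IHs IHt; rewrite /GRing.add /= palg_addE.
- by rewrite -[pclass _ _]/(1 : H) -(sra_grp1 omega rG eta); apply/even/hp_grp.
- by have := spM _ _ IHs IHt; rewrite /GRing.mul /= palg_mulE.
- by have := spZ c _ IH; rewrite /GRing.scale /= palg_scaleE.
Qed.

End Parity.

(** * Uniqueness and existence of traces *)

Section Traces.
Variables (C : numFieldType) (n : nat) (gT : finGroupType).
Variables (omega : {skew_symmetric 'cV[C]_n}) (rG : mx_representation C [set: gT] n).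
Variable eta : gT -> C.
Hypothesis omega_nondeg : nondegenerate omega.
Hypothesis isoG : forall g x y, omega (rG g *m x) (rG g *m y) = omega x y.
Hypothesis eta_central :
  forall r g, r \in sreflections rG -> eta (r ^ g)%g = eta r.
Local Notation V := 'cV[C]_n.
Local Notation H := (sra omega rG eta).
Local Notation e_ i := (delta_mx i 0 : V).
Local Notation hv := (sra_vec omega rG eta).
Local Notation hg := (sra_grp omega rG eta).
Local Notation Sym := (@Sym C n gT omega rG eta).
Local Notation fil := (@fil C n gT omega rG eta).
Local Notation br := (@br C n gT omega rG eta).
Local Notation Dd := (@Dd C n gT omega rG eta).
Local Notation span0 := (@span0 C n gT omega rG eta).
Local Notation hp := (@hp C n gT omega rG eta).
Implicit Types (h : H) (u : 'I_n -> H) (g a : gT) (q : gT -> C).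

Lemma fil_hp d h : fil d h -> hp (odd d) h. Proof. by exists d. Qed.

Lemma span0_grp k h : span0 k h ->
  exists q, h = \sum_(g | fixdim rG k g == 0%N) q g *: hg g.
Proof.
move=> [Q [s Q0]]; exists (fun g => (Q g)@_0).
have /eqP : h - ell omega rG eta 0 Q = 0 by apply: (fil_low2 (Sym_sub_ell s)).
rewrite subr_eq0 => /eqP ->; rewrite /= [RHS]big_mkcond; apply: eq_bigr => g _.
by case: posnP => // Eg; rewrite Q0 // mcoeff0 scale0r.
Qed.

Lemma no_eigenvalueE k g : k * k = 1 ->
  (g \in no_eigenvalue rG k) = (fixdim rG k g == 0%N).
Proof.
move=> kk; rewrite inE negbK /fixdim mxrank_eq0; apply/eqP/eqP => [l0|p0].
  apply: mulmx_cV_inj => x; rewrite mul0mx; apply/eqP; rewrite -memv0 -l0 memv_ker.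
  rewrite add_lfunE opp_lfunE scale_lfunE id_lfunE gactE subr_eq0.
  have rGp : rG g *m fixp rG k g = k *: fixp rG k g.
    by rewrite -{2}(act_fixp rG kk) [k *: (_ *m _)]scalemxAl scalerA kk scale1r.
  by rewrite mulmxA rGp [k *: (_ *m _)]scalemxAl.
apply/eqP; rewrite -subv0; apply/subvP => x; rewrite memv_ker memv0.
rewrite add_lfunE opp_lfunE scale_lfunE id_lfunE gactE subr_eq0 => /eqP gx.
have : fixp rG k g *m x == x by rewrite fixpP // -scalemxAl gx scalerA kk scale1r.
by rewrite p0 mul0mx eq_sym.
Qed.

Section Uniqueness.
Variables (k : C) (t : H -> C^o).
Hypotheses (kk : k * k = 1) (t_lin : scalar t).
Hypothesis t_trace : forall (p q : bool) (f h : H), homogeneous p f -> homogeneous q h ->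
  t (f * h) = k ^+ (p && q) * t (h * f).

Let t0 : t 0 = 0.
Proof. by have := t_lin (-1) 0 0; rewrite scaler0 addr0 mulN1r addNr. Qed.
Let tD h h' : t (h + h') = t h + t h'.
Proof. by rewrite -[h]scale1r t_lin mul1r scale1r. Qed.
Let tZ b h : t (b *: h) = b * t h.
Proof. by rewrite -[_ *: h]addr0 t_lin t0 addr0. Qed.
Let tsum (I : Type) (r : seq I) (P : pred I) (F : I -> H) :
  t (\sum_(i <- r | P i) F i) = \sum_(i <- r | P i) t (F i).
Proof. by apply: big_morph. Qed.

Lemma trace_grp_conj g a : t (hg (g ^ a)%g) = t (hg g).
Proof.
rewrite conjgE sra_grpM (t_trace (homogeneous_grp _ _ _ _) (homogeneous_grp _ _ _ _)).
by rewrite /= expr0 mul1r -sra_grpM mulgK.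
Qed.

(** For even h the arguments of [Dd] are odd and the twist is k. For odd h they are even and the
    twist is 1; the leftover combination of group elements is then both even and odd, hence 0. *)
Lemma trace_eq0 : (forall g, fixdim rG k g = 0%N -> t (hg g) = 0) -> forall h, t h = 0.
Proof.
move=> tg; have tDd b u : (forall i, hp (~~ b) (u i)) -> t (Dd (k ^+ ~~ b) u) = 0.
  move=> pu; rewrite /Dd tsum big1 // => j _; rewrite brE -scaleNr tD tZ.
  rewrite (t_trace (homogeneous_vec _ _ _ _) (hp_homogeneous (pu j))) /=.
  by rewrite mulNr subrr.
move=> h; have [h0 [h1 [p0 p1 ->]]] := hp_split h.
rewrite tD; case: p0 => d [od fd]; case: p1 => d1 [od1 fd1].
have [u0 [s0 [fu0 ss0 ->]]] := span0_Dd_span omega_nondeg isoG kk fd.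
have k1 : (1 : C) * 1 = 1 by rewrite mulr1.
have [u1 [s1 [fu1 ss1 hE]]] := span0_Dd_span omega_nondeg isoG k1 fd1.
have tD1 : t (Dd 1 u1) = 0.
  rewrite -[1](expr0 k) -[X in k ^+ X]/(nat_of_bool (~~ true)).
  by apply: tDd => i; have := fil_hp (fu1 i); rewrite /= od1.
have tD0 : t (Dd k u0) = 0.
  rewrite -[k](expr1 k) -[X in k ^+ X]/(nat_of_bool (~~ false)).
  by apply: tDd => i; have := fil_hp (fu0 i); rewrite /= od.
have s10 : s1 = 0.
  apply: (hp_parity isoG eta_central); last first.
    by exists 2; split=> //; case: ss1 => Q [sQ _]; exists Q.
  have -> : s1 = -1 *: Dd 1 u1 + h1 by rewrite hE scaleN1r addrA addNr add0r.
  apply: hp_lin; last by exists d1.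
  exists d1.+2; rewrite /= negbK; split=> //.
  by apply: fil_sum => j _; have [P sP] := fu1 j; exists (kM rG 1 (e_ j) P); apply: Sym_br.
rewrite hE s10 addr0 tD1 addr0 tD tD0 add0r.
have [q ->] := span0_grp ss0; rewrite tsum big1 // => g /eqP Eg.
by rewrite tZ tg // mulr0.
Qed.

End Uniqueness.

(** * Extension of a class function to a trace *)

Section Existence.
Variable k : C.
Hypothesis kk : k * k = 1.
Local Notation E g := (fixdim rG k g).
Variable c : gT -> C.
Hypothesis c_class : forall g a, E g = 0%N -> c (g ^ a)%g = c g.

(* [trel h v]: modulo twisted commutators, conjugation and odd elements, [h] is
   a combination of group elements on which [c] extends to the value [v]. *)
Definition trel h (v : C) := exists u q h1,
  [/\ forall i, hp true (u i), hp true h1,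
      av (h - Dd k u - h1 - \sum_(g | E g == 0%N) q g *: hg g) = 0 &
      v = \sum_(g | E g == 0%N) q g * c g].

Lemma trel_lin b h h' v v' : trel h v -> trel h' v' -> trel (b *: h + h') (b * v + v').
Proof.
move=> [u [q [h1 [pu ph avh ->]]]] [u' [q' [h1' [pu' ph' avh' ->]]]].
exists (fun i => b *: u i + u' i), (fun g => b * q g + q' g), (b *: h1 + h1'); split.
- by move=> i; apply: hp_lin.
- exact: hp_lin.
- have -> : \sum_(g | E g == 0%N) (b * q g + q' g) *: hg g =
      b *: (\sum_(g | E g == 0%N) q g *: hg g) + \sum_(g | E g == 0%N) q' g *: hg g.
    by rewrite scaler_sumr -big_split; apply: eq_bigr => g _; rewrite scalerDl scalerA.
  rewrite Dd_lin !opprD (addrACA (b *: h)) (addrACA (b *: h - _)) (addrACA (b *: h - _ - _)) -!scalerBr.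
  by rewrite av_linear avh avh' scaler0 addr0.
by rewrite mulr_sumr -big_split; apply: eq_bigr => g _; rewrite mulrDl mulrA.
Qed.

Lemma hp_av b h : hp b h -> hp b (av h).
Proof.
move=> [d [od [P s]]]; exists d; split=> //; exists (#|gT|%:R^-1 *: \sum_a conjP rG a P).
by apply: SymZ; apply: Sym_sum => a _; apply: Sym_conj.
Qed.

(** This makes the extension well defined. The even part of the relation gives av (Dd u) = - av s,
    so both vanish by [span0_Dd_eq0]; then q sums to 0 over each class, where c is constant. *)
Lemma trel0 v : trel 0 v -> v = 0.
Proof.
move=> [u [q [h1 [pu ph avE ->]]]].
pose s := \sum_(g | E g == 0%N) q g *: hg g.
have Ss : Sym 2 s (\sum_(g | E g == 0%N) q g *: dl g 1).
  by apply: Sym_sum => g _; apply: SymZ; apply: Sym_grp.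
have ss : span0 k s.
  eexists; split; first exact: Ss.
  move=> g Eg; rewrite sum_ffunE big1 // => g' /eqP Eg'; rewrite !ffunE.
  by case: eqP Eg => [->|_ _]; rewrite ?Eg' // scaler0.
have [d [od fu]] : exists d, odd d = true /\ forall i, fil d (u i).
  have [D DP] := choice pu; have [K KP] : exists K, odd K /\ forall i, (D i <= K)%N.
    exists (\max_i D i).*2.+1; split=> [|i]; first by rewrite /= odd_double.
    rewrite ltnW // ltnS -addnn (leq_trans _ (leq_addr _ _)) //.
    exact: (leq_bigmax i).
  exists K; split=> [|i]; first exact: (proj1 KP).
  have [oD fD] := DP i; apply: fil_leq fD; first exact: (proj2 KP).
  by rewrite oD (proj1 KP).
have Dodd : hp false (Dd k u).
  exists d.+1; rewrite /= od; split=> //.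
  by apply: fil_sum => j _; have [P sP] := fu j; exists (kM rG k (e_ j) P); apply: Sym_br.
have seven : hp false s by exists 2; split=> //; exists (\sum_(g | E g == 0%N) q g *: dl g 1).
have avDs : av (Dd k u) + av s = 0.
  apply: (hp_parity isoG eta_central); last first.
    by rewrite -linearD -[Dd k u]scale1r /=; apply/hp_av/hp_lin.
  have -> : av (Dd k u) + av s = -1 *: av h1 + 0; last first.
    by apply: hp_lin; [apply: hp_av | apply: hp0].
  move: avE; rewrite -/s sub0r -!opprD linearN => /eqP; rewrite oppr_eq0 !linearD /=.
  by rewrite addrAC addr_eq0 => /eqP ->; rewrite scaleN1r addr0.
have avs : av s = 0.
  suff avD : av (Dd k u) = 0 by rewrite avD add0r in avDs.
  rewrite -av_idem -Dd_avT; apply: (span0_Dd_eq0 omega_nondeg isoG eta_central kk (j := d./2)).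
    move=> i; have -> : (d./2).*2.+1 = d by rewrite -[RHS]odd_double_half od.
    have [P sP] := choice fu; exists (avTP rG P i); exact: Sym_avT.
  have -> : Dd k (avT u) = av (- s).
    by rewrite Dd_avT linearN /=; apply/eqP; rewrite -addr_eq0 avDs.
  apply: span0_av; have [Q [sQ Q0]] := ss; exists (- Q); split; first exact: SymN.
  by move=> g Eg; rewrite ffunE Q0 // oppr0.
have sumq g : E g = 0%N -> \sum_a q (a^-1 * g * a)%g = 0.
  move=> Eg; have sav : Sym 2 (av s)
      (#|gT|%:R^-1 *: \sum_a conjP rG a (\sum_(g | E g == 0%N) q g *: dl g 1)).
    by apply: SymZ; apply: Sym_sum => a _; apply: Sym_conj.
  rewrite avs in sav; have := Sym_uniq isoG eta_central sav (Sym0 _ _ _ 2).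
  move/ffunP/(_ g); rewrite !ffunE sum_ffunE => /eqP; rewrite scaler_eq0 invr_eq0.
  rewrite (negPf (natr_card_neq0 C gT)) /= (eq_bigr (fun a => q (a^-1 * g * a)%g *: 1)) => [|a _].
    by rewrite -scaler_suml scaler_eq0 oner_eq0 orbF => /eqP.
  have Ega : E (a^-1 * g * a)%g = 0%N by rewrite -Eg -{2}[a]invgK fixdim_conj.
  rewrite ffunE sum_ffunE (bigD1 (a^-1 * g * a)%g) ?Ega //= big1 => [|g' /andP[_ g'g]].
    by rewrite addr0 ffunE dlE linearZ /= subst1.
  by rewrite !ffunE eq_sym (negPf g'g) scaler0.
(* Multiplied by |G|, the sum can be averaged over conjugations, which c does not see. *)
apply/eqP; rewrite -(inj_eq (mulfI (natr_card_neq0 C gT))) mulr0 mulr_natl -sumr_const.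
apply/eqP; transitivity (\sum_a \sum_(g | E g == 0%N) q (a^-1 * g * a)%g * c g).
  apply: eq_bigr => a _; have conjK : cancel (fun g => a^-1 * g * a)%g (fun g => a * g * a^-1)%g.
    by move=> g; rewrite !mulgA mulgV mul1g mulgK.
  rewrite (reindex_inj (can_inj conjK)); apply: eq_big => [g|g Eg].
    by rewrite -{2}[a]invgK fixdim_conj.
  rewrite -{2}[a]invgK fixdim_conj // in Eg.
  by rewrite /= -[c g](c_class a (eqP Eg)) conjgE mulgA.
rewrite exchange_big /= big1 // => g /eqP Eg.
by rewrite -mulr_suml sumq // mul0r.
Qed.

Lemma trel_ex h : exists v, trel h v.
Proof.
have [h0 [h1 [[d [od fd]] p1 ->]]] := hp_split h.
have [u [s [fu ss ->]]] := span0_Dd_span omega_nondeg isoG kk fd.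
have [q qE] := span0_grp ss; eexists; exists u, q, h1; split=> //.
  by move=> i; exists d.+1; rewrite /= od.
by rewrite -qE (addrAC _ h1) addrK (addrAC _ s) subrr add0r subrr linear0.
Qed.

Definition extension h : C^o := projT1 (cid (trel_ex h)).

Lemma extensionE h v : trel h v -> extension h = v.
Proof.
rewrite /extension; case: (cid _) => v' /= rv' rv.
have := trel_lin (-1) rv rv'; rewrite scaleN1r addNr mulN1r => /trel0/eqP.
by rewrite addrC subr_eq0 => /eqP.
Qed.

Lemma extension_scalar : scalar extension.
Proof.
move=> b h h'; have [v rv] := trel_ex h; have [v' rv'] := trel_ex h'.
by rewrite (extensionE rv) (extensionE rv') (extensionE (trel_lin b rv rv')).
Qed.

Let D0 : Dd k (fun=> 0) = 0.
Proof. by rewrite /Dd big1 // => i _; rewrite linear0. Qed.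

Let trel_av h : av h = 0 -> extension h = 0.
Proof.
move=> avh; apply: extensionE; exists (fun=> 0), (fun=> 0), 0; split.
- by move=> i; apply: hp0.
- exact: hp0.
- by rewrite D0 !subr0 big1 ?subr0 // => g _; rewrite scale0r.
by rewrite big1 // => g _; rewrite mul0r.
Qed.

Lemma extension_grp g : E g = 0%N -> extension (hg g) = c g.
Proof.
move=> Eg; apply: extensionE; exists (fun=> 0), (fun a => (a == g)%:R), 0; split.
- by move=> i; apply: hp0.
- exact: hp0.
- rewrite D0 !subr0 (bigD1 g) ?Eg //= eqxx scale1r big1 ?addr0 ?subrr ?linear0 // => a /andP[_ ag].
  by rewrite (negPf ag) scale0r.
rewrite (bigD1 g) ?Eg //= eqxx mul1r big1 ?addr0 // => a /andP[_ ag].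
by rewrite (negPf ag) mul0r.
Qed.

Lemma extension_odd h : hp true h -> extension h = 0.
Proof.
move=> ph; apply: extensionE; exists (fun=> 0), (fun=> 0), h; split=> //.
- by move=> i; apply: hp0.
- by rewrite D0 subr0 subrr big1 ?subr0 ?linear0 // => g _; rewrite scale0r.
by rewrite big1 // => g _; rewrite mul0r.
Qed.

Lemma extension_vec x h : hp true h -> extension (hv x * h) = k * extension (h * hv x).
Proof.
move=> ph; apply/eqP; rewrite -subr_eq0; apply/eqP.
have -> : extension (hv x * h) - k * extension (h * hv x) = extension (br k x h).
  by rewrite brE [in RHS]addrC -[in RHS]scaleNr extension_scalar mulNr addrC.
apply: extensionE; exists (fun j => x j 0 *: h), (fun=> 0), 0; split.
- by move=> j; rewrite -[_ *: h]addr0; apply: hp_lin => //; apply: hp0.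
- exact: hp0.
- rewrite subr0 [X in _ - X]big1 ?subr0 => [|g _]; last by rewrite scale0r.
  rewrite (_ : Dd k _ = br k x h) ?subrr ?linear0 //.
  rewrite [in RHS](vec_sum_delta x) br_suml; apply: eq_bigr => j _.
  by rewrite linearZ.
by rewrite big1 // => g _; rewrite mul0r.
Qed.

Lemma extension_grp_comm a h : extension (hg a * h) = extension (h * hg a).
Proof.
apply/eqP; rewrite -subr_eq0; apply/eqP.
have -> : extension (hg a * h) - extension (h * hg a) = extension (hg a * h - h * hg a).
  by rewrite addrC -mulN1r -extension_scalar scaleN1r addrC.
by apply: trel_av; rewrite linearB /= av_comm_grp subrr.
Qed.

(** The letters of f are moved around h one at a time, each vector at the cost of a factor k; k^2 =
    1 reduces the power to the parity. *)
Lemma extension_trace p f h : hp p f -> hp p h -> extension (f * h) = k ^+ p * extension (h * f).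
Proof.
case=> d [<- [P s]]; elim: s h => {d f P} [d|d b f f' P P' _ IH _ IH'|g|d x f P s IH|d f P _ IH] h ph /=.
- by rewrite mul0r mulr0 extension_odd ?mulr0 //; apply: hp0.
- rewrite mulrDl mulrDr -sra_scalerAl -sra_scalerAr !extension_scalar IH // IH' //.
  by rewrite mulrDr mulrCA.
- by rewrite expr0 mul1r extension_grp_comm.
- have pf : hp (odd d) f by exists d; split=> //; exists P.
  rewrite -mulrA extension_vec; last first.
    by have := hp_mul pf ph; rewrite /= addbN addbb.
  rewrite -mulrA IH; last first.
    by have := hp_mul ph (hp_vec omega rG eta x); rewrite /= addbT negbK.
  by rewrite !mulrA; case: (odd d); rewrite ?expr1 ?expr0 ?mulr1 ?kk.
- by rewrite negbK; apply: IH; rewrite /= negbK in ph.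
Qed.

Lemma extension_is_ktrace : is_ktrace k extension.
Proof.
split=> [|p q f h /homogeneous_hp pf /homogeneous_hp ph]; first exact: extension_scalar.
case: (eqVneq p q) => [pq|pq].
  by rewrite -pq andbb; apply: extension_trace => //; rewrite pq.
rewrite !extension_odd ?mulr0 //.
  by have := hp_mul ph pf; case: p q pq {pf ph} => [] [].
by have := hp_mul pf ph; case: p q pq {pf ph} => [] [].
Qed.

End Existence.
End Traces.

(** * The space of traces and its dimension *)

Section KTraces.
Variables (C : numFieldType) (n : nat) (gT : finGroupType).
Variables (omega : {skew_symmetric 'cV[C]_n}) (rG : mx_representation C [set: gT] n).
Variables (eta : gT -> C) (k : C).
Hypothesis omega_nondeg : nondegenerate omega.
Hypothesis isoG : forall g x y, omega (rG g *m x) (rG g *m y) = omega x y.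
Hypothesis eta_central :
  forall r g, r \in sreflections rG -> eta (r ^ g)%g = eta r.
Hypothesis kk : k * k = 1.
Local Notation hg := (sra_grp omega rG eta).
Local Notation NE := (no_eigenvalue rG k).
Local Notation T := (ktrace omega rG eta k).
Implicit Types (sp : T) (c : gT -> C) (g a : gT).

Lemma ktraceP sp : is_ktrace k sp.
Proof. by case: sp => f /= /asboolP. Qed.

Lemma ktrace_conj sp g a : sp (hg (g ^ a)%g) = sp (hg g).
Proof. by have [_ tr] := ktraceP sp; apply: (trace_grp_conj tr). Qed.

Lemma ktrace_inj sp sp' : {in NE, forall g, sp (hg g) = sp' (hg g)} -> sp = sp'.
Proof.
move=> eq_sp; apply/eqP; rewrite -subr_eq0; apply/eqP/val_inj/funext => h.
have [lin tr] := ktraceP (sp - sp').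
apply: (trace_eq0 omega_nondeg isoG eta_central kk lin tr) => g /eqP.
by rewrite -no_eigenvalueE // => /eq_sp eq_g; rewrite [LHS](_ : _ = sp (hg g) - sp' (hg g)) // eq_g subrr.
Qed.

Lemma ktrace_ex c : (forall g a, g \in NE -> c (g ^ a)%g = c g) ->
  exists sp, {in NE, forall g, sp (hg g) = c g}.
Proof.
move=> c_class; have cE g a : fixdim rG k g = 0%N -> c (g ^ a)%g = c g.
  by move/eqP; rewrite -no_eigenvalueE //; apply: c_class.
have ext := extension_is_ktrace omega_nondeg isoG eta_central kk cE.
exists (KTrace (introT (asboolP _) ext)) => g.
by rewrite no_eigenvalueE // => /eqP; apply: extension_grp.
Qed.

(** Evaluation at one representative of each class is injective by uniqueness and onto by
    existence. *)
Lemma ktrace_has_dim :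
  has_dim T #|[set X in classes [set: gT] | X \subset NE]|.
Proof.
set K := [set X in _ | _]; have NEJ g a : (g ^ a \in NE)%g = (g \in NE).
  by rewrite !no_eigenvalueE // conjgE mulgA -{2}[a]invgK fixdim_conj.
have clK g : g \in NE -> (g ^: [set: gT])%g \in K.
  move=> gNE; rewrite inE mem_classes ?inE //; apply/subsetP => _ /imsetP[a _ ->].
  by rewrite NEJ.
have reprK (X : {set gT}) : X \in K -> repr X \in NE.
  by rewrite inE => /andP[clX /subsetP]; apply; apply: (mem_repr_classes clX).
pose f sp : 'rV_#|K| := \row_i sp (hg (repr (enum_val i))).
have reprE sp g : sp (hg (repr (g ^: [set: gT])%g)) = sp (hg g).
  by have [a _ ->] := repr_class [set: gT]%G g; rewrite ktrace_conj.
have f_lin : linear f by move=> b sp sp'; apply/rowP => i; rewrite !mxE.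
have f_inj : injective f.
  move=> sp sp' /rowP eqf; apply: ktrace_inj => g gNE.
  have := eqf (enum_rank_in (clK g gNE) (g ^: [set: gT])%g).
  by rewrite !mxE enum_rankK_in ?clK // !reprE.
have f_surj v : exists sp, f sp = v.
  (* The default 0 is reached only at elements with eigenvalue k. *)
  pose c g := oapp (fun i => v 0 i) 0 [pick i | enum_val i == (g ^: [set: gT])%g].
  have [g a _|sp spE] := @ktrace_ex c; first by rewrite /c classGidl ?inE.
  exists sp; apply/rowP => i; rewrite !mxE spE /c ?reprK ?enum_valP //.
  have clX : enum_val i \in classes [set: gT] by have := enum_valP i; rewrite inE => /andP[].
  have [_ <-] := repr_classesP clX.
  case: pickP => [j /eqP/enum_val_inj -> //|/(_ i)]; by rewrite eqxx.
have [finv finvK] := choice f_surj.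
constructor; exists f => //; exists finv => // sp.
by apply: f_inj; rewrite finvK.
Qed.

End KTraces.

Theorem theorem5p1 (R : realType) (N : nat) (gT : finGroupType)
    (omega : {skew_symmetric 'cV[R[i]]_(N.*2)})
    (rG : mx_representation R[i] [set: gT] N.*2)
    (eta : gT -> R[i]) (kappa : R[i])
    (omega_nondeg : nondegenerate omega)
    (G_srg : symplectic_reflection_group omega rG)
    (eta_central : forall r g : gT,
       r \in sreflections rG -> eta (r ^ g)%g = eta r)
    (kappa_pm1 : kappa = 1 \/ kappa = -1) :
  has_dim (ktrace omega rG eta kappa)
    #|[set X in classes [set: gT] | X \subset no_eigenvalue rG kappa]|
  /\
  forall c : gT -> R[i],
    (forall g h : gT, g \in no_eigenvalue rG kappa -> c (g ^ h)%g = c g) ->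
    exists! sp : ktrace omega rG eta kappa,
      forall g : gT, g \in no_eigenvalue rG kappa ->
        sp (sra_grp omega rG eta g) = c g.
Proof.
have isoG g x y : omega (rG g *m x) (rG g *m y) = omega x y.
  by case: G_srg => _ iso _; rewrite -[RHS](iso g) !gactE.
have kk : kappa * kappa = 1 by case: kappa_pm1 => ->; rewrite ?mulr1 // mulrNN mulr1.
split=> [|c c_class].
  exact: (ktrace_has_dim omega_nondeg isoG eta_central kk).
have [sp spE] := ktrace_ex omega_nondeg isoG eta_central kk c_class.
exists sp; split=> // sp' sp'E.
by apply: (ktrace_inj omega_nondeg isoG eta_central kk) => g gNE; rewrite spE // sp'E.
Qed.
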